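(* For every $a\in\mathbb{C}$, the set $\tilde{E}(f_a)\cup\{\infty\}$ is connected (as a subspace of the Riemann sphere), where $f_a(z)=e^z+a$ and $\tilde{E}(f_a)$ is the set of escaping endpoints of $f_a$.
   Context: For $a\in\mathbb{C}$, $f_a\colon\mathbb{C}\to\mathbb{C}$, $f_a(z)=e^z+a$. $I(f_a)=\{z\in\mathbb{C}: f_a^n(z)\to\infty\}$ is the escaping set. An arc is an injective continuous image of a compact interval (parametrised injectively). A point $z_0\in\mathbb{C}$ is on a hair if there is an arc $\gamma\colon[-1,1]\to I(f_a)$ with $\gamma(0)=z_0$. A point $z_0\in\mathbb{C}$ is an endpoint if $z_0$ is not on a hair and there is an arc $\gamma\colon[0,1]\to\mathbb{C}$ with $\gamma(0)=z_0$ and $\gamma(t)\in I(f_a)$ for all $t>0$. $E(f_a)$ is the set of endpoints, and $\tilde{E}(f_a)=E(f_a)\cap I(f_a)$ is the set of escaping endpoints. *)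

(* Defs.v *)
From HB Require Import structures.
From mathcomp Require Import all_boot all_order all_algebra.
From mathcomp Require Import complex.
From mathcomp Require Import all_classical all_reals all_analysis.

Set Implicit Arguments.
Unset Strict Implicit.
Unset Printing Implicit Defensive.

Import Order.TTheory GRing.Theory Num.Theory.
Import numFieldNormedType.Exports.

Local Open Scope classical_set_scope.
Local Open Scope ring_scope.
Local Open Scope complex_scope.

(* The regular-algebra alias [^o] is what carries the topology of the modulus
   on [R[i]]; on the bare type [R[i]] no topology is inferred. *)
Notation cplane R := (R[i]^o).

(* [Some z] is the finite point [z], [None] is the point at infinity. *)
Notation riemann_sphere R := (one_point_compactification (cplane R)).

Definition cexp (R : realType) (z : cplane R) : cplane R :=
  (expR (complex.Re z) * cos (complex.Im z))
    +i* (expR (complex.Re z) * sin (complex.Im z)).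

Definition expmap (R : realType) (a z : cplane R) : cplane R := cexp z + a.

Definition escaping_set (R : realType) (a : cplane R) : set (cplane R) :=
  [set z | (Some (iter n (expmap a) z) : riemann_sphere R) @[n --> \oo]
             --> (None : riemann_sphere R)].

(* Only the restriction of [g] to [[s, t]] matters. *)
Definition is_arc (R : realType) (s t : R) (g : R -> cplane R) : Prop :=
  {within `[s, t], continuous g} /\ {in `[s, t] &, injective g}.

Definition on_hair (R : realType) (a z0 : cplane R) : Prop :=
  exists g : R -> cplane R,
    [/\ is_arc (-1) 1 g,
        g @` `[-1, 1] `<=` escaping_set a &
        g 0 = z0].

Definition endpoints (R : realType) (a : cplane R) : set (cplane R) :=
  [set z0 | ~ on_hair a z0 /\
     exists g : R -> cplane R,
       [/\ is_arc 0 1 g,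
           g 0 = z0 &
           g @` `]0, 1] `<=` escaping_set a]].

Definition escaping_endpoints (R : realType) (a : cplane R) :
    set (cplane R) :=
  endpoints a `&` escaping_set a.

(* Main.v *)
Require Import Defs.
From HB Require Import structures.
From mathcomp Require Import all_boot all_order all_algebra.
From mathcomp Require Import complex.
From mathcomp Require Import all_classical all_reals all_analysis.
From mathcomp Require Import ring lra zify.

(** An orbit staying in a far right half plane is coded by the components
    of the set where [cos (im z) > 0] that it visits. Since [f] expands there, of two distinct points
    with the same code one eventually runs arbitrarily far ahead of the other, so the
    points with a given code are linearly ordered by [slower], and from a point [u]
    a ray of ever faster points with the same code is obtained by pulling back.

    Every arc of escaping points is, from a common time on, contained in the half plane.
    By a Baire argument it suffices to exclude that the time needed tends to infinity
    only at one end of the arc. A piece of a late iterate on which the imaginary part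
    varies by [4 pi] would contain points with different codes, which is impossible;
    so the late iterates stay close to the orbit of the end point, and contraction gives
    a contradiction. Hence arcs are monotone for the order, and a point of the half plane
    which is minimal among the points with its code is an endpoint.

    Every bounded open set [U] meeting the escaping endpoints has one on its boundary.
    An iterate of [U] contains a point whose orbit stays far up. Follow its ray until it
    leaves the iterate, and just before move to a nearby point whose orbit leaves that of
    the ray at a late time [n] and then stays close to an almost fixed point [b]. No point
    in the same strips can be much further left at time [n]. Iterating this with [n]
    tending to infinity, a cluster point lies on the boundary, escapes and is minimal.
    Endpoints pull back under [f], which gives one on the boundary of [U].

    A separation of the set in the theorem would contradict this: take for [U] the union of
    half-sized balls around the points of the piece not containing [None]. *)

(** Hairs and endpoints are defined through arbitrary arcs of escaping points, and nothing bounds a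
    priori the time such an arc needs to enter the half plane. The results up to [arc_uniform] serve
    to bound it. After that an arc has an iterate that is a path of points with one code, on which
    [slower] is a linear order, and it behaves like an injective path in the real line.

    The boundary endpoint is a limit, so what is asked of it must survive limits. Escape does not,
    but lower bounds on the imaginary parts along an orbit do, and they depend only on the code.
    Since the distance of [f z] to [a] is the exponential of [re z], a large imaginary part forces a
    large real part one step earlier; bounds [thr (K0 + j)] valid from later and later times thus
    give escape. Minimality survives for another reason: a gap of 2 between real parts of orbits in
    common strips grows at the next step to [KK] and persists, so a point slower than the limit
    would still lag when the approximating orbit turns to its almost fixed point, where there is no
    room on the left. *)

Set Implicit Arguments.
Unset Strict Implicit.
Unset Printing Implicit Defensive.

Import Order.TTheory GRing.Theory Num.Theory.
Import numFieldNormedType.Exports.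

Local Open Scope classical_set_scope.
Local Open Scope ring_scope.

(* [lra] is very slow in a large context. *)
Ltac clear_props := repeat match goal with
  | H : ?T |- _ => lazymatch type of T with Prop => clear H end
  end.

Tactic Notation "lra_from" ne_hyp_list(hs) := revert hs; clear_props; intros; lra.

(** * Real inequalities *)

Section RealLemmas.
Variable R : realType.
Implicit Types x y t : R.

(* Case analysis on these does not abstract the comparison in the goal, which is
   what makes [leP] and [ltP] slow. *)
Lemma le_or_lt x y : x <= y \/ y < x.
Proof. by case: leP; [left|right]. Qed.

Lemma lt_or_le x y : x < y \/ y <= x.
Proof. by case: ltP; [left|right]. Qed.

Lemma itv_sub c d x y s : c <= x -> y <= d -> x <= s <= y -> c <= s <= d.
Proof. by move=> cx yd /andP[/(le_trans cx) -> /le_trans ->]. Qed.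

Lemma pi_le4 : (pi : R) <= 4.
Proof. have := @pihalf_lt2 R; lra. Qed.

(** On [[0, 1]] the mean value theorem gives [sin u = u cos c] with
    [cos c = 1 - 2 sin^2 (c / 2) >= 1 / 2]; beyond 1, monotonicity of the sine and [pi / 2 < 2]
    suffice. *)
Lemma sin_ge_quarter t : 0 <= t <= pi / 2 -> t / 4 <= sin t.
Proof.
have half (u : R) : 0 <= u <= 1 -> u / 2 <= sin u.
  move=> /andP[u0 u1]; have [->|un0] := eqVneq u 0; first by rewrite sin0 mul0r.
  have {un0 u0} u0 : 0 < u by rewrite lt_def un0.
  have [|c /itvP cu] := @MVT_segment R sin cos 0 u (ltW u0).
    by apply: continuous_subspaceT => x; exact: continuous_sin.
  rewrite sin0 !subr0 => ->; rewrite mulrC ler_pM2r//.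
  suff : 1 <= cos c + cos c by lra.
  have -> : c = (c / 2) *+ 2 by rewrite mulr2n; lra.
  rewrite cos_mulr2n cos2sin2.
  have c20 : 0 <= c / 2 by rewrite divr_ge0// ?cu.
  have [|e /itvP ec] := @MVT_segment R sin cos 0 (c / 2) c20.
    by apply: continuous_subspaceT => x; exact: continuous_sin.
  rewrite sin0 !subr0 => ->; rewrite mulr2n.
  have c0 : 0 <= c by rewrite cu.
  have c1 : c <= 1 by apply: le_trans u1; rewrite cu.
  have e1 := cos_le1 e; have e2 := cos_geN1 e.
  have : cos e ^+ 2 <= 1 by rewrite -(cos2Dsin2 e) lerDl sqr_ge0.
  rewrite exprMn; set q := cos e ^+ 2 => q1.
  have q0 : 0 <= q by rewrite sqr_ge0.
  have c2 : c ^+ 2 <= 1 by rewrite expr_le1.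
  have : q * c ^+ 2 <= 1 by rewrite mulr_ile1// sqr_ge0.
  have -> : (c / 2) ^+ 2 = c ^+ 2 / 4 by field.
  move=> qc; lra.
move=> /andP[t0 t1]; have [tl|tg] := le_or_lt t 1.
  by have := half t; rewrite t0 tl => /(_ isT); lra.
have p1 := @pihalf_ge1 R; have p2 := @pihalf_lt2 R.
have : 1 / 2 <= sin (1 : R) by apply: half; lra.
suff : sin (1 : R) <= sin t by lra.
rewrite leNgt; apply/negP; rewrite ltr_sin ?in_itv /= => [|//|]; lra.
Qed.

Lemma cos_between x y t : 0 < cos x -> 0 < cos y -> x <= t <= y -> y - x < pi ->
  0 < cos t.
Proof.
move=> cx cy /andP[xt ty] xy.
have [->//|xt'] := eqVneq t x; have [->//|ty'] := eqVneq t y.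
have {}xt : x < t by rewrite lt_def xt'.
have {}ty : t < y by rewrite lt_def eq_sym ty'.
have s1 : 0 < sin (y - x) by apply: sin_gt0_pi; lra.
have s2 : 0 < sin (y - t) by apply: sin_gt0_pi; lra.
have s3 : 0 < sin (t - x) by apply: sin_gt0_pi; lra.
have E : sin (y - x) * cos t = sin (y - t) * cos x + sin (t - x) * cos y.
  by rewrite !sinB; ring.
by rewrite -(pmulr_rgt0 _ s1) E addr_gt0 ?mulr_gt0.
Qed.

(** The components of the set where the cosine is positive are intervals of length [pi] separated by
    gaps of length [pi]. For points of this set, being closer than [pi] therefore means lying in one
    component. *)
Lemma strip_trans x y t : 0 < cos x -> 0 < cos y -> 0 < cos t ->
  `|x - y| < pi -> `|y - t| < pi -> `|x - t| < pi.
Proof.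
move=> cx cy ct xy yt.
have key (u v : R) : 0 < cos u -> u < v -> (forall w, u <= w <= v -> 0 < cos w) ->
    v - u < pi.
  move=> cu uv H; rewrite ltNge; apply/negP => l.
  have := H (u + pi); rewrite cosDpi => /(_ _); have := @pi_gt0 R.
  move=> p H2.
  have /H2 : u <= u + pi <= v by apply/andP; split; lra.
  lra.
have mono (u v w : R) : 0 < cos u -> 0 < cos v -> 0 < cos w -> `|u - v| < pi ->
   `|v - w| < pi -> u < w -> w - u < pi.
  move=> cu cv cw; rewrite !ltr_norml => /andP[? ?] /andP[? ?] uw.
  have [vu|uv] := le_or_lt v u; first lra.
  have [wv|vw] := le_or_lt w v; first lra.
  apply: key => // s /andP[us sw]; have [sv|vs] := le_or_lt s v.
    by apply: (@cos_between u v); rewrite ?us ?sv//; lra.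
  by apply: (@cos_between v w); rewrite ?sw ?(ltW vs)//; lra.
have [xt|tx|->] := ltgtP x t; last by rewrite subrr normr0 pi_gt0.
- rewrite ltr_norml; have := mono x y t cx cy ct xy yt xt; lra.
- rewrite ltr_norml; rewrite distrC in xy; rewrite distrC in yt.
  have := mono t y x ct cy cx yt xy tx; lra.
Qed.

(** The identity [cos (x + pi) = - cos x] excludes the distance [pi]. Preimages chosen modulo [2 pi]
    and limits of strict bounds only give [<= pi]; strictness is restored here. *)
Lemma strip_neq_pi x y : 0 < cos x -> 0 < cos y -> `|x - y| <= pi ->
  `|x - y| < pi.
Proof.
move=> cx cy; rewrite le_eqVlt => /orP[/eqP xy|//].
have [yx|xy'] := le_or_lt y x.
  have E : x = y + pi by rewrite -xy ger0_norm; lra.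
  by move: cx; rewrite E cosDpi; lra.
have E : y = x + pi by rewrite -xy ler0_norm; lra.
by move: cy; rewrite E cosDpi; lra.
Qed.

Lemma periodic_shift x y : exists t, [/\ cos t = cos x, sin t = sin x &
  `|t - y| <= pi].
Proof.
have p0 := @pi_gt0 R.
have P (f : R -> R) : periodic f (pi *+ 2) -> forall (k : int) u,
    f (u + (pi *+ 2) *~ k) = f u.
  move=> pf [n|n] u; first exact: periodicn.
  by rewrite NegzE mulrNz -(periodicn pf n.+1) addrNK.
pose k := Num.floor ((y - x + pi) / (pi *+ 2)).
have p2 : 0 < (pi : R) *+ 2 by rewrite mulrn_wgt0.
exists (x + (pi *+ 2) *~ k); split.
- by apply: P; exact: cosD2pi.
- by apply: P; exact: sinD2pi.
have := floor_le_tmp ((y - x + pi) / (pi *+ 2)).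
have := lt_succ_floor ((y - x + pi) / (pi *+ 2)).
rewrite -/k ltr_pdivrMr// ler_pdivlMr// intrD.
have -> : (pi : R) *+ 2 *~ k = k%:~R * (pi *+ 2) by rewrite mulrzl.
rewrite ler_norml mulr2n => *; apply/andP; split; lra.
Qed.

Lemma polar_unit x y : x ^+ 2 + y ^+ 2 = 1 -> exists t, cos t = x /\ sin t = y.
Proof.
move=> xy.
have x1 : -1 <= x <= 1 by nra.
have E : Num.sqrt (1 - x ^+ 2) = `|y|.
  by rewrite -xy addrAC subrr add0r sqrtr_sqr.
have [y0|y0] := le_or_lt 0 y.
  exists (acos x); rewrite sin_acos// E ger0_norm//.
  by rewrite acosK// in_itv /=.
exists (- acos x); rewrite cosN sinN sin_acos// E ltr0_norm// opprK.
by rewrite acosK// in_itv /=.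
Qed.

End RealLemmas.

(** * Paths in the plane *)

Section Paths.
Variable R : realType.
Local Notation C := (cplane R).
Local Notation "'re' z" := (complex.Re (z : R[i]%C)) (at level 10, z at level 8).
Local Notation "'im' z" := (complex.Im (z : R[i]%C)) (at level 10, z at level 8).
Implicit Types (z w p q : C) (x y t s e m c d : R) (g : R -> C) (h : R -> R).

Lemma cplane_eq z w : re z = re w -> im z = im w -> z = w.
Proof. by case: z => ? ?; case: w => ? ? /= -> ->. Qed.

(* This distance induces the topology of the modulus and keeps all estimates linear. *)
Definition dist1 z w : R := `|re z - re w| + `|im z - im w|.

Lemma dist1_ge0 z w : 0 <= dist1 z w.
Proof. by rewrite addr_ge0. Qed.

Lemma dist1C z w : dist1 z w = dist1 w z.
Proof. by rewrite /dist1 distrC [X in _ + X]distrC. Qed.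

Lemma dist1_tri z w p : dist1 z p <= dist1 z w + dist1 w p.
Proof.
rewrite /dist1; have := ler_distD (re w) (re z) (re p).
by have := ler_distD (im w) (im z) (im p); lra.
Qed.

Lemma dist1_xx z : dist1 z z = 0.
Proof. by rewrite /dist1 !subrr !normr0 addr0. Qed.

Lemma dist1_eq0 z w : dist1 z w <= 0 -> z = w.
Proof.
move=> h; have h1 := normr_ge0 (re z - re w); have h2 := normr_ge0 (im z - im w).
have [e1 e2] : `|re z - re w| <= 0 /\ `|im z - im w| <= 0.
  by move: h; rewrite /dist1; split; lra.
move: e1 e2; rewrite !normr_le0 !subr_eq0 => /eqP e1 /eqP e2.
exact: cplane_eq.
Qed.

Lemma dist1_small z w : (forall e, 0 < e -> dist1 z w <= e) -> z = w.
Proof.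
move=> h; apply: dist1_eq0; rewrite leNgt; apply/negP => h0.
have := h (dist1 z w / 2); rewrite divr_gt0// => /(_ isT); lra.
Qed.

Lemma re_dist1 z w : `|re z - re w| <= dist1 z w.
Proof. by rewrite lerDl. Qed.

Lemma im_dist1 z w : `|im z - im w| <= dist1 z w.
Proof. by rewrite lerDr. Qed.

Lemma expand_lt x y m : m <= expR y -> x - y >= 0 -> m * (x - y) <= expR x - expR y.
Proof.
move=> my xy; have -> : expR x = expR y * expR (x - y) by rewrite -expRD addrC subrK.
have := expR_ge1Dx (x - y); have := expR_gt0 y => ? ?.
have : expR y * (x - y) <= expR y * (expR (x - y) - 1) by rewrite ler_pM2l//; lra.
have : m * (x - y) <= expR y * (x - y) by rewrite ler_wpM2r.
by rewrite mulrBr; lra.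
Qed.

Definition contC (G : C -> C) := forall z e, 0 < e ->
  exists2 r, 0 < r & forall w, dist1 w z < r -> dist1 (G w) (G z) < e.

Definition contp g c d := forall t, c <= t <= d -> forall e, 0 < e ->
  exists2 r, 0 < r & forall s, c <= s <= d -> `|s - t| < r ->
    dist1 (g s) (g t) < e.

Definition contr h c d := forall t, c <= t <= d -> forall e, 0 < e ->
  exists2 r, 0 < r & forall s, c <= s <= d -> `|s - t| < r -> `|h s - h t| < e.

Lemma contC_comp G H : contC G -> contC H -> contC (G \o H).
Proof.
move=> cG cH z e e0; have [r r0 Gr] := cG (H z) e e0.
by have [r' r'0 Hr] := cH z r r0; exists r' => // w /Hr /Gr.
Qed.

Lemma contp_comp G g c d : contC G -> contp g c d -> contp (G \o g) c d.
Proof.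
move=> cG cg t tcd e e0; have [r r0 Gr] := cG (g t) e e0.
by have [r' r'0 Hr] := cg t tcd r r0; exists r' => // w wcd /(Hr w wcd) /Gr.
Qed.

Lemma contp_re g c d : contp g c d -> contr (fun t => re (g t)) c d.
Proof.
move=> cg t tcd e e0; have [r r0 H] := cg t tcd e e0; exists r => // s scd st.
by apply: le_lt_trans (H s scd st); exact: re_dist1.
Qed.

Lemma contp_im g c d : contp g c d -> contr (fun t => im (g t)) c d.
Proof.
move=> cg t tcd e e0; have [r r0 H] := cg t tcd e e0; exists r => // s scd st.
by apply: le_lt_trans (H s scd st); exact: im_dist1.
Qed.

Lemma contp_dist g p c d : contp g c d -> contr (fun t => dist1 (g t) p) c d.
Proof.
move=> cg t tcd e e0; have [r r0 H] := cg t tcd e e0; exists r => // s scd st.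
apply: le_lt_trans (H s scd st); rewrite ler_norml.
have := dist1_tri (g s) (g t) p; have := dist1_tri (g t) (g s) p.
by rewrite (dist1C (g t) (g s)) => *; apply/andP; split; lra.
Qed.

Lemma contp_sub g c d c' d' : c <= c' -> d' <= d -> contp g c d -> contp g c' d'.
Proof.
move=> cc dd cg t /andP[t1 t2] e e0; have [|r r0 H] := cg t _ e e0.
  by rewrite (le_trans cc)//= (le_trans t2).
by exists r => // s /andP[s1 s2]; apply: H; rewrite (le_trans cc)//= (le_trans s2).
Qed.

Lemma contr_sub h c d c' d' : c <= c' -> d' <= d -> contr h c d -> contr h c' d'.
Proof.
move=> cc dd cg t /andP[t1 t2] e e0; have [|r r0 H] := cg t _ e e0.
  by rewrite (le_trans cc)//= (le_trans t2).
by exists r => // s /andP[s1 s2]; apply: H; rewrite (le_trans cc)//= (le_trans s2).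
Qed.

Lemma contr_within h c d : contr h c d -> {within `[c, d], continuous h}.
Proof.
move=> ch; apply/subspace_continuousP => x /=; rewrite in_itv /= => xcd.
apply/cvgrPdist_lt => e e0; have [r r0 H] := ch x xcd e e0.
have : \forall s \near x, `|x - s| < r by apply/nbhs_ballP; exists r.
rewrite near_withinE; apply: filterS => s sr.
rewrite /= in_itv /= => scd.
by rewrite distrC; apply: H => //; rewrite distrC.
Qed.

Lemma contr_IVT h c d v : c <= d -> contr h c d ->
  Num.min (h c) (h d) <= v <= Num.max (h c) (h d) -> exists2 t, c <= t <= d & h t = v.
Proof.
move=> cd /contr_within ch hv; have [t tcd <-] := IVT cd ch hv.
by exists t => //; move: tcd; rewrite in_itv.
Qed.

Lemma contr_IVT_up h c d v : c <= d -> contr h c d -> h c <= v -> v <= h d ->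
  exists2 t, c <= t <= d & h t = v.
Proof.
move=> cd ch h1 h2; apply: contr_IVT => //.
by rewrite ge_min h1 le_max h2 orbT.
Qed.

Lemma contr_IVT_dn h c d v : c <= d -> contr h c d -> h d <= v -> v <= h c ->
  exists2 t, c <= t <= d & h t = v.
Proof.
move=> cd ch h1 h2; apply: contr_IVT => //.
by rewrite ge_min h1 orbT le_max h2.
Qed.

Lemma contr_min h c d : c <= d -> contr h c d ->
  exists2 t, c <= t <= d & forall s, c <= s <= d -> h t <= h s.
Proof.
move=> cd /contr_within ch; have [t tcd H] := EVT_min cd ch.
exists t; first by move: tcd; rewrite in_itv.
by move=> s scd; apply: H; rewrite in_itv.
Qed.

Lemma contr_max h c d : c <= d -> contr h c d ->
  exists2 t, c <= t <= d & forall s, c <= s <= d -> h s <= h t.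
Proof.
move=> cd /contr_within ch; have [t tcd H] := EVT_max cd ch.
exists t; first by move: tcd; rewrite in_itv.
by move=> s scd; apply: H; rewrite in_itv.
Qed.

(* The indicator function of [P] would be continuous, contradicting the
   intermediate value theorem. *)
Lemma itv_clopen (J P : R -> Prop) x0 :
  (forall x y t, J x -> J y -> x <= t <= y -> J t) ->
  (forall x, J x -> P x ->
     exists2 r, 0 < r & forall y, J y -> `|y - x| < r -> P y) ->
  (forall x, J x -> ~ P x ->
     exists2 r, 0 < r & forall y, J y -> `|y - x| < r -> ~ P y) ->
  J x0 -> P x0 -> forall x, J x -> P x.
Proof.
move=> Jc Po Pc J0 P0 x Jx; apply: contrapT => nPx.
pose h (t : R) : R := if `[< P t >] then 1 else 0.
have hP t : P t -> h t = 1 by move=> ?; rewrite /h asboolT.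
have hN t : ~ P t -> h t = 0 by move=> ?; rewrite /h asboolF.
have H c d : J c -> J d -> contr h c d.
  move=> Jc' Jd t tcd e e0; have Jt := Jc _ _ _ Jc' Jd tcd.
  have [Pt|nPt] := pselect (P t).
    have [r r0 rP] := Po t Jt Pt; exists r => // s scd st.
    by rewrite !hP ?subrr ?normr0//; apply: rP => //; exact: (Jc c d).
  have [r r0 rP] := Pc t Jt nPt; exists r => // s scd st.
  by rewrite !hN ?subrr ?normr0//; apply: rP => //; exact: (Jc c d).
have nhalf t : h t <> 1 / 2.
  by have [/hP ->|/hN ->] := pselect (P t); lra.
have [xx|xx] := le_or_lt x x0.
  have [||t _] := @contr_IVT_up h x x0 (1 / 2) xx (H _ _ Jx J0); last exact: nhalf.
  - by rewrite hN//; lra.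
  - by rewrite hP//; lra.
have [||t _] := @contr_IVT_dn h x0 x (1 / 2) (ltW xx) (H _ _ J0 Jx); last exact: nhalf.
- by rewrite hN//; lra.
- by rewrite hP//; lra.
Qed.

(** The step hypothesis is symmetric in [u] and [v], so it makes both [P] and its complement open in
    [J]. It serves to turn local bounds into uniform ones. *)
Lemma itv_induct (J P : R -> Prop) x0 :
  (forall x y t, J x -> J y -> x <= t <= y -> J t) ->
  (forall x, J x -> exists2 r, 0 < r & forall u v, J u -> J v -> `|u - x| < r ->
     `|v - x| < r -> P u -> P v) ->
  J x0 -> P x0 -> forall x, J x -> P x.
Proof.
move=> Jc step J0 P0; apply: (itv_clopen Jc _ _ J0 P0) => x Jx Px;
  have [r r0 rP] := step x Jx; exists r => // y Jy yx.
- by apply: (rP x y) => //; rewrite subrr normr0.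
- by move=> Py; apply: Px; apply: (rP y x) => //; rewrite subrr normr0.
Qed.

Lemma nested_intervals (P : nat -> R -> R -> Prop) x0 y0 : x0 <= y0 -> P 0%N x0 y0 ->
  (forall n x y, x <= y -> P n x y -> exists x' y',
     [/\ x <= x', x' <= y', y' <= y & P n.+1 x' y']) ->
  exists t, forall n, exists x y, x <= t <= y /\ P n x y.
Proof.
move=> xy0 P0 step.
(* [Q] is an implication so that choice applies to all pairs; [(0, 0)] is a junk value for those
   violating its premises. *)
pose Q (n : nat) (u v : R * R) := P n u.1 u.2 -> u.1 <= u.2 ->
  [/\ u.1 <= v.1, v.1 <= v.2, v.2 <= u.2 & P n.+1 v.1 v.2].
have /choice[S HS] : forall nu : nat * (R * R), exists v, Q nu.1 nu.2 v.
  move=> [n [x y]]; have [[p l]|np] := pselect (P n x y /\ x <= y).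
    by have [x' [y' H]] := step n x y l p; exists (x', y').
  by exists (0, 0) => /= p l; case: np.
pose u := fix u n := if n is k.+1 then S (k, u k) else (x0, y0).
have uP n : P n (u n).1 (u n).2 /\ (u n).1 <= (u n).2.
  by elim: n => //= n [p l]; have [] := HS (n, u n) p l.
have mono n k : (u n).1 <= (u (n + k)%N).1 /\ (u (n + k)%N).2 <= (u n).2.
  elim: k => [|k [h1 h2]]; first by rewrite addn0.
  rewrite addnS /=; have [p l] := uP (n + k)%N.
  have [/= ? ? ? _] := HS ((n + k)%N, u (n + k)%N) p l.
  by split; [apply: le_trans h1 _|apply: le_trans h2].
have lr n k : (u n).1 <= (u k).2.
  have [l _] := mono n k; have [_ r] := mono k n.
  by apply: le_trans l _; rewrite addnC; apply: le_trans r; rewrite (uP _).2.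
pose E := [set (u n).1 | n in [set: nat]].
have E0 : E !=set0 by exists (u 0%N).1; exists 0%N.
exists (sup E) => n; exists (u n).1, (u n).2; split; last exact: (uP n).1.
apply/andP; split.
  apply: ub_le_sup; last by exists n.
  by exists (u 0%N).2 => _ [k _ <-].
by apply: ge_sup => // _ [k _ <-].
Qed.

End Paths.

(** * Parallel chords of a plane path *)

Section Chord.
Variable R : realType.
Implicit Types (x y : R -> R).

Lemma unif_cont (h : R -> R) c d : c <= d -> contr h c d -> forall e, 0 < e ->
  exists2 r : R, 0 < r & forall s t : R, c <= s <= d -> c <= t <= d -> `|s - t| < r ->
    `|h s - h t| < e.
Proof.
move=> cd ch e e0.
pose P u := exists2 r : R, 0 < r & forall s t : R, c <= s <= u -> c <= t <= u -> `|s - t| < r ->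
    `|h s - h t| < e.
have step u : c <= u <= d -> exists2 r : R, 0 < r & forall v w, c <= v <= d -> c <= w <= d ->
    `|v - u| < r -> `|w - u| < r -> P v -> P w.
  move=> ucd; have e20 : 0 < e / 2 by lra.
  have [r r0 rP] := ch u ucd (e / 2) e20.
  exists (r / 2); first lra.
  move=> v w /andP[cv vd] /andP[cw wd] vu wu [k k0 kP].
  have rk0 : 0 < Num.min k (r / 4) by rewrite lt_min k0; lra.
  exists (Num.min k (r / 4)) => // s t /andP[cs sw] /andP[ct tw].
  rewrite lt_min => /andP[stk str].
  have [/andP[sv tv]|/nandP nv] := boolP ((s <= v) && (t <= v)).
    by apply: kP => //; apply/andP.
  rewrite !ltr_norml in vu wu str; move: vu wu str => /andP[v1 v2] /andP[w1 w2] /andP[s1 s2].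
  have near z : c <= z -> z <= w -> u - r < z -> `|h z - h u| < e / 2.
    move=> cz zw uz; apply: rP; first by rewrite cz (le_trans zw wd).
    by rewrite ltr_norml; apply/andP; split; [lra_from uz|lra_from zw w2 r0].
  have hs : `|h s - h u| < e / 2 by apply: near => //; case: nv; rewrite -ltNge => nv; lra_from nv v1 s1 r0.
  have ht : `|h t - h u| < e / 2 by apply: near => //; case: nv; rewrite -ltNge => nv; lra_from nv v1 s2 r0.
  by have := ler_distD (h u) (h s) (h t); rewrite (distrC (h u)) => k1; lra_from k1 hs ht.
apply: (@itv_induct R (fun u => c <= u <= d) P c) => //.
- by move=> u v w /andP[cu _] /andP[_ vd]; exact: itv_sub.
- by rewrite lexx.
- exists 1 => // s t /andP[s1 s2] /andP[t1 t2] _.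
  have -> : s = t by lra_from s1 s2 t1 t2.
  by rewrite subrr normr0.
- by rewrite cd lexx.
Qed.

Lemma continuous_at_contr (h : R -> R) c d :
  (forall t, c <= t <= d -> {for t, continuous h}) -> contr h c d.
Proof.
move=> ch t tcd e e0; have /cvgrPdist_lt /(_ e e0) /nbhs_ballP[r /= r0 rP] := ch t tcd.
by exists r => // s _ st; rewrite distrC; apply: rP; rewrite /ball /= distrC.
Qed.

Lemma continuous_contr (h : R -> R) c d : continuous h -> contr h c d.
Proof. by move=> ch; apply: continuous_at_contr => t _; exact: ch. Qed.

(** Compactness of the square in two stages: minimise over [t] for fixed [s], then over [s]. The
    inner minimum is continuous in [s] because [D s t] varies with [s] uniformly in [t]. *)
Lemma square_min (x y : R -> R) (k : R) : continuous x -> continuous y ->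
  (forall s t : R, 0 <= s <= 1 -> 0 <= t <= 1 -> x s = x t -> y t <> y s + k) ->
  exists2 r : R, 0 < r & forall s t : R, 0 <= s <= 1 -> 0 <= t <= 1 ->
    r <= `|x t - x s| + `|y t - y s - k|.
Proof.
move=> cx cy nz; have le01 : (0 : R) <= 1 by [].
pose D s t := `|x t - x s| + `|y t - y s - k|.
have cD s : contr (D s) 0 1.
  apply: continuous_contr => t; apply: cvgD.
    apply: cvg_norm; apply: cvgB; [exact: cx|exact: cvg_cst].
  apply: cvg_norm; apply: cvgB; last exact: cvg_cst.
  by apply: cvgB; [exact: cy|exact: cvg_cst].
have /choice[m mP] : forall s, exists t : R, 0 <= t <= 1 /\ forall u : R, 0 <= u <= 1 -> D s t <= D s u.
  by move=> s; have [t ? ?] := contr_min le01 (cD s); exists t.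
have cm : contr (fun s => D s (m s)) 0 1.
  move=> s scd e e0; have e20 : 0 < e / 2 by lra.
  have [r1 r10 r1P] := continuous_contr cx scd e20.
  have [r2 r20 r2P] := continuous_contr cy scd e20.
  exists (Num.min r1 r2); first by rewrite lt_min r10.
  move=> u ucd; rewrite lt_min => /andP[ur1 ur2].
  have h1 := r1P u ucd ur1; have h2 := r2P u ucd ur2.
  have DD t : `|D u t - D s t| < e.
    rewrite /D ltr_norml.
    have := ler_distD (x s) (x t) (x u); have := ler_distD (x u) (x t) (x s).
    have := ler_distD (y t - y s - k) (y t - y u - k) 0.
    have := ler_distD (y t - y u - k) (y t - y s - k) 0; rewrite !subr0.
    have -> : y t - y s - k - (y t - y u - k) = y u - y s by ring.
    have -> : y t - y u - k - (y t - y s - k) = - (y u - y s) by ring.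
    rewrite normrN (distrC (x s) (x u)).
    by move=> k1 k2 k3 k4; apply/andP; split; lra_from k1 k2 k3 k4 h1 h2.
  have [mu A1] := mP u; have [ms A2] := mP s.
  have B1 := A1 (m s) ms; have B2 := A2 (m u) mu.
  have := DD (m s); have := DD (m u); rewrite !ltr_norml => /andP[k1 k2] /andP[k3 k4].
  by apply/andP; split; lra_from B1 B2 k1 k2 k3 k4.
have [s0 s0cd s0P] := contr_min le01 cm.
exists (D s0 (m s0)).
  have [mcd _] := mP s0; rewrite lt_def addr_ge0// andbT.
  apply/negP; rewrite paddr_eq0// !normr_eq0 => /andP[/eqP e1 /eqP e2].
  apply: (nz s0 (m s0)) => //; first by lra.
  by lra.
move=> s t scd tcd; have [_ A] := mP s; apply: le_trans (s0P s scd) _; exact: A.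
Qed.

(* Rotating by the angle between two nonzero plane vectors at acute angle. *)
Lemma rotate_step (u v u' v' t rho : R) : 0 < rho -> u = - rho * sin t -> v = rho * cos t ->
  0 < u * u' + v * v' ->
  exists2 rho', 0 < rho' &
    u' = - rho' * sin (t + atan ((u * v' - v * u') / (u * u' + v * v'))) /\
    v' = rho' * cos (t + atan ((u * v' - v * u') / (u * u' + v * v'))).
Proof.
move=> r0 uE vE; set dt := u * u' + v * v'; set cr := u * v' - v * u' => d0.
set phi := atan _; have cphi : 0 < cos phi.
  by apply: cos_gt0_pihalf; rewrite atan_gtNpi2 atan_ltpi2.
have crE : cr * cos phi = dt * sin phi.
  have : tan phi = cr / dt by rewrite /phi atanK.
  rewrite /tan => h; have -> : sin phi = cr / dt * cos phi by rewrite -h mulfVK ?gt_eqF.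
  by field; rewrite gt_eqF.
have uv : u ^+ 2 + v ^+ 2 = rho ^+ 2.
  by rewrite uE vE !exprMn sqrrN -mulrDr addrC cos2Dsin2 mulr1.
have rn : rho != 0 by rewrite gt_eqF.
have cn : cos phi != 0 by rewrite gt_eqF.
exists (dt / (cos phi * rho)); first by rewrite divr_gt0// mulr_gt0.
have e1 : u' * rho ^+ 2 = dt * u - cr * v by rewrite -uv /dt /cr; ring.
have e2 : v' * rho ^+ 2 = dt * v + cr * u by rewrite -uv /dt /cr; ring.
have dE : cr = dt * sin phi / cos phi by rewrite -crE mulfK.
have rn2 : rho ^+ 2 != 0 by rewrite expf_neq0.
rewrite sinD cosD; split; apply: (mulIf rn2).
  by rewrite e1 dE uE vE; field; rewrite cn rn.
by rewrite e2 dE uE vE; field; rewrite cn rn.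
Qed.

(** For a quarter turn beyond either end of [[0, pi]] the sine is negative, and a shorter step
    cannot jump over that range. *)
Lemma turn_bound (u v : R) : 0 <= u <= pi -> - (pi / 2) < v -> v < pi / 2 ->
  0 <= sin (u + v) -> 0 <= u + v <= pi.
Proof.
move=> /andP[u0 u1] v0 v1 s0; apply/andP; split; rewrite leNgt; apply/negP => l.
  have := @sin_gt0_pihalf R (- (u + v)); rewrite sinN.
  have /andP H : 0 < - (u + v) /\ - (u + v) < pi / 2 by lra.
  by rewrite H => /(_ isT); lra.
have := @sin_gt0_pihalf R (u + v - pi); rewrite sinB sinpi cospi mulr0 subr0 mulrN1.
have /andP H : 0 < u + v - pi /\ u + v - pi < pi / 2 by lra.
by rewrite H => /(_ isT); lra.
Qed.

(** A winding argument. Otherwise the vector [(U, V)], the chord from [s] to [t] minus [(0, 2 pi)],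
    never vanishes. Along the segment from [(s, t) = (0, 1)] to [(l, l)] it turns from pointing up
    to pointing down, by an angle [Th N l] continuous in [l]. For [l = 0] the point at [s = 0] is
    rightmost, so the vector stays in the left half plane and the angle lies in [[0, pi]]; for
    [l = 1] it stays in the right half plane and the angle lies in [[- pi, 0]]. Some [l] gives the
    angle 0, but then the final vector would point up. *)
Lemma chord (x y : R -> R) X : continuous x -> continuous y ->
  (forall t : R, 0 <= t <= 1 -> x t <= X) -> x 0 = X -> x 1 = X ->
  y 0 + pi *+ 2 < y 1 ->
  exists s t : R, [/\ 0 <= s <= 1, 0 <= t <= 1, x s = x t & y t = y s + pi *+ 2].
Proof.
move=> cx cy xX x0 x1 y01; apply: contrapT => nost.
have nz (s t : R) : 0 <= s <= 1 -> 0 <= t <= 1 -> x s = x t -> y t <> y s + pi *+ 2.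
  by move=> scd tcd e1 e2; apply: nost; exists s, t.
have [r r0 rP] := square_min cx cy nz.
have le01 : (0 : R) <= 1 by []. have r40 : 0 < r / 8 by lra.
have [r1 r10 r1P] := unif_cont le01 (continuous_contr cx) r40.
have [r2 r20 r2P] := unif_cont le01 (continuous_contr cy) r40.
have rr0 : 0 < Num.min r1 r2 by rewrite lt_min r10.
(* With this mesh consecutive vectors differ by four increments below [r / 8], hence by less than
   half of their least size [r]. The angle between them is acute, so it is an arctangent. *)
pose N := (Num.bound (1 / Num.min r1 r2)).+1.
have N0 : 0 < N%:R :> R by rewrite ltr0n.
have NP : 1 / N%:R < Num.min r1 r2.
  rewrite ltr_pdivrMr// -ltr_pdivrMl// mulrC.
  apply: lt_le_trans (archi_boundP _) _; first by rewrite divr_ge0// ltW.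
  by rewrite ler_nat.
pose ta (l : R) (j : nat) : R := l * (j%:R / N%:R).
pose tb (l : R) (j : nat) : R := 1 - (1 - l) * (j%:R / N%:R).
pose U (l : R) (j : nat) : R := x (tb l j) - x (ta l j).
pose V (l : R) (j : nat) : R := y (tb l j) - y (ta l j) - pi *+ 2.
have jN j : (j <= N)%N -> 0 <= (j%:R / N%:R : R) <= 1.
  by move=> jN; rewrite divr_ge0//= ler_pdivrMr// mul1r ler_nat.
have ta01 l j : 0 <= l <= 1 -> (j <= N)%N -> 0 <= ta l j <= 1.
  move=> /andP[? ?] /jN /andP[? ?]; rewrite /ta mulr_ge0//=.
  by rewrite mulr_ile1.
have tb01 l j : 0 <= l <= 1 -> (j <= N)%N -> 0 <= tb l j <= 1.
  move=> /andP[? ?] /jN /andP[? ?]; rewrite /tb.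
  have : 0 <= (1 - l) * (j%:R / N%:R) by rewrite mulr_ge0// subr_ge0.
  have : (1 - l) * (j%:R / N%:R) <= 1 by rewrite mulr_ile1// ?subr_ge0// lerBlDr lerDl.
  by move=> k1 k2; apply/andP; split; [lra_from k1|lra_from k2].
have dN l : 0 <= l <= 1 -> `|l * (1 / N%:R)| < Num.min r1 r2.
  move=> /andP[l0 l1]; apply: le_lt_trans NP; rewrite ger0_norm ?mulr_ge0//.
  by rewrite -[leRHS]mul1r ler_wpM2r.
have jS j : (j.+1%:R / N%:R : R) = j%:R / N%:R + 1 / N%:R by rewrite -natr1 mulrDl.
have stepsm l j : 0 <= l <= 1 -> (j < N)%N ->
   `|U l j.+1 - U l j| + `|V l j.+1 - V l j| < r / 2.
  move=> lcd jn; have l'cd : 0 <= 1 - l <= 1 by move: lcd => /andP[l0 l1]; rewrite subr_ge0 l1 gerBl.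
  have A1 := ta01 l j lcd (ltnW jn); have A2 := ta01 l j.+1 lcd jn.
  have B1 := tb01 l j lcd (ltnW jn); have B2 := tb01 l j.+1 lcd jn.
  have da : `|ta l j.+1 - ta l j| < Num.min r1 r2.
    by rewrite /ta jS mulrDr addrAC subrr add0r; exact: dN.
  have db : `|tb l j.+1 - tb l j| < Num.min r1 r2.
    rewrite /tb jS mulrDr.
    have -> : 1 - ((1 - l) * (j%:R / N%:R) + (1 - l) * (1 / N%:R)) -
       (1 - (1 - l) * (j%:R / N%:R)) = - ((1 - l) * (1 / N%:R)) by ring.
    by rewrite normrN; exact: dN.
  move: da db; rewrite !lt_min => /andP[a1 a2] /andP[b1 b2].
  have := r1P _ _ A2 A1 a1; have := r1P _ _ B2 B1 b1.
  have := r2P _ _ A2 A1 a2; have := r2P _ _ B2 B1 b2.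
  have := ler_normB (x (tb l j.+1) - x (tb l j)) (x (ta l j.+1) - x (ta l j)).
  have := ler_normB (y (tb l j.+1) - y (tb l j)) (y (ta l j.+1) - y (ta l j)).
  rewrite /U /V.
  have -> : y (tb l j.+1) - y (tb l j) - (y (ta l j.+1) - y (ta l j)) =
    y (tb l j.+1) - y (ta l j.+1) - pi *+ 2 - (y (tb l j) - y (ta l j) - pi *+ 2) by ring.
  have -> : x (tb l j.+1) - x (tb l j) - (x (ta l j.+1) - x (ta l j)) =
    x (tb l j.+1) - x (ta l j.+1) - (x (tb l j) - x (ta l j)) by ring.
  move: (`|_|) (`|_|) (`|_|) (`|_|) (`|_|) (`|_|) => n1 n2 n3 n4 n5 n6.
  by move=> k1 k2 k3 k4 k5 k6; lra_from k1 k2 k3 k4 k5 k6.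
pose dt l j := U l j * U l j.+1 + V l j * V l j.+1.
pose cr l j := U l j * V l j.+1 - V l j * U l j.+1.
have dt0 l j : 0 <= l <= 1 -> (j < N)%N -> 0 < dt l j.
  move=> lcd jn; have := stepsm l j lcd jn.
  have := rP _ _ (ta01 l j lcd (ltnW jn)) (tb01 l j lcd (ltnW jn)).
  rewrite -/(U l j) -/(V l j) /dt.
  move: (U l j) (V l j) (U l j.+1) (V l j.+1) => u v u' v' h1 h2.
  move: h1 h2; clear_props => h1 h2.
  have h : `|u' - u| + `|v' - v| < (`|u| + `|v|) / 2 by lra.
  have -> : u * u' + v * v' = u ^+ 2 + v ^+ 2 + (u * (u' - u) + v * (v' - v)) by ring.
  have h3 : `|u * (u' - u) + v * (v' - v)| <= (`|u| + `|v|) * (`|u' - u| + `|v' - v|).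
    apply: le_trans (ler_normD _ _) _; rewrite !normrM.
    have := mulr_ge0 (normr_ge0 u) (normr_ge0 (v' - v)).
    have := mulr_ge0 (normr_ge0 v) (normr_ge0 (u' - u)).
    rewrite mulrDl !mulrDr; lra.
  have p0 : 0 < `|u| + `|v| by have := normr_ge0 (u' - u); have := normr_ge0 (v' - v); lra.
  have h4 : (`|u| + `|v|) * (`|u' - u| + `|v' - v|) < (`|u| + `|v|) * ((`|u| + `|v|) / 2).
    by rewrite ltr_pM2l.
  have h5 : (`|u| + `|v|) * ((`|u| + `|v|) / 2) <= u ^+ 2 + v ^+ 2.
    rewrite -(real_normK (num_real u)) -(real_normK (num_real v)).
    by have := sqr_ge0 (`|u| - `|v|); move: `|u| `|v| => p q; rewrite !expr2; lra.
  have := lerNnormlW h3; move=> k6; lra_from h4 h5 k6.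
pose Th k l := \sum_(j < k) atan (cr l j / dt l j).
have rot k l : 0 <= l <= 1 -> (k <= N)%N -> exists2 rho : R, 0 < rho &
    U l k = - rho * sin (Th k l) /\ V l k = rho * cos (Th k l).
  move=> lcd; elim: k => [|k IH] kN.
    exists (y 1 - y 0 - pi *+ 2); first lra_from y01.
    rewrite /Th big_ord0 sin0 cos0 mulr0 mulr1 /U /V /ta /tb mul0r !mulr0 subr0.
    by rewrite x0 x1 subrr.
  have [rho rho0 [e1 e2]] := IH (ltnW kN).
  have [rho' rho'0 [e1' e2']] := rotate_step rho0 e1 e2 (dt0 l k lcd kN).
  by exists rho' => //; rewrite /Th big_ord_recr.
have cTh : contr (Th N) 0 1.
  apply: continuous_at_contr => l lcd.
  suff H k : (k <= N)%N -> {for l, continuous (Th k)} by exact: H.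
  elim: k => [|k IH] kN.
    have -> : Th 0%N = fun=> 0 by apply/funext => z; rewrite /Th big_ord0.
    exact: cvg_cst.
  have -> : Th k.+1 = fun z => Th k z + atan (cr z k / dt z k).
    by apply/funext => z; rewrite /Th big_ord_recr.
  have cta j : {for l, continuous (fun z => ta z j)}.
    by apply: cvgM; [exact: cvg_id|exact: cvg_cst].
  have ctb j : {for l, continuous (fun z => tb z j)}.
    apply: cvgB; first exact: cvg_cst.
    by apply: cvgM; [apply: cvgB; [exact: cvg_cst|exact: cvg_id]|exact: cvg_cst].
  have cU j : {for l, continuous (fun z => U z j)}.
    apply: cvgB.
      by apply: continuous_comp; [exact: ctb|exact: cx].
    by apply: continuous_comp; [exact: cta|exact: cx].
  have cV j : {for l, continuous (fun z => V z j)}.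
    apply: cvgB; last exact: cvg_cst.
    apply: cvgB.
      by apply: continuous_comp; [exact: ctb|exact: cy].
    by apply: continuous_comp; [exact: cta|exact: cy].
  apply: cvgD; first exact: IH (ltnW kN).
  apply: continuous_comp; last exact: continuous_atan.
  apply: cvgM.
    by apply: cvgB; apply: cvgM; solve [exact: cU|exact: cV].
  apply: cvgV; first by rewrite gt_eqF// dt0.
  by apply: cvgD; apply: cvgM; solve [exact: cU|exact: cV].
have h01 : 0 <= (0 : R) <= 1 by rewrite lexx.
have h11 : 0 <= (1 : R) <= 1 by rewrite lexx andbT.
have ph := @pi_gt0 R.
have lo k : (k <= N)%N -> 0 <= Th k 0 <= pi.
  elim: k => [|k IH] kN; first by rewrite /Th big_ord0 lexx pi_ge0.
  have [rho rho0 [e1 _]] := rot k.+1 0 h01 kN.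
  have U0 : U 0 k.+1 <= 0.
    by rewrite /U /ta mul0r x0 subr_le0; apply: xX; exact: tb01.
  have s0 : 0 <= sin (Th k.+1 0).
    by move: U0; rewrite e1 mulNr oppr_le0 pmulr_rge0.
  have E : Th k.+1 0 = Th k 0 + atan (cr 0 k / dt 0 k) by rewrite /Th big_ord_recr.
  by rewrite E in s0 *; apply: turn_bound => //; [exact: IH (ltnW kN)|exact: atan_gtNpi2|exact: atan_ltpi2].
have hi k (kN : (k <= N)%N) : - pi <= Th k 1 <= 0.
  suff : 0 <= - Th k 1 <= pi by rewrite oppr_ge0 [- Th k 1 <= pi]lerNl => /andP[-> ->].
  elim: k kN => [|k IH] kN; first by rewrite /Th big_ord0 oppr0 lexx pi_ge0.
  have [rho rho0 [e1 _]] := rot k.+1 1 h11 kN.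
  have U0 : 0 <= U 1 k.+1.
    by rewrite /U /tb subrr mul0r subr0 x1 subr_ge0; apply: xX; exact: ta01.
  have s0 : 0 <= sin (- Th k.+1 1).
    by move: U0; rewrite e1 mulNr oppr_ge0 pmulr_rle0// sinN oppr_ge0.
  have E : - Th k.+1 1 = - Th k 1 + - atan (cr 1 k / dt 1 k).
    by rewrite /Th big_ord_recr /= opprD.
  rewrite E in s0 *; apply: turn_bound => //; first exact: IH (ltnW kN).
    by rewrite ltrN2 atan_ltpi2.
  by rewrite ltrNl atan_gtNpi2.
have /andP[l0 _] := lo N (leqnn N); have /andP[_ h1] := hi N (leqnn N).
have [l lcd E] := contr_IVT_dn le01 cTh h1 l0.
have [rho rho0 [_]] := rot N l lcd (leqnn N).
have -> : V l N = - (pi *+ 2).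
  rewrite /V /ta /tb divff ?gt_eqF// !mulr1.
  have -> : 1 - (1 - l) = l by ring.
  by rewrite subrr sub0r.
rewrite E cos0 mulr1 mulr2n => h; by lra_from h rho0 ph.
Qed.

End Chord.

(** * Orbits in the half plane *)

Section Dynamics.
Variables (R : realType) (a : cplane R).
Local Notation C := (cplane R).
Local Notation "'re' z" := (complex.Re (z : R[i]%C)) (at level 10, z at level 8).
Local Notation "'im' z" := (complex.Im (z : R[i]%C)) (at level 10, z at level 8).
Local Notation f := (expmap a).
Local Notation F n := (iter n (expmap a)).
Implicit Types (z w p q : C) (x y t s e m c d : R) (g : R -> C) (h : R -> R).

Lemma re_f z : re (f z) = expR (re z) * cos (im z) + re a.
Proof. by case: a. Qed.

Lemma im_f z : im (f z) = expR (re z) * sin (im z) + im a.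
Proof. by case: a. Qed.

Lemma modulus_f z : (re (f z) - re a) ^+ 2 + (im (f z) - im a) ^+ 2 = expR (re z) ^+ 2.
Proof.
rewrite re_f im_f !addrK !exprMn -mulrDr cos2Dsin2 mulr1 //.
Qed.

(** The law of cosines: with [r], [r'] the distances of [f z], [f w] to [a] and [th = im z - im w],
    the squared distance of the images is [(r - r')^2 + 4 r r' sin^2 (th / 2)]. The two terms
    control the real and the imaginary difference with factors 1 and 4, whence 5. *)
Lemma exp_expansion z w m : 0 < m -> `|im z - im w| <= pi ->
  m <= expR (re z) -> m <= expR (re w) -> m * dist1 z w <= 5 * dist1 (f z) (f w).
Proof.
move=> m0 th mz mw; set D := dist1 (f z) (f w).
have D0 : 0 <= D by exact: dist1_ge0.
have D2 : (re (f z) - re (f w)) ^+ 2 + (im (f z) - im (f w)) ^+ 2 <= D ^+ 2.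
  rewrite /D /dist1 -(real_normK (num_real (re (f z) - _))).
  rewrite -(real_normK (num_real (im (f z) - _))).
  set u := `|re _ - _|; set v := `|im _ - _|.
  have u0 : 0 <= u by rewrite /u. have v0 : 0 <= v by rewrite /v.
  by have := mulr_ge0 u0 v0; rewrite sqrrD mulr2n; lra.
pose s := sin (`|im z - im w| / 2).
have E : (re (f z) - re (f w)) ^+ 2 + (im (f z) - im (f w)) ^+ 2 =
   (expR (re z) - expR (re w)) ^+ 2 + 4 * (expR (re z) * expR (re w) * s ^+ 2).
  have -> : s ^+ 2 = (1 - cos (im z - im w)) / 2.
    rewrite /s -cos_norm [in RHS](_ : `|im z - im w| = (`|im z - im w| / 2) *+ 2).
      by rewrite cos_mulr2n cos2sin2 mulr2n; field.
    by rewrite mulr2n -splitr.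
  rewrite !re_f !im_f cosB.
  have := cos2Dsin2 (im z); have := cos2Dsin2 (im w).
  move: (cos (im z)) (cos (im w)) (sin (im z)) (sin (im w)) => c c' d d' h h'.
  move: (expR _) (expR _) => r r'.
  transitivity (r' ^+ 2 * (c ^+ 2 + d ^+ 2) + r ^+ 2 * (c' ^+ 2 + d' ^+ 2)
     - 2 * r * r' * (c * c' + d * d')); first by ring.
  by rewrite h h'; field.
have s1 : `|im z - im w| / 8 <= s.
  have := @sin_ge_quarter R (`|im z - im w| / 2); rewrite -/s.
  have -> : 0 <= `|im z - im w| / 2 <= pi / 2.
    by have := normr_ge0 (im z - im w) => ?; apply/andP; split; lra.
  by move=> /(_ isT); lra.
have h1 : m * `|re z - re w| <= D.
  have : m * `|re z - re w| <= `|expR (re z) - expR (re w)|.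
    have [h|h] := le_or_lt (re w) (re z).
      have := expand_lt mw; rewrite -subr_ge0 in h => /(_ _ h).
      by rewrite (ger0_norm h) => /le_trans; apply; exact: ler_norm.
    have := @expand_lt _ (re w) (re z) m mz; rewrite ltr0_norm ?subr_lt0//.
    rewrite opprB subr_ge0 (ltW h) => /(_ isT) /le_trans; apply.
    by rewrite distrC ler_norm.
  move=> /le_trans; apply; rewrite -(ler_pXn2r (ltn0Sn 1)) ?nnegrE//.
  rewrite real_normK ?num_real//; apply: le_trans D2; rewrite E lerDl.
  by rewrite mulr_ge0// mulr_ge0 ?sqr_ge0// mulr_ge0 ?expR_ge0.
have h2 : m * (`|im z - im w| / 4) <= D.
  rewrite -(ler_pXn2r (ltn0Sn 1)) ?nnegrE//; last first.
    by rewrite mulr_ge0// ?divr_ge0// ltW.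
  apply: le_trans D2; rewrite E; apply: le_trans (_ : 4 * (m * m * (`|im z - im w| / 8) ^+ 2) <= _).
    by rewrite le_eqVlt; apply/orP; left; apply/eqP; field.
  have := sqr_ge0 (expR (re z) - expR (re w)).
  suff : m * m * (`|im z - im w| / 8) ^+ 2 <= expR (re z) * expR (re w) * s ^+ 2 by lra.
  rewrite ler_pM ?mulr_ge0 ?sqr_ge0 ?(ltW m0)//.
    by rewrite ler_pM// ltW.
  by rewrite ler_pXn2r ?nnegrE ?divr_ge0//; apply: le_trans s1; rewrite divr_ge0.
by rewrite /dist1; lra.
Qed.

Lemma lift_exists w y : w <> a -> exists z, f z = w /\ `|im z - y| <= pi.
Proof.
move=> wa; pose r := Num.sqrt ((re w - re a) ^+ 2 + (im w - im a) ^+ 2).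
have s0 : 0 <= (re w - re a) ^+ 2 + (im w - im a) ^+ 2 by rewrite addr_ge0 ?sqr_ge0.
have r0 : 0 < r.
  rewrite sqrtr_gt0 lt_def s0 andbT paddr_eq0 ?sqr_ge0// !sqrf_eq0 !subr_eq0.
  by apply/negP => /andP[/eqP h1 /eqP h2]; apply: wa; exact: cplane_eq.
have r2 : r ^+ 2 = (re w - re a) ^+ 2 + (im w - im a) ^+ 2 by rewrite sqr_sqrtr.
have [|t0 [ct0 st0]] := @polar_unit R ((re w - re a) / r) ((im w - im a) / r).
  by rewrite !expr_div_n -mulrDl -r2 divff// expf_eq0 gt_eqF.
have [t [ct st ty]] := periodic_shift t0 y.
exists (Complex (ln r) t); split => //; apply: cplane_eq.
  by rewrite re_f /= lnK ?posrE// ct ct0 mulrCA divff ?gt_eqF// mulr1 subrK.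
by rewrite im_f /= lnK ?posrE// st st0 mulrCA divff ?gt_eqF// mulr1 subrK.
Qed.

Lemma contC_f : contC f.
Proof.
have key (T : R -> R) : continuous T -> forall (x y e k : R), 0 < e ->
  exists2 r, 0 < r & forall x' y', `|x' - x| < r -> `|y' - y| < r ->
    `|(expR x' * T y' + k) - (expR x * T y + k)| < e.
  move=> cT x y e k e0.
  have : {for (x, y), continuous (fun p : R * R => expR p.1 * T p.2 + k)}.
    apply: cvgD; last exact: cvg_cst.
    apply: cvgM.
      apply: continuous_comp; first exact: cvg_fst.
      exact: continuous_expR.
    apply: continuous_comp; first exact: cvg_snd.
    exact: cT.
  move=> /cvgrPdist_lt /(_ e e0) /nbhs_ballP[r /= r0 rP]; exists r => // x' y' hx hy.
  rewrite distrC; apply: (rP (x', y')); split; rewrite /ball /= distrC//.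
move=> z e e0; have e20 : 0 < e / 2 by rewrite divr_gt0.
have [r r0 rP] := key cos (@continuous_cos R) (re z) (im z) (e / 2) (re a) e20.
have [r' r'0 rP'] := key sin (@continuous_sin R) (re z) (im z) (e / 2) (im a) e20.
exists (Num.min r r'); first by rewrite lt_min r0.
move=> w; rewrite lt_min => /andP[wr wr'].
rewrite [e in _ < e]splitr /dist1 !re_f !im_f; apply: ltrD.
  by apply: rP; [apply: le_lt_trans wr; exact: re_dist1|apply: le_lt_trans wr; exact: im_dist1].
by apply: rP'; [apply: le_lt_trans wr'; exact: re_dist1|apply: le_lt_trans wr'; exact: im_dist1].
Qed.

Lemma contC_F n : contC (F n).
Proof.
elim: n => [|n IH]; first by move=> z e e0; exists e.
exact: (contC_comp contC_f IH).
Qed.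

Lemma contp_F n g c d : contp g c d -> contp (fun t => F n (g t)) c d.
Proof. by move=> cg; apply: (contp_comp (contC_F n)). Qed.

Lemma F_add n k z : F (n + k)%N z = F n (F k z).
Proof. exact: iterD. Qed.

Lemma F_S n z : F n.+1 z = F n (f z).
Proof. exact: iterSr. Qed.

(* [CC] bounds the error in shadowing a pseudo-orbit, [KK] is the gap separating two
   orbits with the same itinerary, [MM] the left edge of the half plane in which [f]
   expands and [M1] leaves room in it for these errors. *)
Definition Aa : R := `|re a| + `|im a|.
Definition CC : R := Aa + 30.
Definition KK : R := 2 * CC + 10.
Definition MM : R := Aa + 4 * KK + 200.
Definition M1 : R := MM + 2 * CC + Aa + KK + 10.

Lemma consts : [/\ 0 <= Aa, `|re a| <= Aa, `|im a| <= Aa, CC = Aa + 30 &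
  [/\ KK = 2 * CC + 10, MM = Aa + 4 * KK + 200 &
     M1 = MM + 2 * CC + Aa + KK + 10]].
Proof.
have ? := normr_ge0 (re a); have ? := normr_ge0 (im a).
by rewrite /Aa; split => //; lra.
Qed.

Lemma re_a_bound : - Aa <= re a <= Aa.
Proof. by rewrite -ler_norml; case: consts. Qed.

Lemma im_a_bound : - Aa <= im a <= Aa.
Proof. by rewrite -ler_norml; case: consts. Qed.

Lemma cos_gt0_Pi z : MM <= re (f z) -> 0 < cos (im z).
Proof.
move=> h; have [? _ _ ? [? ? _]] := consts; have /andP[_ ?] := re_a_bound.
have := re_f z => E; have : 0 < expR (re z) * cos (im z) by lra.
by rewrite pmulr_rgt0 ?expR_gt0.
Qed.

Lemma modulus_ge z m : 0 <= m -> m <= re (f z) - re a -> m <= expR (re z).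
Proof.
move=> m0 h; rewrite -(ler_pXn2r (ltn0Sn 1)) ?nnegrE ?expR_ge0//.
rewrite -(modulus_f); have := sqr_ge0 (im (f z) - im a).
have : m ^+ 2 <= (re (f z) - re a) ^+ 2 by rewrite ler_pXn2r ?nnegrE// (le_trans m0).
lra.
Qed.

Lemma modulus_ge_im z m : 0 <= m -> m <= im (f z) - im a -> m <= expR (re z).
Proof.
move=> m0 h; rewrite -(ler_pXn2r (ltn0Sn 1)) ?nnegrE ?expR_ge0//.
rewrite -(modulus_f); have := sqr_ge0 (re (f z) - re a).
have : m ^+ 2 <= (im (f z) - im a) ^+ 2 by rewrite ler_pXn2r ?nnegrE// (le_trans m0).
lra.
Qed.

Lemma contract z w : MM <= re (f z) -> MM <= re (f w) -> `|im z - im w| <= pi ->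
  dist1 z w <= dist1 (f z) (f w) / 2.
Proof.
move=> hz hw him; have [? _ _ ? [? ? _]] := consts; have /andP[? ?] := re_a_bound.
(* Expansion by 10 and the loss of 5 in [exp_expansion] leave the factor 2. *)
have ez : 10 <= expR (re z) by apply: modulus_ge; lra.
have ew : 10 <= expR (re w) by apply: modulus_ge; lra.
have h10 : (0 : R) < 10 by lra.
have := exp_expansion h10 him ez ew; lra.
Qed.

Lemma contract_iter n z w :
  (forall i, (i < n)%N -> `|im (F i z) - im (F i w)| <= pi) ->
  (forall i, (0 < i <= n)%N -> MM <= re (F i z) /\ MM <= re (F i w)) ->
  dist1 z w <= dist1 (F n z) (F n w) / 2 ^+ n.
Proof.
elim: n => [|n IH] h1 h2; first by rewrite expr0 divr1.
apply: le_trans (IH _ _) _.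
- by move=> i ni; apply: h1; exact: leqW.
- by move=> i /andP[i0 ni]; apply: h2; rewrite i0 leqW.
rewrite exprS invfM mulrA ler_pM2r ?invr_gt0 ?exprn_gt0//.
by have [] := h2 n.+1; rewrite ?leqnn// => *; apply: contract => //; apply: h1.
Qed.

Definition stays m z := forall n, m <= re (F n z).
(* In the half plane [MM <= re] preimages of [MM <= re] lie where [cos (im z) > 0], so
   imaginary parts less than [pi] apart mean the same component. *)
Definition same z w := forall n, `|im (F n z) - im (F n w)| < pi.
Definition slower p q := exists n, forall k, (n <= k)%N ->
  re (F k p) + KK <= re (F k q).

Lemma stays_F m n z : stays m z -> stays m (F n z).
Proof. by move=> h k; rewrite -F_add. Qed.

Lemma stays_le m m' z : m' <= m -> stays m z -> stays m' z.
Proof. by move=> mm h n; apply: le_trans (h n). Qed.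

Lemma stays_M1_MM z : stays M1 z -> stays MM z.
Proof. by apply: stays_le; have [? _ _ ? [? ? ?]] := consts; lra. Qed.

Lemma same_F n z w : same z w -> same (F n z) (F n w).
Proof. by move=> h k; rewrite -!F_add. Qed.

Lemma stays_cos z : stays MM z -> forall n, 0 < cos (im (F n z)).
Proof. by move=> h n; apply: cos_gt0_Pi; exact: (h n.+1). Qed.

Lemma same_sym z w : same z w -> same w z.
Proof. by move=> h n; rewrite distrC. Qed.

Lemma same_refl z : same z z.
Proof. by move=> n; rewrite subrr normr0 pi_gt0. Qed.

Lemma same_trans z w p : stays MM z -> stays MM w -> stays MM p ->
  same z w -> same w p -> same z p.
Proof.
move=> /stays_cos hz /stays_cos hw /stays_cos hp zw wp n.
exact: strip_trans (hz n) (hw n) (hp n) (zw n) (wp n).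
Qed.

Lemma slower_F n p q : slower (F n p) (F n q) <-> slower p q.
Proof.
split=> -[m H].
  exists (m + n)%N => k mk; have nk : (n <= k)%N by apply: leq_trans mk; exact: leq_addl.
  by have := H (k - n)%N; rewrite -!F_add subnK//; apply; rewrite leq_subRL// addnC.
by exists m => k mk; rewrite -!F_add; apply: H; exact: leq_trans (leq_addr _ _).
Qed.

Lemma KK_ge : 2 <= KK.
Proof. by have [? _ _ ? [? ? _]] := consts; lra. Qed.

Lemma slower_asym p q : slower p q -> slower q p -> False.
Proof.
move=> [n Hn] [k Hk]; have := Hn (n + k)%N (leq_addr _ _).
have := Hk (n + k)%N (leq_addl _ _); have := KK_ge; lra.
Qed.

(** Real parts 2 apart make the distances of the images to [a] differ by a factor of at least 4.
    Imaginary parts within 20 cannot account for this, so the real parts must. Otherwise, relative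
    to [a], the real parts satisfy [u >= 3 / 4 * v] and [v >= 200] (the reason for [4 * KK + 200] in
    [MM]), against [16 (u^2 + x^2) <= v^2 + y^2]. Since [KK >= 2], the gap reproduces itself. *)
Lemma gap_step z w : MM <= re (f z) -> MM <= re (f w) ->
  `|im (f z) - im (f w)| <= 20 -> re z + 2 <= re w ->
  re (f z) + KK <= re (f w).
Proof.
move=> hz hw; rewrite ler_norml => him gap; have [? _ _ ? [? ? _]] := consts.
have /andP[? ?] := re_a_bound.
have e2 : 4 * expR (re z) <= expR (re w).
  have -> : expR (re w) = expR (re z) * expR (re w - re z).
    by rewrite -expRD addrC subrK.
  rewrite mulrC ler_pM2l ?expR_gt0//.
  have -> : re w - re z = (re w - re z) / 2 + (re w - re z) / 2 by rewrite -splitr.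
  have := expR_ge1Dx ((re w - re z) / 2); rewrite expRD => h.
  have : 2 <= expR ((re w - re z) / 2) by lra.
  by move: (expR _) => E; nra.
have : (4 * expR (re z)) ^+ 2 <= expR (re w) ^+ 2.
  by rewrite ler_pXn2r ?nnegrE ?mulr_ge0 ?expR_ge0.
rewrite exprMn -!(modulus_f) leNgt => E; rewrite leNgt; apply/negP => l.
move/negP: E; apply.
move: (re (f z)) (re (f w)) (im (f z)) (im (f w)) hz hw him l => P Q h k.
move=> hP hQ /andP[h1 h2] l.
pose u := P - re a; pose v := Q - re a; pose x := h - im a; pose y := k - im a.
rewrite -/u -/v -/x -/y.
have v0 : 200 <= v by rewrite /v; lra.
have ly : `|y - x| <= 20 by rewrite /x /y ler_norml; apply/andP; split; [lra_from h2|lra_from h1].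
have u0 : 3 / 4 * v <= u by rewrite /u /v in v0 *; lra.
move: ly; rewrite -/u -/v -/x -/y; move: u v x y v0 u0; clear_props => u v x y v0 u0 ly.
have u2 : (3 / 4 * v) ^+ 2 <= u ^+ 2 by rewrite ler_pXn2r ?nnegrE//; lra.
have v2 : 200 ^+ 2 <= v ^+ 2 by rewrite ler_pXn2r ?nnegrE//; lra.
have d2 : (y - x) ^+ 2 <= 20 ^+ 2.
  by rewrite -(real_normK (num_real (y - x))) ler_pXn2r ?nnegrE.
have k2 : y ^+ 2 + (y - 2 * x) ^+ 2 = 2 * x ^+ 2 + 2 * (y - x) ^+ 2 by ring.
have w2 : (3 / 4 * v) ^+ 2 = 9 / 16 * v ^+ 2 by field.
have := sqr_ge0 (y - 2 * x); have := sqr_ge0 x.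
move: k2 d2 u2 v2; rewrite w2.
move: (u ^+ 2) (v ^+ 2) (x ^+ 2) (y ^+ 2) ((y - x) ^+ 2) ((y - 2 * x) ^+ 2) => *.
lra.
Qed.

Lemma gap_slower n0 n p q :
  (forall k, (n0 <= k)%N -> MM <= re (F k p) /\ MM <= re (F k q)) ->
  (forall k, (n0 <= k)%N -> `|im (F k p) - im (F k q)| <= 20) ->
  (n0 <= n.+1)%N -> re (F n p) + 2 <= re (F n q) -> slower p q.
Proof.
move=> h1 h2 nn gap; exists n.+1 => k; move=> /subnK <-.
elim: (k - n.+1)%N => [|i IH].
  by rewrite add0n /=; have [? ?] := h1 n.+1 nn; apply: gap_step => //; exact: (h2 n.+1).
have ni : (n0 <= (i.+1 + n.+1)%N)%N by apply: leq_trans nn _; exact: leq_addl.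
rewrite addSn /=; have [? ?] := h1 _ ni; apply: gap_step => //.
  by have := h2 _ ni; rewrite addSn.
by have := KK_ge; lra.
Qed.

Lemma not_slower_ge n0 n p q :
  (forall k, (n0 <= k)%N -> MM <= re (F k p) /\ MM <= re (F k q)) ->
  (forall k, (n0 <= k)%N -> `|im (F k p) - im (F k q)| <= 20) ->
  (n0 <= n.+1)%N -> ~ slower p q -> re (F n q) - 2 <= re (F n p).
Proof.
move=> h1 h2 nn ns; rewrite leNgt; apply/negP => l; apply: ns.
by apply: (gap_slower h1 h2 nn); lra.
Qed.

Lemma pi_le20 x : `|x| < pi -> `|x| <= 20.
Proof. by move=> h; have := @pi_le4 R; lra. Qed.

Lemma half_pow_small (k e : R) : 0 < k -> 0 < e -> exists n, forall i, (n <= i)%N -> k / 2 ^+ i <= e.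
Proof.
move=> k0 e0; exists (Num.bound (k / e)) => i ni.
rewrite ler_pdivrMr ?exprn_gt0// -ler_pdivrMl// mulrC.
have h := archi_boundP (divr_ge0 (ltW k0) (ltW e0)).
apply: le_trans (ltW h) _; apply: le_trans (_ : i%:R <= _); first by rewrite ler_nat.
rewrite -natrX ler_nat; exact: ltnW (ltn_expl _ _).
Qed.

Lemma three_half_pow_small (k e : R) : 0 < k -> 0 < e -> exists n, k / (3 / 2) ^+ n < e.
Proof.
move=> k0 e0; have b0 : 0 <= 2 * (k / e) by rewrite mulr_ge0// divr_ge0 ?(ltW k0) ?(ltW e0).
exists (Num.bound (2 * (k / e))); have h := archi_boundP b0.
set n := Num.bound _ in h *.
have p32 : (0 : R) < 3 / 2 by lra.
rewrite ltr_pdivrMr ?exprn_gt0// -ltr_pdivrMl// mulrC.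
suff : 1 + n%:R / 2 <= (3 / 2 : R) ^+ n by lra.
elim: (n) => [|i IH]; first by rewrite expr0 mul0r addr0.
have i0 : 0 <= i%:R :> R by [].
by rewrite exprS -natr1; move: (_ ^+ i) (i%:R) IH i0 => u v *; lra.
Qed.

(** If neither point is slower, the real parts never differ by more than 2, so the orbits stay
    within 6 of each other and contraction identifies the points. *)
Lemma stays_trichotomy p q : stays MM p -> stays MM q -> same p q ->
  [\/ slower p q, slower q p | p = q].
Proof.
move=> hp hq pq; have [spq|nspq] := pselect (slower p q); first by constructor 1.
have [sqp|nsqp] := pselect (slower q p); first by constructor 2.
have h1 k : (0 <= k)%N -> MM <= re (F k p) /\ MM <= re (F k q) by split.
have h1' k : (0 <= k)%N -> MM <= re (F k q) /\ MM <= re (F k p) by split.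
have h2 k : (0 <= k)%N -> `|im (F k p) - im (F k q)| <= 20 by move=> _; apply: pi_le20.
have h2' k : (0 <= k)%N -> `|im (F k q) - im (F k p)| <= 20.
  by move=> _; rewrite distrC; apply: pi_le20.
constructor 3; apply: dist1_small => e e0.
have bd n : dist1 (F n p) (F n q) <= 6.
  have := not_slower_ge h1 h2 (leq0n n.+1) nspq.
  have := not_slower_ge h1' h2' (leq0n n.+1) nsqp.
  have := pq n; have := @pi_le4 R; rewrite /dist1 => ? ? ? ?.
  suff : `|re (F n p) - re (F n q)| <= 2 by lra.
  by rewrite ler_norml; apply/andP; split; lra.
have h6 : (0 : R) < 6 by lra.
have [n nP] := half_pow_small h6 e0; apply: le_trans (nP n (leqnn n)).
apply: le_trans (@contract_iter n p q _ _) _.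
- by move=> i _; rewrite ltW.
- by move=> i _.
by rewrite ler_pM2r ?invr_gt0 ?exprn_gt0.
Qed.

Lemma path_strip g c d : contp g c d -> (forall t, c <= t <= d -> 0 < cos (im (g t))) ->
  forall s t, c <= s <= d -> c <= t <= d -> `|im (g s) - im (g t)| < pi.
Proof.
move=> cg pos.
have key s t : c <= s <= d -> c <= t <= d -> s <= t -> `|im (g s) - im (g t)| < pi.
  move=> scd tcd st.
  have cg' : contr (fun t => im (g t)) s t.
    apply: contp_im; apply: contp_sub cg; by [case/andP: scd|case/andP: tcd].
  have inn u : s <= u <= t -> 0 < cos (im (g u)).
    move: scd tcd => /andP[? ?] /andP[? ?] /andP[? ?]; apply: pos.
    by apply/andP; split; lra.
  rewrite ltNge; apply/negP; rewrite ler_normr => /orP[h|h].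
    have [||u /inn pu E] := @contr_IVT_dn R _ s t (im (g s) - pi) st cg'.
    - by lra.
    - by have := @pi_gt0 R; lra.
    have := inn s; rewrite lexx st => /(_ isT).
    have -> : im (g s) = im (g u) + pi by lra.
    by rewrite cosDpi; lra.
  have [||u /inn pu E] := @contr_IVT_up R _ s t (im (g s) + pi) st cg'.
  - by have := @pi_gt0 R; lra.
  - by lra.
  have := inn s; rewrite lexx st => /(_ isT).
  by move: pu; rewrite E cosDpi; lra.
move=> s t scd tcd; have [st|/ltW ts] := le_or_lt s t; first exact: key.
by rewrite distrC; exact: key.
Qed.

Lemma path_same g c d n : contp g c d ->
  (forall t, c <= t <= d -> MM <= re (F n.+1 (g t))) ->
  forall s t, c <= s <= d -> c <= t <= d -> `|im (F n (g s)) - im (F n (g t))| < pi.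
Proof.
move=> cg h; apply: path_strip; first exact: contp_F.
by move=> t tcd; apply: cos_gt0_Pi; exact: (h t tcd).
Qed.

Lemma path_same_all g c d : contp g c d -> (forall t, c <= t <= d -> stays MM (g t)) ->
  forall s t, c <= s <= d -> c <= t <= d -> same (g s) (g t).
Proof.
move=> cg h s t scd tcd n; apply: (path_same cg) => // u ucd; exact: h.
Qed.

(* At every late level the real part of the path takes the value of that of [p];
   contraction then brings the path arbitrarily close to [p]. *)
Lemma path_hits g c d p : c <= d -> contp g c d ->
  (forall t, c <= t <= d -> stays MM (g t)) -> stays MM p -> same (g c) p ->
  slower (g c) p /\ slower p (g d) \/ slower (g d) p /\ slower p (g c) ->
  exists2 t, c <= t <= d & g t = p.
Proof.
move=> cd cg st sp gp H.
have ccd : c <= c <= d by rewrite lexx cd.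
have sam t : c <= t <= d -> same (g t) p.
  move=> tcd; apply: (same_trans (st t tcd) (st c ccd) sp) => //.
  exact: path_same_all cg st _ _ tcd ccd.
have [t0 t0cd t0P] := contr_min cd (contp_dist p cg).
exists t0 => //; apply: dist1_small => e e0.
have [n nP] := half_pow_small (@pi_gt0 R) e0.
have [k [nk Hk]] : exists k, (n <= k)%N /\
  (re (F k (g c)) + KK <= re (F k p) /\ re (F k p) + KK <= re (F k (g d)) \/
   re (F k (g d)) + KK <= re (F k p) /\ re (F k p) + KK <= re (F k (g c))).
  case: H => -[[i Hi] [j Hj]]; exists (n + i + j)%N; (split; first by rewrite -addnA leq_addr).
    left; split; [apply: Hi|apply: Hj; exact: leq_addl].
    by apply: leq_trans (leq_addr _ _); exact: leq_addl.
  right; split; [apply: Hi|apply: Hj; exact: leq_addl].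
  by apply: leq_trans (leq_addr _ _); exact: leq_addl.
have K2 := KK_ge; have cF := contp_re (contp_F k cg).
have [t tcd E] : exists2 t, c <= t <= d & re (F k (g t)) = re (F k p).
  case: Hk => -[? ?].
    by have [||t ? ?] := contr_IVT_up cd cF (v := re (F k p)); [lra|lra|exists t].
  by have [||t ? ?] := contr_IVT_dn cd cF (v := re (F k p)); [lra|lra|exists t].
apply: le_trans (t0P t tcd) _; apply: le_trans (nP k nk).
apply: le_trans (@contract_iter k (g t) p _ _) _.
- by move=> i _; rewrite ltW// sam.
- by move=> i _; split; [exact: st|exact: sp].
rewrite ler_pM2r ?invr_gt0 ?exprn_gt0// /dist1 E subrr normr0 add0r ltW//.
exact: sam.
Qed.

Definition loc_inj g c d := forall t, c <= t <= d -> exists2 r, 0 < r &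
  forall s s', c <= s <= d -> c <= s' <= d -> `|s - t| < r -> `|s' - t| < r ->
  g s = g s' -> s = s'.

(* A coincidence [g x = g y] produces another one on a subinterval at most
   2/3 times as long: the order [slower] plays the role of the real line. *)
Lemma path_inj g c d : contp g c d -> (forall t, c <= t <= d -> stays MM (g t)) ->
  loc_inj g c d ->
  forall x y, c <= x <= d -> c <= y <= d -> g x = g y -> x = y.
Proof.
move=> cg st li.
suff key x y : c <= x -> x < y -> y <= d -> g x <> g y.
  move=> x y /andP[cx xd] /andP[cy yd] E; have [xy|yx|//] := ltgtP x y.
    by case: (key x y cx xy yd).
  by case: (key y x cy yx xd); rewrite E.
move=> cx xy yd E.
pose P (n : nat) (u v : R) := [/\ c <= u, u < v, v <= d, g u = g v &
   v - u <= (y - x) / ((3 / 2) ^+ n)].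
have [||t tP] := @nested_intervals R P x y (ltW xy).
- by split => //; rewrite expr0 divr1.
- move=> n u v uv [cu uv' vd guv len].
  have scd s : u <= s <= v -> c <= s <= d.
    exact: itv_sub.
  have ucd : c <= u <= d by apply: scd; rewrite lexx.
  have shrink u' v' : u <= u' -> u' < v' -> v' <= v -> g u' = g v' -> v' - u' <= (2 / 3) * (v - u) ->
      exists x' y', [/\ u <= x', x' <= y', y' <= v & P n.+1 x' y'].
    move=> uu' uv1 vv1 E1 l; exists u', v'; split => //; first exact: ltW.
    split => //; [exact: le_trans cu uu'|exact: le_trans vv1 vd|]; rewrite exprS.
    have -> : (y - x) / (3 / 2 * (3 / 2) ^+ n) = 2 / 3 * ((y - x) / (3 / 2) ^+ n).
      by field; rewrite expf_neq0//; apply/eqP; lra.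
    by lra_from l len.
  (* Comparing the values at [p] and [q] with the common end value, and with each other, always
     yields a repeated value through [path_hits]. As [p] and [q] are near the middle, its two
     parameters are at most two thirds of the length apart. *)
  pose p := u + (9 / 20) * (v - u); pose q := u + (11 / 20) * (v - u).
  have up : u < p by rewrite /p; lra_from uv'.
  have pq : p < q by rewrite /p /q; lra_from uv'.
  have qv : q < v by rewrite /q; lra_from uv'.
  have icd s : u <= s <= v -> stays MM (g s) by move=> /scd; exact: st.
  have cgs s s' : u <= s -> s' <= v -> contp g s s'.
    by move=> us s'v; exact: contp_sub (le_trans cu us) (le_trans s'v vd) cg.
  have sm s s' : u <= s <= v -> u <= s' <= v -> same (g s) (g s').
    by move=> /scd ? /scd ?; apply: path_same_all cg st _ _ _ _.
  have iu : u <= u <= v by rewrite lexx ltW.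
  have ip : u <= p <= v by rewrite !ltW// (lt_trans pq).
  have iq : u <= q <= v by rewrite !ltW// (lt_trans up).
  have iv : u <= v <= v by rewrite lexx ltW.
  have hit s s' w : u <= s -> s <= s' -> s' <= v -> stays MM w -> same (g s) w ->
     slower (g s) w /\ slower w (g s') \/ slower (g s') w /\ slower w (g s) ->
     exists2 t, s <= t <= s' & g t = w.
    move=> us ss' s'v sw sam H; apply: path_hits => //; first exact: cgs.
    by move=> t' t'P; apply: icd; exact: itv_sub t'P.
  have vu0 : 0 < v - u by rewrite subr_gt0.
  have L1 t : u <= t -> q - t <= 2 / 3 * (v - u) by rewrite /q => k1; lra_from k1 vu0.
  have L2 t : t <= v -> t - p <= 2 / 3 * (v - u) by rewrite /p => k1; lra_from k1 vu0.
  have L3 t : t <= q -> t - u <= 2 / 3 * (v - u) by rewrite /q => k1; lra_from k1 vu0.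
  have up' := ltW up; have pq' := ltW pq; have qv' := ltW qv.
  have pv' := le_trans pq' qv'; have uq' := le_trans up' pq'.
  have uq : u < q by exact: lt_trans pq.
  have pv : p < v by exact: lt_trans qv.
  have huu := lexx u; have hvv := lexx v.
  have [pu|pu|Epu] := stays_trichotomy (icd p ip) (icd u iu) (sm _ _ ip iu);
  last by apply: (@shrink u p) => //; exact: L3.
  + have [qu|qu|Equ] := stays_trichotomy (icd q iq) (icd u iu) (sm _ _ iq iu);
    last by apply: (@shrink u q) => //; exact: L3.
    * have [PQ|PQ|EPQ] := stays_trichotomy (icd p ip) (icd q iq) (sm _ _ ip iq);
      last by apply: (@shrink p q) => //; exact: L2.
      -- have [||||t /andP[t1 t2] Et] := @hit u p (g q) _ _ _ (icd q iq) (sm _ _ iu iq) => //.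
         ++ by right.
         ++ by apply: (@shrink t q) => //; [exact: le_lt_trans pq|exact: L1].
      -- have [||||t /andP[t1 t2] Et] := @hit q v (g p) _ _ _ (icd p ip) (sm _ _ iq ip) => //.
         ++ by left; rewrite -guv.
         ++ by apply: (@shrink p t) => //; [exact: lt_le_trans pq _|exact: L2].
    * have [||||t /andP[t1 t2] Et] := @hit p q (g u) _ _ _ (icd u iu) (sm _ _ ip iu) => //.
      -- by left.
      -- by apply: (@shrink u t) => //; [exact: lt_le_trans up _|exact: le_trans qv'|exact: L3].
  + have [qu|qu|Equ] := stays_trichotomy (icd q iq) (icd u iu) (sm _ _ iq iu);
    last by apply: (@shrink u q) => //; exact: L3.
    * have [||||t /andP[t1 t2] Et] := @hit p q (g u) _ _ _ (icd u iu) (sm _ _ ip iu) => //.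
      -- by right.
      -- by apply: (@shrink u t) => //; [exact: lt_le_trans up _|exact: le_trans qv'|exact: L3].
    * have [PQ|PQ|EPQ] := stays_trichotomy (icd p ip) (icd q iq) (sm _ _ ip iq);
      last by apply: (@shrink p q) => //; exact: L2.
      -- have [||||t /andP[t1 t2] Et] := @hit q v (g p) _ _ _ (icd p ip) (sm _ _ iq ip) => //.
         ++ by right; rewrite -guv.
         ++ by apply: (@shrink p t) => //; [exact: lt_le_trans pq _|exact: L2].
      -- have [||||t /andP[t1 t2] Et] := @hit u p (g q) _ _ _ (icd q iq) (sm _ _ iu iq) => //.
         ++ by left.
         ++ by apply: (@shrink t q) => //; [exact: le_lt_trans pq|exact: L1].
have tcd : c <= t <= d.
  have [u [v [tuv [cu _ vd _ _]]]] := tP 0%N.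
  exact: itv_sub tuv.
have [r r0 rP] := li t tcd.
have yx0 : 0 < y - x by lra.
have [n nP] := three_half_pow_small yx0 r0.
have [u [v [/andP[ut tv] [cu uv vd guv len]]]] := tP n.
suff E1 : u = v by move: uv; rewrite E1 ltxx.
apply: rP => //.
- by rewrite cu (le_trans (ltW uv)).
- by rewrite vd (le_trans cu (ltW uv)).
- by rewrite ler0_norm ?subr_le0//; lra_from tv len nP.
- by rewrite ger0_norm ?subr_ge0//; lra_from ut len nP.
Qed.

Lemma ReC (x y : R) : re (Complex x y : C) = x. Proof. by []. Qed.
Lemma ImC (x y : R) : im (Complex x y : C) = y. Proof. by []. Qed.

(** * Shadowing and rays *)

Lemma plane_cauchy (u : nat -> C) k : 0 <= k ->
  (forall n, dist1 (u n.+1) (u n) <= k / 2 ^+ n) ->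
  exists l, forall n, dist1 (u n) l <= 4 * k / 2 ^+ n.
Proof.
move=> k0 uk.
have pw n : k / 2 ^+ n = 2 * (k / 2 ^+ n.+1).
  by rewrite exprS; field; rewrite expf_neq0.
have key (T : C -> R) : (forall z w, `|T z - T w| <= dist1 z w) ->
    exists l, forall n, `|T (u n) - l| <= 2 * k / 2 ^+ n.
  move=> hT; pose P n (x y : R) := x = T (u n) - 2 * (k / 2 ^+ n) /\
    y = T (u n) + 2 * (k / 2 ^+ n).
  have pos n : 0 <= k / 2 ^+ n by rewrite divr_ge0// exprn_ge0.
  have [|||l lP] := @nested_intervals R P (T (u 0%N) - 2 * (k / 2 ^+ 0))
      (T (u 0%N) + 2 * (k / 2 ^+ 0)) _.
  - by have := pos 0%N; lra.
  - by [].
  - move=> n x y _ [-> ->]; exists (T (u n.+1) - 2 * (k / 2 ^+ n.+1)).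
    exists (T (u n.+1) + 2 * (k / 2 ^+ n.+1)).
    have := le_trans (hT (u n.+1) (u n)) (uk n).
    rewrite ler_norml pw; have := pos n.+1.
    by move=> e0 /andP[? ?]; split; [lra|lra|lra|split].
  exists l => n; have [x [y [/andP[? ?] [? ?]]]] := lP n.
  by rewrite -mulrA ler_norml; apply/andP; split; lra.
have [l1 h1] := key (fun z => re z) (fun z w => re_dist1 z w).
have [l2 h2] := key (fun z => im z) (fun z w => im_dist1 z w).
exists (Complex l1 l2) => n; have := h1 n; have := h2 n; rewrite /dist1 /= -!mulrA.
by move: (k / _) => e; lra.
Qed.

Lemma neq_a_Pi w : MM <= re w -> w <> a.
Proof.
move=> h E; have [? _ _ ? [? ? _]] := consts; have /andP[_ ?] := re_a_bound.
by move: h; rewrite E => h; clear E; lra.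
Qed.

Lemma lift_Pi z0 w : MM <= re (f z0) -> MM <= re w ->
  exists z, f z = w /\ `|im z - im z0| < pi.
Proof.
move=> h0 hw; have [z [zw zi]] := lift_exists (im z0) (neq_a_Pi hw).
exists z; split => //; apply: strip_neq_pi => //; apply: cos_gt0_Pi => //.
by rewrite zw.
Qed.

(** [B k i] is [q (i + k)] pulled back [k] times along the strips of the pseudo-orbit. If it is
    within [CC] of [q i] for every [i], then one more pullback starts from a point within [CC + CC]
    of [f (q i)] and halves this distance, so the bound reproduces itself. The [B k i] converge
    geometrically in [k], and their limits form an orbit. *)
Lemma shadow (q : nat -> C) :
  (forall i, dist1 (f (q i)) (q i.+1) <= CC) ->
  (forall i, MM + 2 * CC <= re (f (q i))) ->
  exists z, forall i, [/\ dist1 (F i z) (q i) <= CC, `|im (F i z) - im (q i)| < pi &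
    MM <= re (F i.+1 z)].
Proof.
move=> qC qM; have [A0 _ _ CE [_ _ _]] := consts.
have CC0 : 0 <= CC by lra.
have /choice[L LP] : forall zw : C * C, exists z, MM <= re (f zw.1) -> MM <= re zw.2 ->
    f z = zw.2 /\ `|im z - im zw.1| < pi.
  move=> [z0 w] /=; have [h0|h0] := pselect (MM <= re (f z0) /\ MM <= re w).
    by have [z H] := lift_Pi h0.1 h0.2; exists z.
  by exists z0 => h1 h2; case: h0.
pose B := fix B k i := if k is k'.+1 then L (q i, B k' i.+1) else q i.
have qMM i : MM <= re (f (q i)) by have := qM i; lra.
have near_re i w : dist1 w (q i.+1) <= CC -> MM <= re w.
  move=> hw; have := le_trans (re_dist1 _ _) hw.
  have := le_trans (re_dist1 _ _) (qC i); have := qM i.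
  by rewrite !ler_norml => ? /andP[? ?] /andP[? ?]; lra.
have BP k : forall i, dist1 (B k i) (q i) <= CC /\
   (0 < k)%N ==> (f (B k i) == B k.-1 i.+1) && (`|im (B k i) - im (q i)| < pi).
  elim: k => [|k IH] i; first by rewrite /= dist1_xx.
  have [h1 h2] := IH i.+1; have hB := near_re i _ h1.
  have [/= e1 e2] := LP (q i, B k i.+1) (qMM i) hB.
  split; last by rewrite /= e1 eqxx.
  apply: le_trans (_ : dist1 (f (B k.+1 i)) (f (q i)) / 2 <= _).
    by apply: (contract ); rewrite /= ?e1// ltW.
  rewrite /= e1; have := dist1_tri (B k i.+1) (q i.+1) (f (q i)).
  by rewrite (dist1C (q i.+1)); have := qC i; lra.
have Bf k i : f (B k.+1 i) = B k i.+1.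
  by have [_ /= /andP[/eqP]] := BP k.+1 i.
have Bim k i : `|im (B k i) - im (q i)| < pi.
  case: k => [|k]; first by rewrite /= subrr normr0 pi_gt0.
  by have [_ /= /andP[_]] := BP k.+1 i.
have BM k i : MM <= re (B k i.+1) by apply: near_re; exact: (BP k i.+1).1.
have Bcos k i : 0 < cos (im (B k i)).
  case: k => [|k]; first exact: cos_gt0_Pi.
  by apply: cos_gt0_Pi; rewrite Bf.
have qcos i : 0 < cos (im (q i)) by exact: (Bcos 0%N i).
have Bc k : forall i, dist1 (B k.+1 i) (B k i) <= CC / 2 ^+ k.
  elim: k => [|k IH] i; first by rewrite expr0 divr1; exact: (BP 1%N i).1.
  apply: le_trans (_ : dist1 (f (B k.+2 i)) (f (B k.+1 i)) / 2 <= _).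
    apply: (contract ); rewrite ?Bf//.
    by apply/ltW/(strip_trans (Bcos _ _) (qcos i) (Bcos _ _) (Bim _ _)); rewrite distrC.
  by rewrite !Bf; have := IH i.+1; rewrite exprSr invfM mulrA; lra.
have /choice[l lP] : forall i, exists l, forall k, dist1 (B k i) l <= 4 * CC / 2 ^+ k.
  by move=> i; apply: plane_cauchy => // k; exact: Bc.
have C40 : 0 < 4 * CC by lra.
have Fl i : f (l i) = l i.+1.
  apply: dist1_small => e e0; have e20 : 0 < e / 2 by lra.
  have [r r0 rP] := @contC_f (l i) (e / 2) e20.
  have r20 : 0 < r / 2 by lra.
  have [n1 h1] := half_pow_small C40 r20; have [n2 h2] := half_pow_small C40 e20.
  pose n := (n1 + n2)%N.
  have := rP (B n.+1 i); rewrite Bf.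
  have := lP i n.+1; have := h1 n.+1 (leqW (leq_addr _ _)) => ? ?.
  move=> /(_ _); have := lP i.+1 n; have := h2 n (leq_addl _ _) => ? ? /(_ _).
  have /[swap]/[apply] : dist1 (B n.+1 i) (l i) < r by lra.
  by have := dist1_tri (f (l i)) (B n i.+1) (l i.+1); rewrite (dist1C (f (l i)) (B n i.+1)); lra.
have lF i : F i (l 0%N) = l i by elim: i => //= i ->.
have ld i : dist1 (l i) (q i) <= CC.
  rewrite leNgt; apply/negP => hlt; have d0 : 0 < (dist1 (l i) (q i) - CC) / 2 by lra.
  have [n h] := half_pow_small C40 d0; have := lP i n; have := h n (leqnn n).
  have := dist1_tri (l i) (B n i) (q i); have := (BP n i).1.
  by rewrite (dist1C (l i) (B n i)); lra.
have lM i : MM <= re (l i.+1) by apply: near_re.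
exists (l 0%N) => i; rewrite !lF; split => //.
apply: strip_neq_pi => //; first by apply: cos_gt0_Pi; rewrite Fl.
rewrite leNgt; apply/negP => hlt.
have d0 : 0 < (`|im (l i) - im (q i)| - pi) / 2 by lra.
have [n h] := half_pow_small C40 d0; have := lP i n; have := h n (leqnn n).
have := im_dist1 (B n i) (l i); have := Bim n i.
have := ler_distD (im (B n i)) (im (l i)) (im (q i)); rewrite (distrC (im (l i)) (im (B n i))).
lra.
Qed.

Lemma bounded_same_eq z w k : stays MM z -> stays MM w -> same z w ->
  (forall i, dist1 (F i z) (F i w) <= k) -> z = w.
Proof.
move=> sz sw zw bd; apply: dist1_small => e e0.
have k1 : 0 < `|k| + 1 by have := normr_ge0 k; lra.
have [n nP] := half_pow_small k1 e0; apply: le_trans (nP n (leqnn n)).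
apply: le_trans (@contract_iter n z w _ _) _.
- by move=> i _; rewrite ltW.
- by move=> i _.
rewrite ler_pM2r ?invr_gt0 ?exprn_gt0//; apply: le_trans (bd n) _.
by have := ler_norm k; lra.
Qed.

(** A lead [p] over the real part [r] becomes a lead [e^r (e^p - 1)] in modulus after one step. In
    this one-dimensional model, [push u x i] is the lead over the orbit of [u] at time [i] that
    starts as [x]. *)
Fixpoint push u x i : R :=
  if i is j.+1 then expR (re (F j u)) * (expR (push u x j) - 1) else x.

Lemma push0 u i : push u 0 i = 0.
Proof. by elim: i => //= i ->; rewrite expR0 subrr mulr0. Qed.

Lemma expR_re_ge2 u i : stays M1 u -> 2 <= expR (re (F i u)).
Proof.
move=> su; have := su i; have := expR_ge1Dx (re (F i u)).
by have [? _ _ ? [? ? ?]] := consts; lra.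
Qed.

Lemma push_ge u x y i : stays M1 u -> 0 <= x -> x <= y ->
  0 <= push u x i /\ 2 ^+ i * (y - x) <= push u y i - push u x i.
Proof.
move=> su x0 xy; elim: i => [|i [h0 IH]] /=; first by rewrite expr0 mul1r.
have e2 := expR_re_ge2 i su; have e0 := expR_gt0 (re (F i u)).
have yx : 0 <= push u y i - push u x i.
  by apply: le_trans IH; rewrite mulr_ge0 ?exprn_ge0// subr_ge0.
have e1 : 1 <= expR (push u x i) by have := expR_ge1Dx (push u x i); lra.
split; first by rewrite mulr_ge0 ?(ltW e0)// subr_ge0.
rewrite -mulrBr opprB addrA subrK.
have := expand_lt e1 yx; rewrite mul1r => h.
apply: le_trans (_ : 2 * (push u y i - push u x i) <= _).
  by rewrite exprS -mulrA ler_pM2l.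
by apply: ler_pM => //; lra.
Qed.

Lemma push_cont u i t : forall e, 0 < e -> exists2 r, 0 < r &
  forall s, `|s - t| < r -> `|push u s i - push u t i| < e.
Proof.
have : {for t, continuous (fun x => push u x i)}.
  elim: i => [|i IH] /=; first by move=> ?.
  apply: cvgM; first exact: cvg_cst.
  apply: cvgB; last exact: cvg_cst.
  apply: continuous_comp; first exact: IH.
  exact: continuous_expR.
move=> /cvgrPdist_lt ct e e0; have /nbhs_ballP[r /= r0 rP] := ct e e0.
by exists r => // s st; rewrite distrC; apply: rP; rewrite /ball /= distrC.
Qed.

(* The point [F i u + push u x i] is pulled back along the orbit of [u] to within
   bounded distance of [F i.-1 u + push u x i.-1]. *)
Lemma push_lift u x i : stays M1 u -> 0 <= x -> exists q,
  [/\ re (f q) = re (F i.+1 u) + push u x i.+1, im (f q) = im (F i.+1 u),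
     `|im q - im (F i u)| < pi &
     re (F i u) + push u x i - 1 <= re q <= re (F i u) + push u x i].
Proof.
move=> su x0; have [A0 _ _ CE [KE ME M1E]] := consts; have /andP[ra1 ra2] := re_a_bound.
have y0 : 0 <= push u x i by case: (push_ge i su x0 (lexx x)).
have y1 : 0 <= push u x i.+1 by case: (push_ge i.+1 su x0 (lexx x)).
have hu := su i.+1.
have hw : MM <= re (Complex (re (F i.+1 u) + push u x i.+1) (im (F i.+1 u)) : C).
  by rewrite ReC; lra.
have hu' : MM <= re (f (F i u)) by rewrite -iterS; lra.
have [q [fq qi]] := lift_Pi hu' hw; exists q; rewrite fq ReC ImC; split => //.
have := modulus_f q; have := modulus_f (F i u); rewrite fq ReC ImC -!iterS.
set U := re (iter i.+1 f u) - re a; set V := im _ - im a.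
set E := expR (re (F i u)).
have EU : 0 <= U by rewrite /U; lra.
move=> h1; have -> : re (iter i.+1 f u) + E * (expR (push u x i) - 1) - re a = U + E * (expR (push u x i) - 1).
  by rewrite /U; ring.
have e1 : 0 <= expR (push u x i) - 1 by have := expR_ge1Dx (push u x i); lra.
have E0 : 0 < E by exact: expR_gt0.
have UE : U <= E.
  rewrite -(ler_pXn2r (ltn0Sn 1)) ?nnegrE ?(ltW E0)// -h1; have := sqr_ge0 V; lra.
set k := expR (push u x i) - 1 in e1 *.
move=> h2.
have up : expR (re q) <= E * (k + 1).
  rewrite -(ler_pXn2r (ltn0Sn 1)) ?nnegrE ?expR_ge0 ?mulr_ge0 ?(ltW E0)//; last lra.
  rewrite -h2; have -> : (U + E * k) ^+ 2 + V ^+ 2 = (U ^+ 2 + V ^+ 2) + 2 * (E * k) * U + (E * k) ^+ 2 by ring.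
  rewrite h1; have -> : (E * (k + 1)) ^+ 2 = E ^+ 2 + 2 * (E * k) * E + (E * k) ^+ 2 by ring.
  have Ek : 0 <= 2 * (E * k) by rewrite mulr_ge0// mulr_ge0// ltW.
  by have := ler_wpM2l Ek UE; lra.
have dn : E * (k + 1) <= expR (re q) * 2.
  rewrite -(ler_pXn2r (ltn0Sn 1)) ?nnegrE ?mulr_ge0 ?expR_ge0 ?(ltW E0)//; last lra.
  rewrite [_ ^+ 2 in leRHS]exprMn -h2.
  have -> : (U + E * k) ^+ 2 + V ^+ 2 = (U ^+ 2 + V ^+ 2) + 2 * (E * k) * U + (E * k) ^+ 2 by ring.
  rewrite h1; have -> : (E * (k + 1)) ^+ 2 = 2 * E ^+ 2 + 2 * (E * k) ^+ 2 - (E - E * k) ^+ 2 by ring.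
  have := sqr_ge0 (E - E * k); have := sqr_ge0 E; have := sqr_ge0 (E * k).
  have : 0 <= 2 * (E * k) * U by rewrite mulr_ge0// mulr_ge0// mulr_ge0// ltW.
  by rewrite -natrX; move: (E ^+ 2) ((E * k) ^+ 2) (2 * (E * k) * U) ((E - E * k) ^+ 2) => *; lra.
have Ek : E * (k + 1) = expR (re (F i u) + push u x i) by rewrite /k subrK expRD.
have exp1 : 2 <= expR (1 : R) by have := expR_ge1Dx (1 : R); lra.
apply/andP; split; last by rewrite -ler_expR -Ek.
rewrite -ler_expR expRD -Ek expRN ler_pdivrMr ?expR_gt0//.
by apply: le_trans dn _; rewrite ler_pM2l ?expR_gt0.
Qed.

Lemma tail_point u x : stays M1 u -> 0 <= x -> exists z,
  [/\ stays MM z, same z u & forall i,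
     re (F i u) + push u x i - 1 - CC <= re (F i z) <= re (F i u) + push u x i + CC].
Proof.
move=> su x0; have [A0 _ _ CE [KE ME M1E]] := consts.
have /choice[q qP] := fun i => push_lift i su x0.
have p0 i : 0 <= push u x i by case: (push_ge i su x0 (lexx x)).
have p4 := @pi_le4 R.
have [||z zP] := @shadow q.
- move=> i; have [h1 h2 _ _] := qP i; have [_ _ h3 h4] := qP i.+1.
  rewrite /dist1 h1 h2 distrC (distrC (im (F i.+1 u))).
  suff k1 : `|re (q i.+1) - (re (F i.+1 u) + push u x i.+1)| <= 1 by lra_from k1 h3 p4 A0 CE.
  by move: h4 => /andP[k1 k2]; rewrite ler_norml; apply/andP; split; [lra_from k1|lra_from k2].
- by move=> i; have [-> _ _ _] := qP i; have k1 := su i.+1; have k2 := p0 i.+1; lra_from k1 k2 A0 M1E KE CE.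
have bd i : re (F i u) + push u x i - 1 - CC <= re (F i z) <= re (F i u) + push u x i + CC.
  have [h _ _] := zP i; have [_ _ _ /andP[k1 k2]] := qP i.
  have := le_trans (re_dist1 _ _) h; rewrite ler_norml => /andP[k3 k4].
  by apply/andP; split; [lra_from k1 k3|lra_from k2 k4].
have sz : stays MM z.
  by move=> i; have /andP[? _] := bd i; have := su i; have := p0 i; lra.
exists z; split => // i; have [h1 h2 h3 h4] := qP i; have [_ k2 _] := zP i.
have hu : MM <= re (F i.+1 u) by have := su i.+1; lra.
apply: strip_trans k2 h3; [exact: stays_cos| |exact: cos_gt0_Pi].
by apply: cos_gt0_Pi; rewrite h1; have := p0 i.+1; lra.
Qed.

(** [H x] shadows the points leading by [push u x i]. Up to a time [n], parameters close together
    have close leads, so contraction gives continuity. The leads of distinct parameters separate at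
    least like [2 ^ i], which gives the order, and the zero lead gives back [u]. *)
Lemma tail u : stays M1 u -> exists H : R -> C,
  [/\ H 0 = u,
      forall x, 0 <= x -> [/\ stays MM (H x), same (H x) u &
         forall i, re (F i u) - 1 - CC <= re (F i (H x))],
      forall X, contp H 0 X,
      forall x y, 0 <= x -> x < y -> slower (H x) (H y) &
      (forall x, 0 <= x -> re u + x - 1 - CC <= re (H x)) /\
      forall x B, 0 < x -> exists n, forall k, (n <= k)%N -> B <= re (F k (H x))].
Proof.
move=> su; have [A0 _ _ CE [KE ME M1E]] := consts; have p4 := @pi_le4 R.
have /choice[H0 HP] : forall x, exists z, 0 <= x -> [/\ stays MM z, same z u & forall i,
     re (F i u) + push u x i - 1 - CC <= re (F i z) <= re (F i u) + push u x i + CC].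
  move=> x; have [x0|x0] := le_or_lt 0 x; last by exists 0 => /(lt_le_trans x0); rewrite ltxx.
  by have [z zP] := tail_point su x0; exists z.
have suM : stays MM u by apply: stays_le su; lra.
have p0 i x : 0 <= x -> 0 <= push u x i by move=> x0; case: (push_ge i su x0 (lexx x)).
exists H0; split.
- have [h1 h2 h3] := HP 0 (lexx 0).
  apply: (@bounded_same_eq _ _ (CC + 1 + 4)) => // i.
  have := h3 i; rewrite push0 => /andP[k1 k2]; have k3 := h2 i.
  rewrite /dist1; suff k4 : `|re (F i (H0 0)) - re (F i u)| <= CC + 1 by lra_from k3 k4 p4.
  by rewrite ler_norml; apply/andP; split; [lra_from k1|lra_from k2].
- move=> x x0; have [h1 h2 h3] := HP x x0; split => // i.
  by have /andP[k1 _] := h3 i; have k2 := p0 i x x0; lra_from k1 k2.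
- move=> X t /andP[t0 tX] e e0.
  have k0 : 0 < 2 * CC + 6 by lra.
  have e20 : 0 < e / 2 by lra.
  have [n nP] := half_pow_small k0 e20.
  have one : (0 : R) < 1 by [].
  have [r r0 rP] := push_cont u n t one.
  exists r => // s /andP[s0 sX] /rP; rewrite ltr_norml => /andP[st1 st2].
  have [h1 h2 h3] := HP t t0; have [k1 k2 k3] := HP s s0.
  have sm : same (H0 s) (H0 t) by apply: same_trans k2 (same_sym h2).
  apply: le_lt_trans (_ : e / 2 < _); last by lra_from e0.
  apply: le_trans (nP n (leqnn n)).
  apply: le_trans (@contract_iter n (H0 s) (H0 t) _ _) _.
  + by move=> i _; rewrite ltW.
  + by move=> i _.
  rewrite ler_pM2r ?invr_gt0 ?exprn_gt0// /dist1.
  have /andP[j1 j2] := h3 n; have /andP[j3 j4] := k3 n; have j5 := sm n.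
  suff j6 : `|re (F n (H0 s)) - re (F n (H0 t))| <= 2 * CC + 2 by lra_from j5 j6 p4.
  by rewrite ler_norml; apply/andP; split; [lra_from j2 j3 st1|lra_from j1 j4 st2].
- move=> x y x0 xy; have y0 : 0 <= y by lra.
  have [h1 h2 h3] := HP x x0; have [k1 k2 k3] := HP y y0.
  have k0 : 0 < KK + 2 * CC + 1 by lra.
  have yx : 0 < y - x by lra.
  have [n nP] := half_pow_small k0 yx; exists n => i ni.
  have /andP[? ?] := h3 i; have /andP[? ?] := k3 i.
  have [_ ] := push_ge i su x0 (ltW xy).
  have := nP i ni; rewrite ler_pdivrMr ?exprn_gt0// (mulrC (y - x)).
  by move: (2 ^+ i * _) => v *; lra.
split.
- by move=> x x0; have [_ _ h3] := HP x x0; have /andP[? _] := h3 0%N.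
- move=> x B x0; have [h1 h2 h3] := HP x (ltW x0).
  have k0 : 0 < `|B| + 1 by have := normr_ge0 B; lra.
  have [n nP] := half_pow_small k0 x0; exists n => i ni.
  have /andP[? ?] := h3 i; have [_ ] := push_ge i su (lexx 0) (ltW x0).
  have := nP i ni; rewrite ler_pdivrMr ?exprn_gt0// push0 !subr0 (mulrC x).
  have := ler_norm B; have := su i.
  by move: (2 ^+ i * _) => v *; lra.
Qed.

(** * Crossing itineraries *)

Lemma last_time (P : R -> Prop) c d : c <= d -> P c ->
  (forall t, c <= t <= d -> ~ P t -> exists2 r : R, 0 < r &
     forall s, c <= s <= d -> `|s - t| < r -> ~ P s) ->
  exists t, [/\ c <= t <= d, P t & forall s, t < s -> s <= d -> ~ P s].
Proof.
move=> cd Pc op; pose E := [set t | c <= t <= d /\ P t].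
have E0 : E !=set0 by exists c; split => //; rewrite lexx.
have Eb : has_ubound E by exists d => t [/andP[]].
have hs : has_sup E by split.
have c1 : c <= sup E by apply: ub_le_sup => //; split => //; rewrite lexx.
have c2 : sup E <= d by apply: ge_sup => // t [/andP[]].
exists (sup E); split; first by rewrite c1.
  apply: contrapT => nP; have [|r r0 rP] := op (sup E) _ nP; first by rewrite c1.
  have [t [tcd Pt] tr] := sup_adherent r0 hs.
  apply: (rP t tcd _ Pt); rewrite ler0_norm ?opprB; last first.
    by rewrite subr_le0; apply: ub_le_sup.
  lra.
move=> s st sd Ps; have : s <= sup E.
  by apply: ub_le_sup => //; split => //; apply/andP; split => //; lra.
lra.
Qed.

Lemma contp_flip g c d : contp g c d -> contp (fun t => g (c + d - t)) c d.
Proof.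
move=> ch t tcd e e0.
have fl s : c <= s <= d -> c <= c + d - s <= d by move=> /andP[? ?]; apply/andP; split; lra.
have [r r0 rP] := ch _ (fl t tcd) e e0; exists r => // s scd st.
apply: rP; first exact: fl.
have -> : c + d - s - (c + d - t) = - (s - t) by ring.
by rewrite normrN.
Qed.

Lemma first_time (P : R -> Prop) c d : c <= d -> P d ->
  (forall t, c <= t <= d -> ~ P t -> exists2 r : R, 0 < r &
     forall s, c <= s <= d -> `|s - t| < r -> ~ P s) ->
  exists t, [/\ c <= t <= d, P t & forall s, s < t -> c <= s -> ~ P s].
Proof.
move=> cd Pd op.
have fl s : c <= s <= d -> c <= c + d - s <= d by move=> /andP[? ?]; apply/andP; split; lra.
have inv s : c + d - (c + d - s) = s by ring.
have [||t [tcd Pt tP]] := @last_time (fun t => P (c + d - t)) c d cd.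
- by have -> : c + d - c = d by ring.
- move=> t tcd nP; have [r r0 rP] := op _ (fl t tcd) nP; exists r => // s scd st.
  apply: rP; first exact: fl.
  have -> : c + d - s - (c + d - t) = - (s - t) by ring.
  by rewrite normrN.
exists (c + d - t); split; [exact: fl|by []|].
by move=> s st cs; rewrite -[s]inv; apply: tP; move: tcd => /andP[? ?]; lra.
Qed.

Lemma lt_open h c d v t : contr h c d -> c <= t <= d -> h t < v ->
  exists2 r : R, 0 < r & forall s, c <= s <= d -> `|s - t| < r -> h s < v.
Proof.
move=> ch tcd hv; have e0 : 0 < v - h t by lra.
have [r r0 rP] := ch t tcd _ e0; exists r => // s scd st.
by have := rP s scd st; rewrite ltr_norml => /andP[? ?]; lra.
Qed.

Lemma gt_open h c d v t : contr h c d -> c <= t <= d -> v < h t ->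
  exists2 r : R, 0 < r & forall s, c <= s <= d -> `|s - t| < r -> v < h s.
Proof.
move=> ch tcd hv; have e0 : 0 < h t - v by lra.
have [r r0 rP] := ch t tcd _ e0; exists r => // s scd st.
by have := rP s scd st; rewrite ltr_norml => /andP[? ?]; lra.
Qed.

Lemma first_hit h c d v : c <= d -> contr h c d -> h c <= v -> v <= h d ->
  exists t, [/\ c <= t <= d, h t = v & forall s, c <= s <= t -> h s <= v].
Proof.
move=> cd ch hc hd; have [||t [tcd vt tP]] := @first_time (fun t => v <= h t) c d cd.
- by [].
- move=> t tcd /negP; rewrite -ltNge => hv.
  have [r r0 rP] := lt_open ch tcd hv; exists r => // s scd st.
  by apply/negP; rewrite -ltNge; exact: rP.
have /andP[ct td] := tcd.
have ht : h t = v.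
  have [s /andP[cs st] hs] := contr_IVT_up ct (contr_sub (lexx c) td ch) hc vt.
  have [st'|ts] := lt_or_le s t; first by case: (tP s st' cs); rewrite hs.
  by have -> : t = s by lra.
exists t; split => // s /andP[cs st]; have [st'|ts] := lt_or_le s t.
  by rewrite leNgt; apply/negP => /ltW; exact: tP.
have -> : s = t by lra.
by rewrite ht.
Qed.

Lemma last_hit h c d v : c <= d -> contr h c d -> h c <= v -> v <= h d ->
  exists t, [/\ c <= t <= d, h t = v & forall s, t <= s <= d -> v <= h s].
Proof.
move=> cd ch hc hd; have [||t [tcd vt tP]] := @last_time (fun t => h t <= v) c d cd.
- by [].
- move=> t tcd /negP; rewrite -ltNge => hv.
  have [r r0 rP] := gt_open ch tcd hv; exists r => // s scd st.
  by apply/negP; rewrite -ltNge; exact: rP.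
have /andP[ct td] := tcd.
have ht : h t = v.
  have [s /andP[ts sd] hs] := contr_IVT_up td (contr_sub ct (lexx d) ch) vt hd.
  have [ts'|st] := lt_or_le t s; first by case: (tP s ts' sd); rewrite hs.
  by have -> : t = s by lra.
exists t; split => // s /andP[ts sd]; have [ts'|st] := lt_or_le t s.
  by rewrite leNgt; apply/negP => /ltW; exact: tP.
have -> : s = t by lra.
by rewrite ht.
Qed.

Lemma contr_end_ge h c d m : c < d -> contr h c d ->
  (forall s, c < s -> s < d -> m < h s) -> m <= h c /\ m <= h d.
Proof.
move=> cd ch inn; have ccd : c <= c <= d by rewrite lexx ltW.
have dcd : c <= d <= d by rewrite lexx ltW.
split; rewrite leNgt; apply/negP => l.
  have [r r0 rP] := lt_open ch ccd l; pose s := c + Num.min r (d - c) / 2.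
  have m1 : Num.min r (d - c) <= r by rewrite ge_min lexx.
  have m2 : Num.min r (d - c) <= d - c by rewrite ge_min lexx orbT.
  have m3 : 0 < Num.min r (d - c) by rewrite lt_min r0 subr_gt0.
  have s1 : c < s by rewrite /s; lra.
  have s2 : s < d by rewrite /s; lra.
  have s3 : `|s - c| < r by rewrite ger0_norm /s; lra.
  have s4 : c <= s <= d by rewrite !ltW.
  by have := inn s s1 s2; have := rP s s4 s3; clear; lra.
have [r r0 rP] := lt_open ch dcd l; pose s := d - Num.min r (d - c) / 2.
have m1 : Num.min r (d - c) <= r by rewrite ge_min lexx.
have m2 : Num.min r (d - c) <= d - c by rewrite ge_min lexx orbT.
have m3 : 0 < Num.min r (d - c) by rewrite lt_min r0 subr_gt0.
have s1 : c < s by rewrite /s; lra.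
have s2 : s < d by rewrite /s; lra.
have s3 : `|s - d| < r by rewrite ler0_norm /s; lra.
have s4 : c <= s <= d by rewrite !ltW.
by have := inn s s1 s2; have := rP s s4 s3; clear; lra.
Qed.

Lemma expR_MM x : MM <= x -> 3 * MM <= expR x.
Proof.
move=> hx; have [? _ _ ? [? ? _]] := consts.
have M200 : 200 <= MM by lra.
apply: le_trans (_ : expR MM <= _); last by rewrite ler_expR.
have -> : expR MM = expR (MM / 2) * expR (MM / 2) by rewrite -expRD -splitr.
have h : 1 + MM / 2 <= expR (MM / 2) := expR_ge1Dx _.
apply: le_trans (_ : (1 + MM / 2) * (1 + MM / 2) <= _); last by apply: ler_pM; lra.
have := mulr_ge0 (_ : 0 <= MM - 200) (_ : 0 <= MM - 200).
have /[swap]/[apply] : 0 <= MM - 200 by lra.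
have /[swap]/[apply] : 0 <= MM - 200 by lra.
move: (MM) M200; clear => m ? h; nra.
Qed.

(** While the path crosses the strip around [y], the image stays at distance at least [3 * MM] from
    [a] and turns from below to above. The piece is cut at the last parameter in the lower half of
    the strip, and at the first later one in the upper half, where the image has real part at most
    [MM]. There the real part explains at most [2 * MM] of that distance, so the imaginary part is
    beyond 40 in absolute value. *)
Lemma cross_step g c d y : c <= d -> contp g c d ->
  (forall t, c <= t <= d -> MM <= re (g t)) -> cos y = 1 -> sin y = 0 ->
  im (g c) <= y - pi / 2 -> y + pi / 2 <= im (g d) ->
  exists c' d', [/\ c <= c', c' <= d', d' <= d &
    (forall t, c' <= t <= d' -> `|im (g t) - y| <= pi / 2 /\ MM <= re (f (g t))) /\
    im (f (g c')) <= - 40 /\ 40 <= im (f (g d'))].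
Proof.
move=> cd cg gM cy sy gc gd; have p0 := @pi_gt0 R.
have [A0 _ _ CE [KE ME _]] := consts; have /andP[ra1 ra2] := re_a_bound.
have /andP[ia1 ia2] := im_a_bound.
have cim := contp_im cg.
have [||d1 [/andP[cd1 d1d] hd1 d1P]] := @first_hit _ c d (y + pi / 2) cd cim; [lra_from gc p0|lra_from gd|].
have cim1 := contr_sub (lexx c) d1d cim.
have [||c1 [/andP[cc1 c1d1] hc1 c1P]] := @last_hit _ c d1 (y - pi / 2) cd1 cim1; [lra_from gc|lra_from hd1 p0|].
have str t : c1 <= t <= d1 -> - (pi / 2) <= im (g t) - y <= pi / 2.
  move=> /andP[h1 h2]; have := c1P t; have := d1P t; rewrite h1 h2 (le_trans cc1 h1).
  by move=> /(_ isT) k1 /(_ isT) k2; apply/andP; split; [lra_from k2|lra_from k1].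
pose G t := re (f (g t)).
have cG : contr G c d by apply: contp_re; exact: (contp_F 1 cg).
have c1d : c1 <= d by exact: le_trans d1d.
have sub t : c1 <= t <= d1 -> c <= t <= d by exact: itv_sub.
have cf t : cos (im (g t)) = cos (im (g t) - y).
  by rewrite cosB cy sy mulr1 mulr0 addr0.
have sf t : sin (im (g t)) = sin (im (g t) - y).
  by rewrite sinB cy sy mulr1 mulr0 subr0.
have E3 t : c1 <= t <= d1 -> 3 * MM <= expR (re (g t)).
  by move=> /sub; move=> /gM/expR_MM.
have big t : c1 <= t <= d1 -> G t <= MM -> 40 + Aa <= `|im (f (g t)) - im a|.
  move=> tcd Gt; have tE := E3 t tcd; have tm := modulus_f (g t).
  have A40 : 0 <= 40 + Aa by lra_from A0.
  have MM0 : 40 + Aa <= MM by lra_from A0 CE KE ME.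
  rewrite -(ler_pXn2r (ltn0Sn 1)) ?nnegrE// real_normK ?num_real//.
  have c0 : 0 <= re (f (g t)) - re a.
    by rewrite re_f addrK mulr_ge0 ?expR_ge0// cf; apply: cos_ge0_pihalf; exact: str.
  have h1 : (re (f (g t)) - re a) ^+ 2 <= (2 * MM) ^+ 2.
    by rewrite ler_pXn2r ?nnegrE//; [move: Gt; rewrite /G => Gt; lra_from Gt A0 A40 MM0 ra1|lra_from A40 MM0].
  have h2 : (3 * MM) ^+ 2 <= expR (re (g t)) ^+ 2.
    by rewrite ler_pXn2r ?nnegrE ?expR_ge0//; lra_from A40 MM0.
  have h3 : (40 + Aa) ^+ 2 <= MM ^+ 2 by rewrite ler_pXn2r// nnegrE; exact: le_trans MM0.
  have h4 := sqr_ge0 MM.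
  have e4 : (2 * MM) ^+ 2 = 4 * MM ^+ 2 by ring.
  have e9 : (3 * MM) ^+ 2 = 9 * MM ^+ 2 by ring.
  rewrite e4 in h1; rewrite e9 in h2; move: tm h1 h2 h3 h4; clear_props.
  move: ((re (f (g t)) - re a) ^+ 2) ((im (f (g t)) - im a) ^+ 2).
  move: (expR (re (g t)) ^+ 2) ((40 + Aa) ^+ 2) (MM ^+ 2).
  by move=> *; lra.
have sgn t : c1 <= t <= d1 -> G t <= MM ->
    (im (g t) <= y -> im (f (g t)) <= - 40) /\ (y <= im (g t) -> 40 <= im (f (g t))).
  move=> tcd Gt; have := big t tcd Gt; have /andP[t1 t2] := str t tcd.
  have E0 := expR_gt0 (re (g t)).
  have -> : im (f (g t)) = expR (re (g t)) * sin (im (g t) - y) + im a by rewrite im_f sf.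
  rewrite addrK; move=> h; split=> hy.
    have : 0 <= sin (- (im (g t) - y)) by apply: sin_ge0_pi; lra_from t1 t2 hy p0.
    rewrite sinN oppr_ge0 => s0; have h0 : expR (re (g t)) * sin (im (g t) - y) <= 0.
      by rewrite pmulr_rle0.
    by rewrite ler0_norm// in h; move: (_ * sin _) h => w h; lra_from h ia1 ia2 A0.
  have s0 : 0 <= sin (im (g t) - y) by apply: sin_ge0_pi; lra_from t1 t2 hy p0.
  have h0 : 0 <= expR (re (g t)) * sin (im (g t) - y) by rewrite pmulr_rge0.
  by rewrite ger0_norm// in h; move: (_ * sin _) h => w h; lra_from h ia1 ia2 A0.
have cG1 := contr_sub cc1 d1d cG; have cim2 := contr_sub cc1 d1d cim.
have Gend t : cos (im (g t) - y) = 0 -> G t <= MM.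
  by move=> h; rewrite /G re_f cf h mulr0 add0r; lra_from ra2 A0 CE KE ME.
have [||c' [c'cd [Gc' yc'] c'P]] :=
    @last_time (fun t => G t <= MM /\ im (g t) <= y) c1 d1 c1d1.
- split; last by lra_from hc1 p0.
  by apply: Gend; rewrite hc1 addrAC subrr add0r cosN cos_pihalf.
- move=> t tcd nP; have [hG|hG] := le_or_lt (G t) MM.
    have hy : y < im (g t) by rewrite ltNge; apply/negP => hy; exact: nP.
    have [r r0 rP] := gt_open cim2 tcd hy; exists r => // s scd st [_].
    by rewrite leNgt; move/negP; apply; exact: rP.
  have [r r0 rP] := gt_open cG1 tcd hG; exists r => // s scd st [].
  by rewrite leNgt; move/negP => + _; apply; exact: rP.
have /andP[c1c' c'd1] := c'cd.
have cG2 := contr_sub c1c' (lexx d1) cG1; have cim3 := contr_sub c1c' (lexx d1) cim2.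
have [||d' [d'cd [Gd' yd'] d'P]] :=
    @first_time (fun t => G t <= MM /\ y <= im (g t)) c' d1 c'd1.
- split; last by lra_from hd1 p0.
  by apply: Gend; rewrite hd1 addrAC subrr add0r cos_pihalf.
- move=> t tcd nP; have [hG|hG] := le_or_lt (G t) MM.
    have hy : im (g t) < y by rewrite ltNge; apply/negP => hy; exact: nP.
    have [r r0 rP] := lt_open cim3 tcd hy; exists r => // s scd st [_].
    by rewrite leNgt; move/negP; apply; exact: rP.
  have [r r0 rP] := gt_open cG2 tcd hG; exists r => // s scd st [].
  by rewrite leNgt; move/negP => + _; apply; exact: rP.
have /andP[c'd' d'd1] := d'cd.
have d'cd1 : c1 <= d' <= d1 by rewrite d'd1 andbT (le_trans c1c').
have inner s : c' < s -> s < d' -> MM < G s.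
  move=> c's sd'; rewrite ltNge; apply/negP => Gs.
  have sd1 : s <= d1 by apply: le_trans d'd1; exact: ltW.
  have [sy'|sy'] := le_or_lt (im (g s)) y; first by apply: (c'P s c's sd1).
  by apply: (d'P s sd' (ltW c's)); split => //; exact: ltW.
have neq : c' < d'.
  rewrite lt_def c'd' andbT; apply/negP => /eqP E.
  have im0 : im (g c') - y = 0 by rewrite E in yd'; lra_from yc' yd'.
  move: Gc'; rewrite /G re_f cf im0 cos0 mulr1; have := E3 c' c'cd => h3 h4; lra_from h3 h4 ra1 A0 CE KE ME.
have [Gc'' Gd''] : MM <= G c' /\ MM <= G d'.
  apply: contr_end_ge neq _ inner.
  exact: contr_sub d'd1 cG2.
exists c', d'; split; [exact: le_trans c1c'|exact: c'd'|exact: le_trans d1d|split; [|split]].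
- move=> t /andP[t1 t2]; have tcd : c1 <= t <= d1 by rewrite (le_trans c1c' t1) (le_trans t2 d'd1).
  split; first by rewrite ler_norml; exact: str.
  have [t1'|t1'] := lt_or_le c' t; last by have -> : t = c' by apply/le_anti; rewrite t1'.
  have [t2'|t2'] := lt_or_le t d'; last by have -> : t = d' by apply/le_anti; rewrite t2.
  exact/ltW/inner.
- exact: (sgn c' c'cd Gc').1 yc'.
- exact: (sgn d' d'cd1 Gd').2 yd'.
Qed.

(** Each [cross_step] leaves an image running from below [- 40] to above 40, which again crosses the
    strip around [y']. The bound 32 admits [y' = 8 pi]. *)
Lemma crossing_itinerary g c d y y' : c <= d -> contp g c d ->
  (forall t, c <= t <= d -> MM <= re (g t)) -> cos y = 1 -> sin y = 0 ->
  im (g c) <= y - pi / 2 -> y + pi / 2 <= im (g d) ->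
  cos y' = 1 -> sin y' = 0 -> 0 <= y' <= 32 ->
  exists t, [/\ c <= t <= d, stays MM (g t) &
    forall n, `|im (F n.+1 (g t)) - y'| <= pi / 2].
Proof.
move=> cd cg gM cy sy gc gd cy' sy' /andP[y0 y32].
have p0 := @pi_gt0 R; have p4 := @pi_le4 R.
pose Y n := if n is _.+1 then y' else y.
have cY n : cos (Y n) = 1 by case: n.
have sY n : sin (Y n) = 0 by case: n.
pose P n u v := [/\ c <= u, v <= d,
  (forall t i, u <= t <= v -> (i <= n)%N -> MM <= re (F i (g t))),
  (forall t i, u <= t <= v -> (i < n)%N -> `|im (F i (g t)) - Y i| <= pi / 2) &
  im (F n (g u)) <= Y n - pi / 2 /\ Y n + pi / 2 <= im (F n (g v))].
have [||t tP] := @nested_intervals R P c d cd.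
- split => //; first by move=> t [|i] // tcd _; exact: gM.
- move=> n u v uv [cu vd h1 h2 [h3 h4]].
  have cF : contp (fun t => F n (g t)) u v.
    by apply: contp_F; apply: contp_sub cg.
  have [|c' [d' [c1 c2 c3 [c4 [c5 c6]]]]] := cross_step uv cF _ (cY n) (sY n) h3 h4.
    by move=> t tuv; exact: h1.
  exists c', d'; split => //; split.
  + exact: le_trans c1.
  + exact: le_trans vd.
  + move=> t i /andP[t1 t2]; rewrite leq_eqVlt ltnS => /orP[/eqP ->|ilt].
      by have [] := c4 t; rewrite ?t1.
    by apply: h1 => //; rewrite (le_trans c1 t1) (le_trans t2).
  + move=> t i /andP[t1 t2]; rewrite ltnS leq_eqVlt => /orP[/eqP ->|ilt].
      by have [] := c4 t; rewrite ?t1.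
    by apply: h2 => //; rewrite (le_trans c1 t1) (le_trans t2).
  + by rewrite /=; split; lra.
exists t; split.
- have [u [v [/andP[? ?] [? ? _ _ _]]]] := tP 0%N.
  by apply/andP; split; lra.
- by move=> n; have [u [v [tuv [_ _ h _ _]]]] := tP n; exact: h.
- by move=> n; have [u [v [tuv [_ _ _ h _]]]] := tP n.+2; exact: (h t n.+1).
Qed.

Lemma vertical_itinerary g c d y' : c <= d -> contp g c d ->
  (forall t, c <= t <= d -> MM <= re (g t)) -> pi * 4 <= `|im (g d) - im (g c)| ->
  cos y' = 1 -> sin y' = 0 -> 0 <= y' <= 32 ->
  exists t, [/\ c <= t <= d, stays MM (g t) &
    forall n, `|im (F n.+1 (g t)) - y'| <= pi / 2].
Proof.
move=> cd cg gM big cy' sy' y'P; have p0 := @pi_gt0 R.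
(* [y] is a centre of a strip within [pi] of the middle height, so its strip of half-width [pi / 2]
   fits into the variation of [4 pi]. *)
have [y [cy sy /ler_normlP[yP1 yP2]]] := periodic_shift 0 ((im (g c) + im (g d)) / 2).
rewrite cos0 in cy; rewrite sin0 in sy.
have [up|dn] := le_or_lt (im (g c)) (im (g d)).
  rewrite ger0_norm ?subr_ge0// in big.
  by apply: (crossing_itinerary (y := y)) => //; lra.
rewrite ltr0_norm ?subr_lt0// in big.
have fl s : c <= s <= d -> c <= c + d - s <= d by move=> /andP[? ?]; apply/andP; split; lra.
have e1 : c + d - c = d by ring.
have e2 : c + d - d = c by ring.
have gM' t : c <= t <= d -> MM <= re (g (c + d - t)) by move=> /fl; exact: gM.
have b1 : im (g (c + d - c)) <= y - pi / 2 by rewrite e1; lra.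
have b2 : y + pi / 2 <= im (g (c + d - d)) by rewrite e2; lra.
have [t [tcd H1 H2]] := crossing_itinerary cd (contp_flip cg) gM' cy sy b1 b2 cy' sy' y'P.
by exists (c + d - t); split => //; exact: fl.
Qed.

(** * Arcs of escaping points *)

(* By [modulus_f] the orbit tends to infinity exactly when its real parts tend to [+oo]. *)
Definition esc z := forall B : R, exists N, forall n, (N <= n)%N -> B <= re (F n z).

Definition evs p q := exists n, [/\ stays MM (F n p), stays MM (F n q) & same (F n p) (F n q)].

Lemma evs_lift (n m : nat) p q : [/\ stays MM (F n p), stays MM (F n q) & same (F n p) (F n q)] ->
  [/\ stays MM (F (m + n)%N p), stays MM (F (m + n)%N q) & same (F (m + n)%N p) (F (m + n)%N q)].
Proof.
by move=> [h1 h2 h3]; split; rewrite ?F_add; [exact: stays_F|exact: stays_F|exact: same_F].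
Qed.

Lemma evs_sym p q : evs p q -> evs q p.
Proof. by move=> [n [h1 h2 h3]]; exists n; split => //; exact: same_sym. Qed.

Lemma evs_trans p q w : evs p q -> evs q w -> evs p w.
Proof.
move=> [n /(evs_lift)H1] [k /(evs_lift)H2]; exists (k + n)%N.
have [h1 h2 h3] := H1 k; have [k1 k2 k3] := H2 n; rewrite (addnC n k) in k1 k2 k3.
by split => //; exact: same_trans h3 k3.
Qed.

Lemma esc_stays z m : esc z -> exists N, forall n, (N <= n)%N -> stays m (F n z).
Proof.
move=> ez; have [N NP] := ez m; exists N => n Nn k; rewrite -F_add; apply: NP.
by apply: leq_trans Nn _; exact: leq_addl.
Qed.

Lemma f_loc_inj p q : `|im p - im q| <= pi -> f p = f q -> p = q.
Proof.
move=> pq E; apply: dist1_eq0.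
pose m := Num.min (expR (re p)) (expR (re q)).
have m0 : 0 < m by rewrite lt_min !expR_gt0.
have m1 : m <= expR (re p) by rewrite ge_min lexx.
have m2 : m <= expR (re q) by rewrite ge_min lexx orbT.
have := exp_expansion m0 pq m1 m2; rewrite E dist1_xx mulr0.
by rewrite pmulr_rle0.
Qed.

Lemma F_loc_inj n z : exists2 r : R, 0 < r & forall p q,
  dist1 p z < r -> dist1 q z < r -> F n p = F n q -> p = q.
Proof.
elim: n => [|n [r r0 IH]]; first by exists 1.
have [r' r'0 H] := @contC_F n z (pi / 2) (divr_gt0 (pi_gt0 R) (ltr0Sn R 1)).
exists (Num.min r r'); first by rewrite lt_min r0.
move=> p q; rewrite !lt_min => /andP[pr pr'] /andP[qr qr'] E.
apply: IH => //; apply: f_loc_inj => //.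
have := H _ pr'; have := H _ qr' => h1 h2.
have := le_lt_trans (im_dist1 _ _) h1; have := le_lt_trans (im_dist1 _ _) h2.
have := ler_distD (im (F n z)) (im (F n p)) (im (F n q)).
by rewrite (distrC (im (F n z))); move: (`|_|) (`|_|) (`|_|) => *; lra.
Qed.

Definition inj_on (g : R -> C) c d := forall s t, c <= s <= d -> c <= t <= d -> g s = g t -> s = t.

Lemma loc_inj_F n g c d : contp g c d -> inj_on g c d -> loc_inj (fun t => F n (g t)) c d.
Proof.
move=> cg ig t tcd; have [r r0 rP] := F_loc_inj n (g t).
have [r' r'0 H] := cg t tcd r r0; exists r' => // s s' scd s'cd sr s'r E.
by apply: ig => //; apply: rP E; exact: H.
Qed.

(** Iterates are only locally injective along the arc; once it is in the half plane, [path_inj]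
    makes this global. Equality at level [n] is carried to level [n + N], where the arc is in the
    half plane. *)
Lemma path_F_inj g c d N : contp g c d -> inj_on g c d ->
  (forall t, c <= t <= d -> stays MM (F N (g t))) ->
  forall n, inj_on (fun t => F n (g t)) c d.
Proof.
move=> cg ig st n s t scd tcd E.
apply: (@path_inj (fun t => F (n + N)%N (g t)) c d) => //.
- exact: contp_F.
- by move=> u ucd; rewrite F_add; apply: stays_F; exact: st.
- exact: loc_inj_F.
- by rewrite addnC !F_add E.
Qed.

Lemma fin_cont g c d t (N : nat) e : contp g c d -> c <= t <= d -> 0 < e -> exists2 r : R, 0 < r &
  forall s, c <= s <= d -> `|s - t| < r -> forall m : nat, (m <= N)%N -> dist1 (F m (g s)) (F m (g t)) < e.
Proof.
move=> cg tcd e0; elim: N => [|N [r r0 IH]].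
  have [r r0 rP] := cg t tcd e e0; exists r => // s scd st m.
  by rewrite leqn0 => /eqP ->; exact: rP.
have [r' r'0 H] := contp_F N.+1 cg tcd e0.
exists (Num.min r r'); first by rewrite lt_min r0.
move=> s scd; rewrite lt_min => /andP[h1 h2] m.
by rewrite leq_eqVlt => /orP[/eqP ->|]; [exact: H|exact: IH].
Qed.

(** The retraction to [[0, 1]]: it extends functions on [[0, 1]] to the whole line, where [chord]
    asks for continuity. *)
Definition clamp (x : R) : R := Num.max 0 (Num.min 1 x).

Lemma clampP x : [\/ x <= 0 /\ clamp x = 0, 0 <= x <= 1 /\ clamp x = x | 1 <= x /\ clamp x = 1].
Proof.
rewrite /clamp maxEle minEle; case: (leP 1 x) => h1.
  by rewrite ler01; constructor 3.
case: (leP 0 x) => h0; first by constructor 2; rewrite ltW.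
by constructor 1; rewrite ltW.
Qed.

Lemma clamp_le0 x : x <= 0 -> clamp x = 0.
Proof. by have [[? ->]|[/andP[? ?] ->]|[? ->]] := clampP x; lra. Qed.

Lemma clamp_ge1 x : 1 <= x -> clamp x = 1.
Proof. by have [[? ->]|[/andP[? ?] ->]|[? ->]] := clampP x; lra. Qed.

Lemma itv0_le t x y : 0 <= t <= x -> x <= y -> 0 <= t <= y.
Proof. by move=> /andP[-> h] /(le_trans h). Qed.

Lemma clamp_id x : 0 <= x <= 1 -> clamp x = x.
Proof. by move=> /andP[? ?]; have [[? ->]|[/andP[? ?] ->]|[? ->]] := clampP x; lra. Qed.

Lemma clamp_thirds t : 0 <= t <= 1 ->
  [\/ [/\ 0 <= - 3 * t + 1 <= 1, clamp (- 3 * t + 1) = - 3 * t + 1,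
        clamp (3 * t + - 1) = 0 & clamp (3 * t + - 2) = 0],
     [/\ 0 < 3 * t + - 1 < 1, clamp (- 3 * t + 1) = 0,
        clamp (3 * t + - 1) = 3 * t + - 1 & clamp (3 * t + - 2) = 0] |
     [/\ 0 <= 3 * t + - 2 <= 1, clamp (- 3 * t + 1) = 0,
        clamp (3 * t + - 1) = 1 & clamp (3 * t + - 2) = 3 * t + - 2]].
Proof.
move=> /andP[t0 t1]; have [h|h] := le_or_lt t (1 / 3).
  have i : 0 <= - 3 * t + 1 <= 1 by apply/andP; split; lra.
  by constructor 1; split => //; [exact: clamp_id|apply: clamp_le0; lra|apply: clamp_le0; lra].
have [h'|h'] := lt_or_le t (2 / 3).
  have i : 0 < 3 * t + - 1 < 1 by apply/andP; split; lra.
  constructor 2; split => //; [apply: clamp_le0; lra| |apply: clamp_le0; lra].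
  by apply: clamp_id; apply/andP; split; lra.
have i : 0 <= 3 * t + - 2 <= 1 by apply/andP; split; lra.
by constructor 3; split => //; [apply: clamp_le0; lra|apply: clamp_ge1; lra|exact: clamp_id].
Qed.

Lemma clamp_ends : [/\ clamp (- 3 * 0 + 1) = 1, clamp (3 * 0 + - 1) = 0, clamp (3 * 0 + - 2) = 0 &
  [/\ clamp (- 3 * 1 + 1) = 0, clamp (3 * 1 + - 1) = 1 & clamp (3 * 1 + - 2) = 1]].
Proof.
by split; [apply: clamp_ge1; lra|apply: clamp_le0; lra|apply: clamp_le0; lra|split];
  [apply: clamp_le0; lra|apply: clamp_ge1; lra|apply: clamp_ge1; lra].
Qed.

Lemma itv01_flip t : 0 <= t <= 1 -> 0 <= - 1 * t + 1 <= 1.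
Proof. by move=> /andP[? ?]; apply/andP; split; lra. Qed.

Lemma itv01_mul x y : 0 <= x -> 0 <= y <= 1 -> 0 <= x * y <= x.
Proof. by move=> x0 /andP[y0 y1]; rewrite mulr_ge0//= -[leRHS]mulr1 ler_wpM2l. Qed.

Lemma clamp_lip x y : `|clamp x - clamp y| <= `|x - y|.
Proof.
have := ler_norm (x - y); have := ler_norm (y - x); rewrite (distrC y x).
move: `|x - y| => k k1 k2; rewrite ler_norml.
have [[? ->]|[/andP[? ?] ->]|[? ->]] := clampP x;
  have [[? ->]|[/andP[? ?] ->]|[? ->]] := clampP y; by apply/andP; split; lra.
Qed.

Lemma clamp01 x : 0 <= clamp x <= 1.
Proof. by have [[? ->]|[/andP[? ?] ->]|[? ->]] := clampP x; apply/andP; split; lra. Qed.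

Lemma clamp_continuous h : contr h 0 1 -> continuous (fun t => h (clamp t)).
Proof.
move=> ch t; apply/cvgrPdist_lt => e e0.
have [r r0 rP] := ch _ (clamp01 t) e e0; apply/nbhs_ballP; exists r => //= s st.
rewrite distrC; apply: rP; first exact: clamp01.
by apply: le_lt_trans (clamp_lip s t) _; rewrite distrC; exact: st.
Qed.

Lemma contp_scale g X : 0 <= X -> contp g 0 X -> contp (fun s => g (X * s)) 0 1.
Proof.
move=> X0 cg t /andP[t0 t1] e e0.
have sc s : 0 <= s <= 1 -> 0 <= X * s <= X.
  by move=> /andP[? ?]; rewrite mulr_ge0//= -[leRHS]mulr1 ler_wpM2l.
have tt : 0 <= t <= 1 by rewrite t0.
have [r r0 rP] := cg _ (sc t tt) e e0; have X1 : 0 < X + 1 by lra.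
exists (r / (X + 1)); first by rewrite divr_gt0.
move=> s sP st; apply: rP; first exact: sc.
rewrite -mulrBr normrM ger0_norm//; apply: le_lt_trans (_ : (X + 1) * `|s - t| < _).
  by rewrite ler_wpM2r//; lra.
by rewrite mulrC -ltr_pdivlMr.
Qed.

Lemma continuous_affine (h : R -> R) x y : continuous h -> continuous (fun t => h (x * t + y)).
Proof.
move=> ch t; apply: continuous_comp; last exact: ch.
by apply: cvgD; [apply: cvgM; [exact: cvg_cst|exact: cvg_id]|exact: cvg_cst].
Qed.

Lemma small_radius (r r' : R) : 0 < r -> 0 < r' -> exists2 e : R, 0 < e &
  forall t, 0 <= t <= e -> [/\ 0 <= t <= 1, `|t - 0| < r & `|t - 0| < r'].
Proof.
move=> r0 r'0; exists (Num.min 1 (Num.min r r') / 2).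
  by rewrite divr_gt0// !lt_min ltr01 r0.
have m1 : Num.min 1 (Num.min r r') <= 1 by rewrite ge_min lexx.
have m2 : Num.min 1 (Num.min r r') <= r by rewrite !ge_min lexx orbT.
have m3 : Num.min 1 (Num.min r r') <= r' by rewrite !ge_min lexx !orbT.
have m4 : 0 < Num.min 1 (Num.min r r') by rewrite !lt_min ltr01 r0.
move: (Num.min 1 _) m1 m2 m3 m4 => k m1 m2 m3 m4 t /andP[t0 tk].
by rewrite subr0 ger0_norm//; split; [apply/andP; split| |]; lra.
Qed.

(** * Arcs along which the entry time may blow up only at the start *)

Definition pos01 (t : R) := 0 < t <= 1.

(** The start is required to stay in the smaller half plane from time 0 on, not just eventually, so
    that a ray can be attached to it at every level. *)
Definition germ g := [/\ contp g 0 1, inj_on g 0 1, forall t, 0 <= t <= 1 -> esc (g t),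
  stays M1 (g 0) & forall t, pos01 t -> exists (r : R) N, 0 < r /\
    forall s, pos01 s -> `|s - t| < r -> stays MM (F N (g s))].

Lemma pos01_sub x y t : pos01 x -> pos01 y -> x <= t <= y -> pos01 t.
Proof.
move=> /andP[x0 _] /andP[_ y1] /andP[xt ty].
by rewrite /pos01 (lt_le_trans x0 xt) (le_trans ty y1).
Qed.

Lemma pos01_1 : pos01 1. Proof. by rewrite /pos01 ltr01 lexx. Qed.

Lemma pos01W t : pos01 t -> 0 <= t <= 1.
Proof. by move=> /andP[/ltW -> ->]. Qed.

Lemma stays_max N N' z : (N <= N')%N -> stays MM (F N z) -> stays MM (F N' z).
Proof. by move=> NN h; rewrite -(subnK NN) F_add; exact: stays_F. Qed.

Lemma tail_uniform g t : germ g -> pos01 t -> exists N, forall s, t <= s <= 1 -> stays MM (F N (g s)).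
Proof.
move=> G; have [cg ig eg g0 lug] := G.
pose P x := exists N, forall s, x <= s <= 1 -> stays MM (F N (g s)).
have step x : pos01 x -> exists2 r : R, 0 < r & forall u v, pos01 u -> pos01 v -> `|u - x| < r ->
    `|v - x| < r -> P u -> P v.
  move=> Jx; have [r [N [r0 rP]]] := lug _ Jx; exists r => // u v Ju Jv ux vx [N' N'P].
  exists (maxn N N') => s /andP[vs s1]; have [us|su] := le_or_lt u s.
    by apply: stays_max (leq_maxr _ _) _; apply: N'P; apply/andP.
  apply: stays_max (leq_maxl _ _) _; apply: rP.
    by move: Jv; rewrite /pos01 => /andP[v0 _]; rewrite s1 andbT; lra.
  by rewrite ltr_norml in ux; rewrite ltr_norml in vx; rewrite ltr_norml; lra.
apply: (@itv_induct R pos01 P 1) => //.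
- exact: pos01_sub.
- exact: pos01_1.
- have [r [N [r0 rP]]] := lug _ pos01_1; exists N => s /andP[s1 s2].
  have -> : s = 1 by lra.
  by apply: (rP 1 pos01_1); rewrite subrr normr0.
Qed.

Lemma germ_contp g t : germ g -> pos01 t -> contp g t 1.
Proof. by move=> [cg _ _ _ _] /andP[/ltW t0 _]; exact: contp_sub t0 (lexx 1) cg. Qed.

Lemma germ_inj g t : germ g -> pos01 t -> inj_on g t 1.
Proof.
move=> [_ ig _ _ _] /andP[/ltW t0 _] s s' si s'i.
by apply: ig; exact: itv_sub t0 (lexx 1) _.
Qed.

Lemma tail_same g t : germ g -> pos01 t -> exists N, forall s, t <= s <= 1 -> stays MM (F N (g s)) /\
   forall s', t <= s' <= 1 -> same (F N (g s)) (F N (g s')).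
Proof.
move=> G; have [cg ig eg g0 lug] := G.
move=> Jt; have [N NP] := tail_uniform G Jt; exists N => s st; split; first exact: NP.
move=> s' s't; apply: (path_same_all (g := fun s => F N (g s)) (c := t) (d := 1)) => //.
by apply: contp_F; exact: germ_contp.
Qed.

Lemma tail_evs g s t : germ g -> pos01 s -> pos01 t -> evs (g s) (g t).
Proof.
move=> G; have [cg ig eg g0 lug] := G.
have key s' t' : pos01 s' -> pos01 t' -> s' <= t' -> evs (g s') (g t').
  move=> Js Jt st; have [N NP] := tail_same G Js; exists N.
  have /andP[s0 s1] := Js; have /andP[t0 t1] := Jt.
  have iss : s' <= s' <= 1 by rewrite lexx.
  have ist : s' <= t' <= 1 by rewrite st.
  by have [h1 h2] := NP _ iss; have [h3 h4] := NP _ ist; split => //; exact: h2.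
move=> Js Jt; have [st|/ltW ts] := le_or_lt s t; first exact: key.
by apply: evs_sym; exact: key.
Qed.

Lemma tail_inj g s t n : germ g -> pos01 s -> pos01 t -> F n (g s) = F n (g t) -> s = t.
Proof.
move=> G; have [cg ig eg g0 lug] := G.
have key s' t' : pos01 s' -> pos01 t' -> s' <= t' -> F n (g s') = F n (g t') -> s' = t'.
  move=> Js Jt st E; have [N NP] := tail_uniform G Js.
  have /andP[s0 s1] := Js; have /andP[t0 t1] := Jt.
  by apply: (path_F_inj (germ_contp G Js) (germ_inj G Js) NP (n := n)) => //; rewrite ?lexx ?st.
move=> Js Jt E; have [st|/ltW ts] := le_or_lt s t; first exact: key.
by apply/esym/key.
Qed.

(** The parameters with the code of [F N3 (g 1)] form a relatively closed set by continuity. It is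
    open: not being slower than the reference keeps the real parts above [MM + 1], and at the
    finitely many times before the local entry time a small change of parameter costs less than 1.
    The 16 leaves room for [pi] within the 20 of [gap_step]. *)
Lemma follow_reference g (y : C) (N3 : nat) : germ g -> stays (MM + 3) (F N3 y) -> stays MM (F N3 (g 1)) ->
  (forall m : nat, (N3 <= m)%N -> `|im (F m y) - im (F m (g 1))| <= 16) ->
  (forall t, pos01 t -> ~ slower (g t) y) ->
  forall t, pos01 t -> stays MM (F N3 (g t)).
Proof.
move=> G; have [cg ig eg g0 lug] := G.
move=> sy sw yw ns; have p4 := @pi_le4 R.
pose Q t := stays MM (F N3 (g t)) /\ same (F N3 (g t)) (F N3 (g 1)).
suff : forall t, pos01 t -> Q t by move=> H t /H [].
have cgF (m : nat) := contp_F m cg.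
apply: (@itv_clopen R pos01 Q 1) => //; last by split => //; exact: same_refl.
- exact: pos01_sub.
- move=> t Jt [st sm].
  have low (m : nat) : (N3 <= m)%N -> MM + 1 <= re (F m (g t)).
    move=> Nm; have h : forall k, (N3 <= k)%N -> MM <= re (F k (g t)) /\ MM <= re (F k y).
      move=> k Nk; have := st (k - N3)%N; have := sy (k - N3)%N; rewrite -!F_add subnK//.
      by move=> *; split; lra.
    have h' : forall k, (N3 <= k)%N -> `|im (F k (g t)) - im (F k y)| <= 20.
      move=> k Nk; have := sm (k - N3)%N; rewrite -!F_add subnK// => h1.
      have := yw k Nk; have := ler_distD (im (F k (g 1))) (im (F k (g t))) (im (F k y)).
      by rewrite (distrC (im (F k (g 1)))) => *; lra.
    have := not_slower_ge h h' (leqW Nm) (ns t Jt).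
    by have := sy (m - N3)%N; rewrite -!F_add subnK// => *; lra.
  have [r [N' [r0 rP]]] := lug _ Jt.
  have one : (0 : R) < 1 by [].
  have [r' r'0 r'P] := fin_cont N' cg (pos01W Jt) one.
  have rr : 0 < Num.min r r' by rewrite lt_min r0.
  have near s : pos01 s -> `|s - t| < Num.min r r' -> stays MM (F N3 (g s)).
    rewrite lt_min => Js /andP[sr sr'] m; rewrite -F_add.
    have [mN|Nm] := leqP (m + N3)%N N'.
      have := r'P s (pos01W Js) sr' _ mN; have := low (m + N3)%N (leq_addl _ _).
      have := re_dist1 (F (m + N3)%N (g s)) (F (m + N3)%N (g t)) => h1 h2 h3.
      by have := le_lt_trans h1 h3; rewrite ltr_norml => /andP[? ?]; lra.
    by have := rP s Js sr ((m + N3) - N')%N; rewrite -F_add subnK// ltnW.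
  exists (Num.min r r') => // s Js sr; split; first exact: near.
  apply: (same_trans (near s Js sr) st sw) => //.
  pose c := Num.min s t; pose d := Num.max s t.
  have cs : c <= s by rewrite ge_min lexx.
  have ct : c <= t by rewrite ge_min lexx orbT.
  have sd : s <= d by rewrite le_max lexx.
  have td : t <= d by rewrite le_max lexx orbT.
  have Jcd u : c <= u <= d -> pos01 u /\ `|u - t| < Num.min r r'.
    move=> /andP[cu ud]; have Jcc : pos01 c by rewrite /c minEle; case: ifP.
    have Jdd : pos01 d by rewrite /d maxEle; case: ifP.
    split; first by apply: pos01_sub Jcc Jdd _; apply/andP.
    move: cu ud sr; rewrite /c /d minEle maxEle; case: (leP s t) => h cu ud.
      by rewrite !ltr_norml => /andP[? ?]; apply/andP; split; lra.
    by rewrite !ltr_norml => /andP[? ?]; apply/andP; split; lra.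
  apply: (path_same_all (g := fun s => F N3 (g s)) (c := c) (d := d)).
  + have cin : c <= c <= d by rewrite lexx (le_trans cs).
    have din : c <= d <= d by rewrite lexx (le_trans cs).
    have [/andP[? ?] _] := Jcd c cin; have [/andP[? ?] _] := Jcd d din.
    by apply: contp_F; apply: contp_sub cg; lra.
  + by move=> u /Jcd[? ?]; exact: near.
  + by rewrite cs.
  + by rewrite ct.
- move=> t Jt nG; have [st|nst] := pselect (stays MM (F N3 (g t))); last first.
    have [m hm] : exists m : nat, re (F (m + N3)%N (g t)) < MM.
      apply: contrapT => nm; apply: nst => m; rewrite leNgt -F_add.
      by apply/negP => h; apply: nm; exists m.
    have [r r0 rP] := lt_open (contp_re (cgF (m + N3)%N)) (pos01W Jt) hm.
    exists r => // s Js sr [ss _]; have := rP s (pos01W Js) sr.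
    by have := ss m; rewrite -F_add; lra.
  have [m hm] : exists m : nat, pi <= `|im (F (m + N3)%N (g t)) - im (F (m + N3)%N (g 1))|.
    apply: contrapT => nm; apply: nG; split => // m; rewrite ltNge -!F_add.
    by apply/negP => h; apply: nm; exists m.
  have {}hm : pi < `|im (F (m + N3)%N (g t)) - im (F (m + N3)%N (g 1))|.
    rewrite lt_def hm andbT; apply/negP => /eqP E.
    have := strip_neq_pi (stays_cos st m) (stays_cos sw m); rewrite -!F_add E.
    by move=> /(_ (lexx _)); rewrite ltxx.
  have e0 : 0 < `|im (F (m + N3)%N (g t)) - im (F (m + N3)%N (g 1))| - pi by lra.
  have [r r0 rP] := contp_im (cgF (m + N3)%N) (pos01W Jt) e0.
  exists r => // s Js sr [ss sm]; have := rP s (pos01W Js) sr; have := sm m; rewrite -!F_add.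
  have := ler_distD (im (F (m + N3)%N (g s))) (im (F (m + N3)%N (g t))) (im (F (m + N3)%N (g 1))).
  by rewrite (distrC (im (F (m + N3)%N (g t))) (im (F (m + N3)%N (g s)))); lra.
- exact: pos01_1.
Qed.

Lemma not_slower_uniform g : germ g -> (forall t, pos01 t -> ~ slower (g t) (g 1)) ->
  exists N, forall t, pos01 t -> stays MM (F N (g t)).
Proof.
move=> G; have [cg ig eg g0 lug] := G.
have ew : esc (g 1) by apply: eg; rewrite ler01 lexx.
move=> ns; have [N NP] := esc_stays (MM + 3) ew; exists N.
have sw := NP N (leqnn N); apply: (follow_reference G sw) => //.
- by apply: stays_le sw; lra.
- by move=> m _; rewrite subrr normr0.
Qed.

Lemma evs_trichotomy p q : evs p q -> [\/ slower p q, slower q p | exists n, F n p = F n q].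
Proof.
move=> [n [h1 h2 h3]]; have [h|h|h] := stays_trichotomy h1 h2 h3.
- by constructor 1; apply/slower_F; exact: h.
- by constructor 2; apply/slower_F; exact: h.
- by constructor 3; exists n.
Qed.

(** Otherwise some iterate of the arc between [t0] and [t] would run through the iterate of [g 1],
    against injectivity. *)
Lemma slower_all g t0 : germ g -> pos01 t0 -> slower (g t0) (g 1) -> forall t, pos01 t -> t < 1 -> slower (g t) (g 1).
Proof.
move=> G; have [cg ig eg g0 lug] := G.
pose w := g 1.
move=> J0 sl t Jt t1.
have t01 : t0 < 1.
  have /andP[_] := J0; rewrite le_eqVlt => /orP[/eqP E|//].
  by move: sl; rewrite E => sl; case: (slower_asym sl sl).
have [//|sl'|[n E]] := evs_trichotomy (tail_evs G Jt pos01_1); last first.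
  by have := tail_inj G Jt pos01_1 E => E1; rewrite E1 ltxx in t1.
exfalso; pose c := Num.min t0 t; pose d := Num.max t0 t.
have cd : c <= d by rewrite /c /d minEle maxEle; case: (leP t0 t) => // /ltW.
have Jcc : pos01 c by rewrite /c minEle; case: ifP.
have d1 : d < 1 by rewrite /d maxEle; case: ifP.
have [N NP] := tail_same G Jcc; have /andP[c0 c1] := Jcc.
have c1c : c <= c <= 1 by rewrite lexx.
have c11 : c <= (1 : R) <= 1 by rewrite lexx andbT.
have [|||||s /andP[cs sd] E] := @path_hits (fun s => F N (g s)) c d (F N w) cd.
- by apply: contp_F; apply: contp_sub cg; lra.
- by move=> s /andP[? ?]; have [] := NP s _; first by apply/andP; split; lra.
- by have [] := NP 1 c11.
- by have [_] := NP c c1c; apply.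
- move: sl sl'; rewrite /c /d minEle maxEle; case: (leP t0 t) => _ s1 s2.
    by left; split; apply/slower_F.
  by right; split; apply/slower_F.
have Js : pos01 s by rewrite /pos01; apply/andP; split; lra.
by have := tail_inj G Js pos01_1 E; lra.
Qed.

Lemma tail_hit u' (H : R -> C) X : (forall Y, contp H 0 Y) -> H 0 = u' -> re u' <= X ->
  (forall x, 0 <= x -> re u' + x - 1 - CC <= re (H x)) ->
  exists x, [/\ 0 <= x, re (H x) = X & forall s, 0 <= s <= x -> re (H s) <= X].
Proof.
move=> cH H0 uX low; pose Y := X - re u' + 1 + CC.
have [A0 _ _ CE _] := consts.
have Y0 : 0 <= Y by rewrite /Y; lra.
have [||x [/andP[x0 _] hx xP]] := @first_hit _ 0 Y X Y0 (contp_re (cH Y)).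
- by rewrite H0.
- by have := low Y Y0; rewrite /Y; lra.
by exists x.
Qed.

(* A curve running from far right down the ray of [g 0], along [g] and up the ray
   of [g 1] cannot meet its own translate by [2 pi i], as [f] is injective along it. *)
Lemma strips_close g : germ g -> (forall t, pos01 t -> t < 1 -> slower (g t) (g 1)) ->
  exists N, forall n, (N <= n)%N -> `|im (F n (g 0)) - im (F n (g 1))| <= 16.
Proof.
move=> G; have [cg ig eg g0 lug] := G.
pose w := g 1.
pose u := g 0.
have ew : esc w by apply: eg; rewrite ler01 lexx.
move=> sl; have p0 := @pi_gt0 R; have p4 := @pi_le4 R.
have [[n [h1 h2 h3]]|nevs] := pselect (evs u w).
  exists n => m /subnK <-; rewrite !F_add; have := h3 (m - n)%N; lra.
have [N NP] := esc_stays M1 ew; exists N => n Nn; rewrite leNgt; apply/negP => far.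
have [A0 _ _ CE [KE ME M1E]] := consts.
pose u' := F n u; pose w' := F n w.
have su : stays M1 u' by exact: stays_F.
have sw : stays M1 w' by exact: NP.
have suM := stays_M1_MM su; have swM := stays_M1_MM sw.
have [H1 [H10 H1s H1c _ [H1r _]]] := tail su.
have [H2 [H20 H2s H2c _ [H2r _]]] := tail sw.
pose ga t := F n (g t); have cga : contp ga 0 1 by exact: contp_F.
have [tm _ tmP] := contr_max ler01 (contp_re cga).
(* The rays are cut where they first reach real part [X], which makes both ends of the curve
   rightmost, as [chord] demands. *)
pose X := re (ga tm).
have i0 : 0 <= (0 : R) <= 1 by rewrite lexx ler01.
have i1 : 0 <= (1 : R) <= 1 by rewrite lexx ler01.
have [x1 [x10 x1X x1P]] := tail_hit H1c H10 (tmP 0 i0) H1r.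
have [x2 [x20 x2X x2P]] := tail_hit H2c H20 (tmP 1 i1) H2r.
pose on p := [\/ exists x, 0 <= x <= x1 /\ p = H1 x, exists t, [/\ 0 < t, t < 1 & p = ga t] |
  exists x, 0 <= x <= x2 /\ p = H2 x].
have onX p : on p -> re p <= X.
  move=> [[x [xx ->]]|[t [t0 t1 ->]]|[x [xx ->]]]; [exact: x1P| |exact: x2P].
  by apply: tmP; rewrite !ltW.
(* Points [2 pi i] apart have equal images. Two points of one ray lie in one strip. A coincidence
   between the ray of [u'] and the arc or the other ray would make the codes of [u] and [w] agree
   eventually. Finally, the points of the arc fall behind [w] by [KK], those on the ray of [w'] by
   at most [CC + 1]. *)
have nochord p q : on p -> on q -> re q = re p -> im q = im p + pi *+ 2 -> False.
  have step13 x t : 0 <= x -> pos01 t -> f (H1 x) = f (ga t) -> False.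
    move=> x0 Jt E; have [s1 s2 _] := H1s x x0; apply: nevs.
    apply: evs_trans (tail_evs G Jt pos01_1); exists n.+1; split.
    - by rewrite iterS; apply: (stays_F 1).
    - by rewrite iterS -[iter n _ (g t)]/(ga t) -E; exact: (stays_F 1).
    - by rewrite !iterS -[iter n _ (g t)]/(ga t) -E; apply: same_sym; exact: (same_F 1).
  have step12 x x' : 0 <= x -> 0 <= x' -> f (H1 x) = f (H2 x') -> False.
    move=> x0 x'0 E; have [s1 s2 _] := H1s x x0; have [k1 k2 _] := H2s x' x'0.
    apply: nevs; exists n.+1; rewrite !iterS; split; [exact: (stays_F 1)|exact: (stays_F 1)|].
    apply: (@same_trans _ (f (H1 x))); [exact: (stays_F 1)|exact: (stays_F 1)|exact: (stays_F 1)| |].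
      by apply: same_sym; exact: (same_F 1).
    by rewrite E; exact: (same_F 1).
  have step32 t x : pos01 t -> t < 1 -> 0 <= x -> f (ga t) = f (H2 x) -> False.
    move=> Jt t1 x0 E; have [_ _ k3] := H2s x x0; have [k kP] := sl t Jt t1.
    have := kP (k + n.+1)%N (leq_addr _ _); have := k3 k.+1.
    rewrite /w' -F_add addSn -addnS.
    have -> : F (k + n.+1)%N (g t) = F k.+1 (H2 x) by rewrite F_add [RHS]F_S -E.
    by move=> j1 j2; lra_from j1 j2 A0 CE KE.
  have same11 H x x' z : stays MM (H x) -> stays MM (H x') -> stays MM z ->
     same (H x) z -> same (H x') z -> im (H x') = im (H x) + pi *+ 2 -> False.
    move=> s1 s2 s3 k1 k2 E; have := same_trans s2 s3 s1 k2 (same_sym k1) 0%N.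
    by rewrite /= E addrAC subrr add0r ger0_norm ?mulr2n; lra_from p0.
  move=> op oq e1 e2.
  have E : f p = f q.
    by apply: cplane_eq; rewrite ?re_f ?im_f e1 e2 ?cosD2pi ?sinD2pi.
  case: op oq => [[x [/andP[x0 _] px]]|[t [t0 t1 px]]|[x [/andP[x0 _] px]]];
    case=> [[x' [/andP[x'0 _] qx]]|[t' [t'0 t'1 qx]]|[x' [/andP[x'0 _] qx]]]; subst p q.
  - have [? ? _] := H1s x x0; have [? ? _] := H1s x' x'0.
    exact: (same11 H1 x x' u').
  - by apply: (step13 x t') => //; apply/andP; rewrite ltW.
  - exact: (step12 x x').
  - by apply: (step13 x' t) => //; apply/andP; rewrite ltW.
  - have Jt : pos01 t by apply/andP; rewrite ltW.
    have Jt' : pos01 t' by apply/andP; rewrite ltW.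
    have tt : t = t' by apply: (tail_inj G (n := n.+1)); rewrite ?iterS.
    by move: e2; rewrite tt => /eqP; rewrite -subr_eq0 opprD addrA subrr sub0r mulr2n => /eqP j; lra_from j p0.
  - by apply: (step32 t x') => //; apply/andP; rewrite ltW.
  - exact: (step12 x' x).
  - by apply: (step32 t' x) => //; apply/andP; rewrite ltW.
  - have [? ? _] := H2s x x0; have [? ? _] := H2s x' x'0.
    exact: (same11 H2 x x' w').
(* At each time at most one of the three clamped parameters moves and the others rest at the corners
   [u'], [w'] of the curve. Subtracting the corner values turns the sum into the concatenation, and
   continuity needs no case analysis. *)
pose glue (T : C -> R) (t : R) := T (H1 (x1 * clamp (- 3 * t + 1))) + T (ga (clamp (3 * t + - 1))) +
   T (H2 (x2 * clamp (3 * t + - 2))) - T u' - T w'.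
have glue_on t : 0 <= t <= 1 -> exists2 p, on p & forall T, glue T t = T p.
  move=> /clamp_thirds[[t01 c1 c2 c3]|[/andP[t0 t1] c1 c2 c3]|[t01 c1 c2 c3]].
  - exists (H1 (x1 * (- 3 * t + 1))); last first.
      by move=> T; rewrite /glue c1 c2 c3 mulr0 H20 -[ga 0]/u' addrAC addrK addrK.
    by constructor 1; exists (x1 * (- 3 * t + 1)); split => //; exact: itv01_mul.
  - exists (ga (3 * t + - 1)); last first.
      by move=> T; rewrite /glue c1 c2 c3 !mulr0 H10 H20 addrAC addrK addrC addKr.
    by constructor 2; exists (3 * t + - 1).
  - exists (H2 (x2 * (3 * t + - 2))); last first.
      by move=> T; rewrite /glue c1 c2 c3 mulr0 H10 -[ga 1]/w'; ring.
    by constructor 3; exists (x2 * (3 * t + - 2)); split => //; exact: itv01_mul.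
have cglue T : (forall g' c d, contp g' c d -> contr (fun t => T (g' t)) c d) -> continuous (glue T).
  move=> hT t; have A (k : R -> R) x y : contr k 0 1 -> {for t, continuous (fun t => k (clamp (x * t + y)))}.
    by move=> ck; have H := continuous_affine (x := x) (y := y) (clamp_continuous ck); exact: H.
  do 2 (apply: cvgB; last exact: cvg_cst).
  apply: cvgD; last exact: (A (fun s => T (H2 (x2 * s))) _ _ (hT _ _ _ (contp_scale x20 (H2c x2)))).
  apply: cvgD; last exact: (A (fun s => T (ga s)) _ _ (hT _ _ _ cga)).
  exact: (A (fun s => T (H1 (x1 * s))) _ _ (hT _ _ _ (contp_scale x10 (H1c x1)))).
have cre := cglue (fun z => re z) (fun g' c d ch => contp_re ch).
have cim := cglue (fun z => im z) (fun g' c d ch => contp_im ch).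
have [e1 e2 e3 [e4 e5 e6]] := clamp_ends.
have g0E T : glue T 0 = T (H1 x1).
  by rewrite /glue e1 e2 e3 mulr1 mulr0 H20 -[ga 0]/u' addrAC addrK addrK.
have g1E T : glue T 1 = T (H2 x2).
  by rewrite /glue e4 e5 e6 mulr1 mulr0 H10 -[ga 1]/w'; ring.
clear e1 e2 e3 e4 e5 e6.
have leX t : 0 <= t <= 1 -> glue (fun z => re z) t <= X.
  by move=> /glue_on[p /onX pX ->].
have [_ k1 _] := H1s x1 x10; have [_ k2 _] := H2s x2 x20.
have {k1} := k1 0%N; have {k2} := k2 0%N.
rewrite -[F 0 _]/(H2 x2) -[F 0 w']/w' -[F 0 (H1 x1)]/(H1 x1) -[F 0 u']/u'.
rewrite !ltr_norml => /andP[k1 k2] /andP[k3 k4].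
have [up|dn] := le_or_lt (im u') (im w').
  (* The heights of the ends are within [pi] of those of [u'] and [w']; more than
     [16 - 2 pi >= 2 pi] remains. *)
  have y01 : glue (fun z => im z) 0 + pi *+ 2 < glue (fun z => im z) 1.
    rewrite g0E g1E mulr2n; move: far; rewrite -/u' -/w' ler0_norm ?subr_le0// => far; lra_from far p4 k1 k2 k3 k4.
  have [s [t [scd tcd e1 e2]]] := chord cre cim leX (etrans (g0E _) x1X) (etrans (g1E _) x2X) y01.
  have [p pon pE] := glue_on s scd; have [q qon qE] := glue_on t tcd.
  rewrite !pE !qE in e1 e2; exact: (nochord p q).
pose fl (h : R -> R) t := h (- 1 * t + 1).
have fl01 := itv01_flip.
have e0 : - 1 * 0 + 1 = 1 :> R by ring.
have e1 : - 1 * 1 + 1 = 0 :> R by ring.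
have y01 : fl (glue (fun z => im z)) 0 + pi *+ 2 < fl (glue (fun z => im z)) 1.
  rewrite /fl e0 e1 g0E g1E mulr2n; move: far; rewrite -/u' -/w' ger0_norm ?subr_ge0 1?ltW// => far; lra_from far p4 k1 k2 k3 k4.
have [|||s [t [scd tcd E1 E2]]] := @chord R (fl (glue (fun z => re z))) (fl (glue (fun z => im z))) X
  (continuous_affine (x := - 1) (y := 1) cre) (continuous_affine (x := - 1) (y := 1) cim) _ _ _ y01.
- by move=> t /fl01; exact: leX.
- by rewrite /fl e0 g1E.
- by rewrite /fl e1 g0E.
have [p pon pE] := glue_on _ (fl01 s scd); have [q qon qE] := glue_on _ (fl01 t tcd).
rewrite /fl !pE !qE in E1 E2; exact: (nochord p q).
Qed.

(** A variation of [4 pi] would produce points following the strips around 0, [4 pi] and [8 pi].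
    Points with parameter in [(0, 1]] eventually share their code, but the start need not share it.
    Hence three itineraries: two of the parameters are both positive or both 0. *)
Lemma no_vertical g n d : germ g -> 0 <= d <= 1 -> (forall t, 0 <= t <= d -> MM <= re (F n (g t))) ->
  forall t, 0 <= t <= d -> `|im (F n (g t)) - im (F n (g 0))| < pi * 4.
Proof.
move=> G; have [cg ig eg g0 lug] := G.
move=> /andP[d0 d1] gM t /andP[t0 td]; rewrite ltNge; apply/negP => big.
have p0 := @pi_gt0 R; have p4 := @pi_le4 R.
have cF : contp (fun s => F n (g s)) 0 t by apply: contp_F; apply: contp_sub cg; lra.
have gM' s : 0 <= s <= t -> MM <= re (F n (g s)).
  by move=> /andP[? ?]; apply: gM; apply/andP; split; lra.
have V y : cos y = 1 -> sin y = 0 -> 0 <= y <= 32 -> exists s, [/\ 0 <= s <= t,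
   stays MM (F n (g s)) & forall k, `|im (F (k.+1 + n)%N (g s)) - y| <= pi / 2].
  move=> cy sy yP; have [s [sP h1 h2]] := vertical_itinerary t0 cF gM' big cy sy yP.
  by exists s; split => // k; rewrite F_add.
have c4 : cos (pi *+ 2 *+ 2 : R) = 1 by rewrite cos_mulr2n cos2pi expr1n; lra.
have s4 : sin (pi *+ 2 *+ 2 : R) = 0 by rewrite sin_mulr2n sin2pi mulr0 mul0rn.
have c8 : cos (pi *+ 2 *+ 2 *+ 2 : R) = 1 by rewrite cos_mulr2n c4 expr1n; lra.
have s8 : sin (pi *+ 2 *+ 2 *+ 2 : R) = 0 by rewrite sin_mulr2n s4 mulr0 mul0rn.
have [|||s1 [/andP[s10 s1t] s1m s1P]] := V 0; [exact: cos0|exact: sin0|by apply/andP; split; lra|].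
have [|||s2 [/andP[s20 s2t] s2m s2P]] := V (pi *+ 2 *+ 2); [exact: c4|exact: s4|by apply/andP; split; lra|].
have [|||s3 [/andP[s30 s3t] s3m s3P]] := V (pi *+ 2 *+ 2 *+ 2); [exact: c8|exact: s8|by apply/andP; split; lra|].
have far (y y' s s' : R) : pi * 4 <= y' - y -> 0 < s -> s <= 1 -> 0 < s' -> s' <= 1 ->
   (forall k, `|im (F (k.+1 + n)%N (g s)) - y| <= pi / 2) ->
   (forall k, `|im (F (k.+1 + n)%N (g s')) - y'| <= pi / 2) -> False.
  move=> yy s0 s1' s'0 s'1 h h'.
  have Js : pos01 s by apply/andP. have Js' : pos01 s' by apply/andP.
  have [m [_ _ sm]] := tail_evs G Js Js'; have := sm n.+1; rewrite -!F_add addSn addnC -addSn.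
  have := h m; have := h' m; rewrite !ler_norml ltr_norml => /andP[k1 k2] /andP[k3 k4] /andP[k5 k6].
  lra_from yy k1 k2 k3 k4 k5 k6 p0.
have same0 (y y' s s' : R) : pi * 4 <= y' - y -> s = s' ->
   (forall k, `|im (F (k.+1 + n)%N (g s)) - y| <= pi / 2) ->
   (forall k, `|im (F (k.+1 + n)%N (g s')) - y'| <= pi / 2) -> False.
  move=> yy ss h h'; have := h 0%N; have := h' 0%N; rewrite ss !ler_norml => /andP[k1 k2] /andP[k3 k4].
  lra_from yy k1 k2 k3 k4 p0.
have le1 s : s <= t -> s <= 1 by move=> st; exact: le_trans st (le_trans td d1).
have z0 s : 0 <= s -> s <= 0 -> s = 0 by move=> s0 s0'; apply/le_anti; rewrite s0 s0'.
have d12 : pi * 4 <= pi *+ 2 *+ 2 - 0 :> R by lra_from p0.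
have d13 : pi * 4 <= pi *+ 2 *+ 2 *+ 2 - 0 :> R by lra_from p0.
have d23 : pi * 4 <= pi *+ 2 *+ 2 *+ 2 - pi *+ 2 *+ 2 :> R by lra_from p0.
have [p1|n1] := lt_or_le 0 s1; have [p2|n2] := ltP 0 s2.
- by apply: (far _ _ s1 s2 d12) => //; exact: le1.
- have [p3|n3] := lt_or_le 0 s3; first by apply: (far _ _ s1 s3 d13) => //; exact: le1.
  exact: (same0 _ _ _ _ d23 (etrans (z0 _ s20 n2) (esym (z0 _ s30 n3))) s2P s3P).
- have [p3|n3] := lt_or_le 0 s3; first by apply: (far _ _ s2 s3 d23) => //; exact: le1.
  exact: (same0 _ _ _ _ d13 (etrans (z0 _ s10 n1) (esym (z0 _ s30 n3))) s1P s3P).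
- exact: (same0 _ _ _ _ d12 (etrans (z0 _ s10 n1) (esym (z0 _ s20 n2))) s1P s2P).
Qed.

(* If [g] left every strip neighbourhood of [g 0] it would, at some late level, pass
   within bounded distance of the shadow [v]; pulled back this forces [v = F n1 (g 0)]. *)
Lemma slower_start_uniform g t1 : germ g -> pos01 t1 -> slower (g t1) (g 0) ->
  (exists N, forall n, (N <= n)%N -> `|im (F n (g 0)) - im (F n (g 1))| <= 16) ->
  exists (r : R) N, 0 < r /\ forall t, 0 <= t <= 1 -> t < r -> stays MM (F N (g t)).
Proof.
move=> G; have [cg ig eg g0 lug] := G.
pose w := g 1.
pose u := g 0.
move=> Jt1 [k1 slP] [k2 strP]; have p0 := @pi_gt0 R; have p4 := @pi_le4 R.
have [A0 _ _ CE [KE ME M1E]] := consts.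
have [k3 escP] := eg _ (pos01W Jt1) (MM + 2 * CC + 30).
have [k4 [sx sw' xw]] := tail_evs G Jt1 pos01_1.
pose n1 := (k1 + k2 + k3 + k4)%N.
pose u' := F n1 u; pose x i := F (i + n1)%N (g t1).
have su : stays M1 u' by exact: stays_F.
have suM : stays MM u' by apply: stays_le su; lra.
have le1 i : (k1 <= i + n1)%N by rewrite /n1; lia.
have le2 i : (k2 <= i + n1)%N by rewrite /n1; lia.
have le3 i : (k3 <= i + n1)%N by rewrite /n1; lia.
have le4 i : (k4 <= i + n1)%N by rewrite /n1; lia.
have xM i : MM + 2 * CC + 30 <= re (x i) by exact: escP.
have xu i : re (x i) + KK <= re (F i u') by rewrite -F_add; exact: slP.
have xim i : `|im (x i) - im (F i u')| <= 20.
  have := xw (i + n1 - k4)%N; rewrite -!F_add subnK// => h1.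
  have := strP (i + n1)%N (le2 i); rewrite /x.
  have := ler_distD (im (F (i + n1)%N w)) (im (F (i + n1)%N (g t1))) (im (F (i + n1)%N u)).
  by rewrite (distrC (im (F (i + n1)%N w))) => *; lra.
have xS i : x i.+1 = f (x i) by [].
(* Preimages of the slower orbit are moved to the strips of [u']. The orbit shadowing them has the
   code of [u'] but lags by at least [KK - CC], so it is not that of [u']. *)
have /choice[q qP] : forall i, exists q, f q = x i.+1 /\ `|im q - im (F i u')| < pi.
  by move=> i; apply: lift_Pi; [exact: (suM i.+1)|have := xM i.+1; lra].
have qre i : re (q i) = re (x i).
  have [h _] := qP i; have := modulus_f (q i); have := modulus_f (x i).
  rewrite h xS => -> /eqP; rewrite eqrXn2 ?expR_ge0// => /eqP/expR_inj -> //.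
have [||v vP] := @shadow q.
- move=> i; have [-> _] := qP i; rewrite /dist1 qre subrr normr0 add0r.
  have [_ h] := qP i.+1; have := xim i.+1.
  have := ler_distD (im (F i.+1 u')) (im (x i.+1)) (im (q i.+1)).
  by rewrite (distrC (im (F i.+1 u'))) => *; lra.
- by move=> i; have [-> _] := qP i; have := xM i.+1; lra.
have vq i : `|re (F i v) - re (x i)| <= CC.
  by have [h _ _] := vP i; rewrite -qre; exact: le_trans (re_dist1 _ _) h.
have vre i : MM <= re (F i v) /\ re (F i v) <= re (F i u') - KK + CC.
  have := vq i; rewrite ler_norml => /andP[? ?]; have := xM i; have := xu i => ? ?.
  by split; lra.
have sv : stays MM v by move=> i; case: (vre i).
have vu : same v u'.
  move=> i; have [_ h _] := vP i; have [e h'] := qP i.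
  apply: strip_trans h h'; [exact: stays_cos| |exact: stays_cos].
  by apply: cos_gt0_Pi; rewrite e; have := xM i.+1; lra.
have vnu : u' <> v.
  by move=> E; have [_] := vre 0%N; rewrite E /=; lra.
pose be t := F n1 (g t); have cbe : contp be 0 1 by exact: contp_F.
apply: contrapT => nun; apply: vnu; apply: dist1_small => eta eta0.
have k200 : 0 < 20 :> R by []. have e20 : 0 < eta / 2 by lra.
have [m0 m0P] := half_pow_small k200 e20.
have i0 : 0 <= (0 : R) <= 1 by rewrite lexx ler01.
have [r r0 rP] := cbe 0 i0 _ e20.
have one : (0 : R) < 1 by [].
have [r' r'0 r'P] := fin_cont m0 cbe i0 one.
have [ep ep0 epP] := small_radius r0 r'0.
pose bad (m : nat) := `[< exists2 t : R, 0 <= t <= ep & re (F m (be t)) < MM >].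
have exbad : exists m : nat, bad m.
  apply: contrapT => nb; apply: nun; exists ep, n1; split => // t /andP[t0 t1'] tep m.
  rewrite leNgt; apply/negP => h; apply: nb; exists m; apply/asboolP; exists t => //.
  by rewrite t0 ltW.
(* [m] is the first level at which the arc near its start leaves the half plane. There its image
   runs from [F m u'] down to real part [MM] and takes the real part of [F m v] on the way;
   [no_vertical] bounds the difference in height, and [m] contractions bring that point close to
   [v]. *)
have [m /asboolP[ts tsep tsM] mmin] := ex_minnP exbad.
have good i t : (i < m)%N -> 0 <= t <= ep -> MM <= re (F i (be t)).
  move=> lim tep; rewrite leNgt; apply/negP => h.
  have : bad i by apply/asboolP; exists t.
  by move=> /mmin; rewrite leqNgt lim.
have m0m : (m0 < m)%N.
  rewrite ltnNge; apply/negP => mm0; have [ts01 _ tr'] := epP ts tsep.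
  have := r'P ts ts01 tr' m mm0 => h; have := le_lt_trans (re_dist1 _ _) h.
  by rewrite ltr_norml => /andP[j1 _]; have j3 : M1 <= re (F m (be 0)) := su m; lra_from j1 j3 tsM A0 CE KE ME M1E.
have /andP[ts0 tse] := tsep; have [/andP[_ ts1] _ _] := epP ts tsep.
have cm : contr (fun t => re (F m (be t))) 0 ts.
  by apply: contp_re; apply: contp_F; apply: contp_sub cbe.
have cmN : contr (fun t => - re (F m (be t))) 0 ts.
  move=> t tP e e0; have [r2 r20 r2P] := cm t tP e e0; exists r2 => // s sP st.
  by rewrite -opprD normrN; exact: r2P.
have b0 : be 0 = u' by [].
have [||te [/andP[te0 tets] teE teP]] := @first_hit _ 0 ts (- MM) ts0 cmN.
- by rewrite b0 lerN2; exact: suM.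
- by rewrite lerN2 ltW.
have teM t : 0 <= t <= te -> MM <= re (F m (be t)) by move=> /teP; rewrite lerN2.
have [||qq /andP[q0 qte] qE] := @contr_IVT_dn R _ 0 te (re (F m v)) te0 (contr_sub (lexx 0) tets cm).
- by rewrite -lerN2 teE lerN2; exact: sv.
- by have [_] := vre m; rewrite b0 => j1; lra_from j1 A0 CE KE.
have qep : 0 <= qq <= ep by rewrite q0 (le_trans qte (le_trans tets tse)).
have [q01 qr _] := epP qq qep.
have nv : `|im (F m (be qq)) - im (F m u')| < pi * 4.
  rewrite -!F_add; apply: (@no_vertical g (m + n1)%N te) => //; last by rewrite q0.
    by rewrite te0 (le_trans tets ts1).
  by move=> t tP; rewrite F_add; exact: teM.
have bM i : (i <= m)%N -> forall t, 0 <= t <= te -> MM <= re (F i (be t)).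
  rewrite leq_eqVlt => /orP[/eqP ->//|lim] t tte.
  by apply: good => //; exact: itv0_le tte (le_trans tets tse).
have qte' : 0 <= qq <= te by rewrite q0.
have close : dist1 (be qq) v <= dist1 (F m (be qq)) (F m v) / 2 ^+ m.
  apply: (contract_iter ) => i.
    move=> lim; have cte : contp be 0 te by exact: contp_sub (lexx 0) (le_trans tets ts1) cbe.
    apply/ltW; apply: (@strip_trans _ _ (im (F i u'))).
    - by apply: cos_gt0_Pi; exact: (bM i.+1 lim).
    - exact: stays_cos.
    - exact: stays_cos.
    - have z0 : 0 <= (0 : R) <= te by rewrite lexx.
      exact: (path_same cte (bM i.+1 lim) qte' z0).
    - by rewrite distrC; exact: vu.
  by move=> /andP[_ lim]; split; [exact: bM|exact: sv].
have big : dist1 (F m (be qq)) (F m v) <= 20.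
  rewrite /dist1 qE subrr normr0 add0r; have := vu m; rewrite distrC.
  by move=> j1; have j2 := ler_distD (im (F m u')) (im (F m (be qq))) (im (F m v)); lra_from j1 j2 nv p4.
have : dist1 (be qq) v <= eta / 2.
  apply: le_trans close _; apply: le_trans (m0P m (ltnW m0m)).
  by rewrite ler_pM2r ?invr_gt0 ?exprn_gt0.
have := rP qq q01 qr; rewrite b0; have := dist1_tri u' (be qq) v.
by rewrite (dist1C u' (be qq)) => j1 j2 j3; lra_from j1 j2 j3.
Qed.

(** If no point is slower than the end, the end is the reference for [follow_reference]. Otherwise
    [strips_close] applies, and the start can be the reference if no point is slower than it. In the
    remaining case [slower_start_uniform] treats a neighbourhood of 0 and [tail_uniform] the
    rest. *)
Theorem germ_uniform g : germ g -> exists N, forall t, 0 <= t <= 1 -> stays MM (F N (g t)).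
Proof.
move=> G; have [cg ig eg g0 lug] := G.
pose w := g 1.
pose u := g 0.
have ew : esc w by apply: eg; rewrite ler01 lexx.
have [A0 _ _ CE [KE ME M1E]] := consts.
have g0M : stays MM u by apply: stays_le g0; lra.
have ext N : (forall t, pos01 t -> stays MM (F N (g t))) ->
    exists N, forall t, 0 <= t <= 1 -> stays MM (F N (g t)).
  move=> H; exists N => t /andP[]; rewrite le_eqVlt => /orP[/eqP <- _|t0 t1].
    exact: stays_F.
  by apply: H; apply/andP.
have [ns|ex] := pselect (forall t, pos01 t -> ~ slower (g t) w).
  by have [N NP] := not_slower_uniform G ns; exact: ext NP.
have {ex} [t0 J0 sl0] : exists2 t, pos01 t & slower (g t) w.
  by apply: contrapT => nex; apply: ex => t Jt st; apply: nex; exists t.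
have sc := strips_close G (slower_all G J0 sl0).
have [ns|ex] := pselect (forall t, pos01 t -> ~ slower (g t) u).
  have [k kP] := sc; have [N NP] := esc_stays MM ew.
  apply: (ext (k + N)%N); apply: (@follow_reference g u) => //.
  - by apply: stays_F; apply: stays_le g0; lra.
  - by apply: NP; exact: leq_addl.
  - by move=> m mm; apply: kP; apply: leq_trans mm; exact: leq_addr.
have {ex} [t1 Jt1 sl1] : exists2 t, pos01 t & slower (g t) u.
  by apply: contrapT => nex; apply: ex => t Jt st; apply: nex; exists t.
have [r [N [r0 rP]]] := slower_start_uniform G Jt1 sl1 sc.
pose c := Num.min 1 (r / 2).
have c0 : 0 < c by rewrite lt_min ltr01; lra.
have c1 : c <= 1 by rewrite ge_min lexx.
have cr : c < r by rewrite /c gt_min; apply/orP; right; lra.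
have Jcc : pos01 c by apply/andP.
have [N' N'P] := tail_uniform G Jcc; exists (maxn N N') => t /andP[t0' t1'].
have [tc|ct] := le_or_lt t c.
  by apply: stays_max (leq_maxl _ _) _; apply: rP; [apply/andP|exact: le_lt_trans tc cr].
by apply: stays_max (leq_maxr _ _) _; apply: N'P; rewrite (ltW ct).
Qed.

(** * From one exceptional end to arbitrary arcs *)

Lemma affine_diff x k s t : x + k * s - (x + k * t) = k * (s - t).
Proof. ring. Qed.

Lemma affine_onto x y s : x != y -> x + (y - x) * ((s - x) / (y - x)) = s.
Proof. by move=> xy; rewrite mulrCA divff ?subr_eq0 1?eq_sym// mulr1 addrC subrK. Qed.

Lemma quot01 x y : 0 <= x -> x <= y -> 0 < y -> 0 <= x / y <= 1.
Proof. by move=> x0 xy y0; rewrite divr_ge0 ?(ltW y0)//= ler_pdivrMr// mul1r. Qed.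

Lemma contp_affine g c d c' d' x k : contp g c d ->
  (forall t, c' <= t <= d' -> c <= x + k * t <= d) -> contp (fun t => g (x + k * t)) c' d'.
Proof.
move=> cg H t tcd e e0; have [r r0 rP] := cg _ (H t tcd) e e0.
have k0 := normr_ge0 k; have k1 : 0 < `|k| + 1 by lra.
exists (r / (`|k| + 1)); first by rewrite divr_gt0.
move=> s scd st; apply: rP; first exact: H.
rewrite affine_diff normrM; apply: le_lt_trans (_ : (`|k| + 1) * `|s - t| < _).
  by rewrite ler_wpM2r//; lra.
by rewrite mulrC -ltr_pdivlMr.
Qed.

Lemma inj_affine g c d c' d' x k : k != 0 -> inj_on g c d ->
  (forall t, c' <= t <= d' -> c <= x + k * t <= d) -> inj_on (fun t => g (x + k * t)) c' d'.
Proof.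
move=> k0 ig H s t sP tP E; apply: (mulfI k0); apply: (addrI x).
by apply: ig E; exact: H.
Qed.

Lemma esc_F n z : esc z -> esc (F n z).
Proof.
move=> ez B; have [N NP] := ez B; exists N => k Nk; rewrite -F_add; apply: NP.
by apply: leq_trans Nk _; exact: leq_addr.
Qed.

(* An arc whose ends stay far to the right and which is eventually in the half plane
   cannot dip below both its ends: it would run through one of them again. *)
Lemma arc_not_below g c d N t : contp g c d -> inj_on g c d ->
  (forall s, c <= s <= d -> stays MM (F N (g s))) -> c < t -> t < d ->
  ~ (slower (g t) (g c) /\ slower (g t) (g d)).
Proof.
move=> cg ig st ct td [/(slower_F N (g t) (g c)).2 s1 /(slower_F N (g t) (g d)).2 s2].
have icd : c <= c <= d by rewrite lexx ltW// (lt_trans ct).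
have idd : c <= d <= d by rewrite lexx ltW// (lt_trans ct).
have itd : c <= t <= d by rewrite !ltW.
have cF : contp (fun s => F N (g s)) c d by exact: contp_F.
have iF := path_F_inj cg ig st (n := N).
have sam s s' := path_same_all (s := s) (t := s') cF st.
have [h|h|h] := stays_trichotomy (st _ icd) (st _ idd) (sam _ _ icd idd).
- have [|||||s sP sE] := @path_hits (fun s => F N (g s)) t d (F N (g c)) (ltW td).
  + exact: contp_sub (ltW ct) (lexx d) cF.
  + by move=> s /andP[ts sd]; apply: st; rewrite sd (le_trans (ltW ct)).
  + exact: st.
  + exact: sam.
  + by left.
  have /andP[ts sd] := sP; have := iF s c; rewrite sd (le_trans (ltW ct) ts).
  by move=> /(_ isT icd sE); lra.
- have [|||||s sP sE] := @path_hits (fun s => F N (g s)) c t (F N (g d)) (ltW ct).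
  + exact: contp_sub (lexx c) (ltW td) cF.
  + by move=> s /andP[cs sd]; apply: st; rewrite cs (le_trans sd (ltW td)).
  + exact: st.
  + exact: sam.
  + by right.
  have /andP[cs sd] := sP; have := iF s d; rewrite cs (le_trans sd (ltW td)).
  by move=> /(_ isT idd sE); lra.
- by have := iF c d icd idd h; lra.
Qed.

(** By [arc_not_below] each point is not slower than one of the ends. Knowing the levels after [n]
    then puts its real part at level [n] at most 2 to the left of that end, so the entry time can be
    lowered level by level. The resulting time 0 no longer depends on [N]. *)
Lemma descend g c d N : c <= d -> contp g c d -> inj_on g c d -> stays M1 (g c) -> stays M1 (g d) ->
  (forall s, c <= s <= d -> stays MM (F N (g s))) -> forall s, c <= s <= d -> stays MM (g s).
Proof.
move=> cd cg ig sc sd st; have [A0 _ _ CE [KE ME M1E]] := consts.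
have icd : c <= c <= d by rewrite lexx.
have idd : c <= d <= d by rewrite lexx andbT.
have nb s : c <= s <= d -> exists2 b, c <= b <= d & stays M1 (g b) /\ ~ slower (g s) (g b).
  move=> sP; have nss p : ~ slower p p by move=> h; exact: (slower_asym h h).
  have [->|sc'] := eqVneq s c; first by exists c.
  have [->|sd'] := eqVneq s d; first by exists d.
  have /andP[cs sd0] := sP.
  have [h1|h1] := pselect (slower (g s) (g c)); last by exists c.
  have [h2|h2] := pselect (slower (g s) (g d)); last by exists d.
  by case: (@arc_not_below g c d N s cg ig st); rewrite ?lt_def ?sc' ?cs// eq_sym sd' sd0.
suff H : forall j s, c <= s <= d -> stays MM (F (N - j)%N (g s)).
  by move=> s sP; have := H N s sP; rewrite subnn.
elim=> [|j IH] s sP; first by rewrite subn0; exact: st.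
have [Nj|jN] := leqP N j.
  have -> : (N - j.+1 = N - j)%N by apply/eqP; rewrite (eqnP Nj) subn_eq0 leqW.
  exact: IH.
have E : (N - j = (N - j.+1).+1)%N by rewrite subnSK.
rewrite E in IH; move: (N - j.+1)%N IH => n IH.
have up k s' : (n.+1 <= k)%N -> c <= s' <= d -> MM <= re (F k (g s')).
  by move=> /subnK <- s'P; rewrite F_add; exact: IH.
case=> [|i]; last by have := IH s sP i; rewrite -!F_add addnS -addSn.
have [b bP [sb nsb]] := nb s sP.
have h1 k : (n.+1 <= k)%N -> MM <= re (F k (g s)) /\ MM <= re (F k (g b)).
  by move=> nk; split; exact: up.
have h2 k : (n.+1 <= k)%N -> `|im (F k (g s)) - im (F k (g b))| <= 20.
  move=> nk; apply: pi_le20; apply: (path_same cg) => // t tP; apply: up => //.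
  exact: leqW.
have := not_slower_ge h1 h2 (leqnn _) nsb; have := sb n; rewrite /= => *; lra.
Qed.

Definition unif_at g c d t := exists (r : R) N, 0 < r /\
  forall s, c <= s <= d -> `|s - t| < r -> stays MM (F N (g s)).

Lemma unif_at_open g c d t : unif_at g c d t -> exists2 r : R, 0 < r &
  forall s, `|s - t| < r -> unif_at g c d s.
Proof.
move=> [r [N [r0 rP]]]; exists r => // s st.
have e0 : 0 < r - `|s - t| by lra.
exists (r - `|s - t|), N; split => // s' s'P ss'; apply: rP => //.
by have := ler_distD s s' t; lra.
Qed.

Lemma germ_segment g c d x y : contp g c d -> inj_on g c d ->
  (forall t, c <= t <= d -> esc (g t)) -> c <= x <= d -> c <= y <= d -> x != y ->
  stays M1 (g x) ->
  (forall s, 0 < s <= 1 -> unif_at g c d (x + (y - x) * s)) ->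
  exists N, forall s, 0 <= s <= 1 -> stays MM (F N (g (x + (y - x) * s))).
Proof.
move=> cg ig eg xP yP xy sx un; have yx : y - x != 0 by rewrite subr_eq0 eq_sym.
have on s : 0 <= s <= 1 -> c <= x + (y - x) * s <= d.
  move=> /andP[s0 s1]; have /andP[? ?] := xP; have /andP[? ?] := yP.
  by apply/andP; split; nra.
apply: (@germ_uniform (fun s => g (x + (y - x) * s))); split.
- exact: contp_affine cg on.
- exact: inj_affine ig on.
- by move=> t /on; exact: eg.
- by rewrite mulr0 addr0.
- move=> t tP; have [r [N [r0 rP]]] := un t tP.
  have yx0 : 0 < `|y - x| by rewrite normr_gt0.
  exists (r / `|y - x|), N; split; first by rewrite divr_gt0.
  move=> s /andP[s0 s1] st; apply: rP; first by apply: on; rewrite (ltW s0).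
  by rewrite affine_diff normrM mulrC -ltr_pdivlMr.
Qed.

(** If [(0, 1]] contains an exceptional parameter [c2], time 0 works on all of [[0, c2)].
    Exceptional parameters and 0 are covered by hypothesis. Any other parameter lies in a gap
    between two of these, where [germ_uniform] from both ends gives some time, depending on the gap,
    and [descend] lowers it to 0. *)
Lemma side_uniform g : contp g 0 1 -> inj_on g 0 1 -> (forall t, 0 <= t <= 1 -> esc (g t)) ->
  stays M1 (g 0) -> (forall t, 0 <= t <= 1 -> ~ unif_at g 0 1 t -> stays M1 (g t)) ->
  exists (r : R) N, 0 < r /\ forall s, 0 <= s <= 1 -> s < r -> stays MM (F N (g s)).
Proof.
move=> cg ig eg s0 bd; have [A0 _ _ CE [KE ME M1E]] := consts.
have i0 : 0 <= (0 : R) <= 1 by rewrite lexx ler01.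
have i1 : 0 <= (1 : R) <= 1 by rewrite lexx ler01.
have [all|] := pselect (forall t, 0 < t <= 1 -> unif_at g 0 1 t).
  have [||N NP] := @germ_segment g 0 1 0 1 cg ig eg i0 i1 _ s0.
  - by rewrite eq_sym oner_eq0.
  - by move=> s sP; rewrite add0r subr0 mul1r; exact: all.
  exists 2, N; split => // s sP _.
  by have := NP s sP; rewrite add0r subr0 mul1r.
move=> /existsNP[c2 /not_implyP[/andP[c20 c21] nc2]].
exists c2, 0%N; split => // t /andP[t0 t1] tc2.
have ti : 0 <= t <= 1 by rewrite t0.
pose P s := ~ unif_at g 0 1 s \/ s = 0.
have [Pt|nPt] := pselect (P t).
  by apply: (@stays_le M1); [lra|case: Pt => [/bd|->//]; exact].
have Popen s : ~ P s -> exists2 r : R, 0 < r & forall s', `|s' - s| < r -> ~ P s'.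
  move=> /not_orP[/contrapT us /eqP ns]; have [r r0 rP] := unif_at_open us.
  exists (Num.min r `|s|); first by rewrite lt_min r0 normr_gt0.
  move=> s'; rewrite lt_min => /andP[h1 h2] [h|h]; first by apply: h; exact: rP.
  by move: h2; rewrite h sub0r normrN ltxx.
have [||u [/andP[u0 ut] Pu uP]] := @last_time P 0 t t0.
- by right.
- by move=> s _ /Popen[r r0 rP]; exists r => // s' _; exact: rP.
have [||v [/andP[tv vc] Pv vP]] := @first_time P t c2 (ltW tc2).
- by left.
- by move=> s _ /Popen[r r0 rP]; exists r => // s' _; exact: rP.
have {}ut : u < t by rewrite lt_def ut andbT; apply/eqP => E; apply: nPt; rewrite E.
have {}tv : t < v by rewrite lt_def tv andbT; apply/eqP => E; apply: nPt; rewrite -E.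
have sP s : 0 <= s <= 1 -> P s -> stays M1 (g s) by move=> si [/bd|->]; [exact|].
have ui : 0 <= u <= 1 by rewrite u0 (le_trans (ltW ut)).
have vi : 0 <= v <= 1 by rewrite (le_trans t0 (ltW tv)) (le_trans vc).
have gap s : u < s -> s < v -> unif_at g 0 1 s.
  move=> us sv; have : ~ P s by have [st|ts] := le_or_lt s t; [apply: uP|apply: vP => //; exact: ltW].
  by move=> /not_orP[/contrapT].
have [||N1 N1P] := @germ_segment g 0 1 u t cg ig eg ui ti _ (sP u ui Pu).
- by rewrite lt_eqF.
- by move=> s /andP[k1 k2]; apply: gap; move: k1 k2 ut tv; clear_props => *; nra.
have [||N2 N2P] := @germ_segment g 0 1 v t cg ig eg vi ti _ (sP v vi Pv).
- by rewrite gt_eqF.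
- by move=> s /andP[k1 k2]; apply: gap; move: k1 k2 ut tv; clear_props => *; nra.
have uv : u <= v by rewrite ltW// (lt_trans ut).
have u1 : 0 <= u by []. have v1 : v <= 1 by exact: le_trans c21.
apply: (@descend g u v (maxn N1 N2) uv).
- exact: contp_sub u1 v1 cg.
- by move=> s s' sP' s'P; apply: ig; exact: (itv_sub u1 v1).
- exact: sP.
- exact: sP.
- move=> s /andP[us sv]; have [st|ts] := le_or_lt s t.
    apply: stays_max (leq_maxl _ _) _; have tu : u != t by rewrite lt_eqF.
    have := N1P ((s - u) / (t - u)).
    rewrite affine_onto//; apply.
    by apply: quot01; rewrite ?subr_ge0// ?subr_gt0// lerD2r.
  apply: stays_max (leq_maxr _ _) _; have tu : v != t by rewrite gt_eqF.
  have := N2P ((s - v) / (t - v)).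
  rewrite affine_onto//; apply.
  have -> : (s - v) / (t - v) = (v - s) / (v - t) by rewrite -[RHS]mulrNN -invrN !opprB.
  by apply: quot01; rewrite ?subr_ge0// ?subr_gt0// lerD2l lerN2 ltW.
- by rewrite !ltW.
Qed.

Lemma one_side g N x k : contp g 0 1 -> inj_on g 0 1 -> (forall t, 0 <= t <= 1 -> esc (g t)) ->
  k != 0 -> (forall t, 0 <= t <= 1 -> 0 <= x + k * t <= 1) ->
  inj_on (fun t => F N (g (x + k * t))) 0 1 ->
  (forall t, 0 <= t <= 1 -> ~ unif_at g 0 1 (x + k * t) -> stays M1 (F N (g (x + k * t)))) ->
  stays M1 (F N (g x)) ->
  exists (r : R) N', 0 < r /\ forall s, 0 <= s <= 1 -> s < r -> stays MM (F N' (g (x + k * s))).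
Proof.
move=> cg ig eg k0 on inj bd sx.
have [||||| r [N' [r0 rP]]] := @side_uniform (fun t => F N (g (x + k * t))).
- by apply: contp_F; exact: contp_affine cg on.
- exact: inj.
- by move=> t /on /eg; exact: esc_F.
- by rewrite mulr0 addr0.
- move=> t tP nu; apply: bd => // -[r [N' [r0 rP]]]; apply: nu.
  exists (r / `|k|), N'; split; first by rewrite divr_gt0// normr_gt0.
  move=> s sP st; rewrite -F_add addnC F_add; apply: stays_F; apply: rP; first exact: on.
  by rewrite affine_diff normrM mulrC -ltr_pdivlMr ?normr_gt0.
exists r, (N' + N)%N; split => // s sP sr; rewrite F_add; exact: rP.
Qed.

Lemma unif_at_all g : (forall t, 0 <= t <= 1 -> unif_at g 0 1 t) ->
  exists N, forall t, 0 <= t <= 1 -> stays MM (F N (g t)).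
Proof.
move=> un; pose Q x := exists N, forall s, 0 <= s <= x -> stays MM (F N (g s)).
pose J x := 0 <= x <= 1.
have step x : J x -> exists2 r : R, 0 < r & forall u v, J u -> J v -> `|u - x| < r ->
    `|v - x| < r -> Q u -> Q v.
  move=> Jx; have [r [N [r0 rP]]] := un x Jx; exists r => // u v Ju Jv ux vx [N' N'P].
  exists (maxn N N') => s /andP[s0 sv]; have [us|su] := le_or_lt s u.
    by apply: stays_max (leq_maxr _ _) _; apply: N'P; apply/andP.
  apply: stays_max (leq_maxl _ _) _; apply: rP.
    by move: Jv; rewrite /J => /andP[_ v1]; rewrite s0 (le_trans sv).
  by rewrite ltr_norml in ux; rewrite ltr_norml in vx; rewrite ltr_norml; lra.
have J0 : J 0 by rewrite /J lexx ler01.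
suff : forall x, J x -> Q x by apply; rewrite /J ler01 lexx.
apply: (@itv_induct R J Q 0) => //.
- move=> x y t; rewrite /J => /andP[? ?] /andP[? ?] /andP[? ?]; apply/andP; split; lra.
- have [r [N [r0 rP]]] := un 0 J0; exists N => s /andP[s1 s2].
  have -> : s = 0 by lra.
  by apply: rP => //; rewrite subrr normr0.
Qed.

(* Baire category, applied to the closed set of parameters at which [unif_at] fails. *)
Lemma bad_piece g t0 : contp g 0 1 -> (forall t, 0 <= t <= 1 -> esc (g t)) ->
  0 <= t0 <= 1 -> ~ unif_at g 0 1 t0 ->
  exists x y t N, [/\ x < t, t < y, 0 <= t <= 1, ~ unif_at g 0 1 t &
   forall s, x < s -> s < y -> 0 <= s <= 1 -> ~ unif_at g 0 1 s -> stays M1 (F N (g s))].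
Proof.
move=> cg eg t01 nt0; apply: contrapT => none.
pose P (n : nat) x y := (exists c, [/\ x < c, c < y, 0 <= c <= 1 & ~ unif_at g 0 1 c]) /\
   forall s, 0 <= s <= 1 -> x <= s <= y -> forall m : nat, n = m.+1 ->
     exists2 k : nat, (m <= k)%N & re (F k (g s)) < M1.
have [||| t tP] := @nested_intervals R P (- 1) 2.
- lra.
- by split => //; exists t0; have /andP[? ?] := t01; split => //; lra.
- move=> n x y _ [[c [xc cy ci nc]] _].
  have [c' [xc' c'y c'i nc' nst]] : exists c', [/\ x < c', c' < y, 0 <= c' <= 1, ~ unif_at g 0 1 c' &
      ~ stays M1 (F n (g c'))].
    apply: contrapT => nex; apply: none; exists x, y, c, n; split => // s xs sy si ns.
    by apply: contrapT => h; apply: nex; exists s.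
  have [k] : exists k : nat, re (F (k + n)%N (g c')) < M1.
    apply: contrapT => nk; apply: nst => k; rewrite -F_add leNgt; apply/negP => h.
    by apply: nk; exists k.
  have cF : contp (fun s => F (k + n)%N (g s)) 0 1 by exact: contp_F.
  move=> /(lt_open (contp_re cF) c'i)[r r0 rP].
  have r2 : r / 2 < r by lra.
  exists (Num.max x (c' - r / 2)), (Num.min y (c' + r / 2)).
  have h1 : Num.max x (c' - r / 2) < c' by rewrite gt_max xc'; lra.
  have h2 : c' < Num.min y (c' + r / 2) by rewrite lt_min c'y; lra.
  split; [by rewrite le_max lexx|by rewrite ltW// (lt_trans h1)|by rewrite ge_min lexx|].
  split; first by exists c'.
  move=> s si /andP[]; rewrite ge_max le_min => /andP[_ s1] /andP[_ s2] m [nm].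
  exists (k + n)%N; first by rewrite nm leq_addl.
  by apply: rP => //; rewrite ltr_norml; apply/andP; split; lra.
have tt := clamp01 t; have [B BP] := eg _ tt M1.
have [x [y [/andP[xt ty] [[c [xc cy /andP[c0 c1] _]] H]]]] := tP B.+1.
have [|k Bk] := H (clamp t) tt _ B erefl; last first.
  by have := BP k Bk; lra.
by have [[? ->]|[_ ->]|[? ->]] := clampP t; apply/andP; split; lra.
Qed.

Lemma itv01_cvx x k t : 0 <= x <= 1 -> 0 <= x + k <= 1 -> 0 <= t <= 1 -> 0 <= x + k * t <= 1.
Proof. by move=> /andP[? ?] /andP[? ?] /andP[? ?]; apply/andP; split; nra. Qed.

(** On the piece given by [bad_piece] the exceptional parameters have a common entry time [N]. Close
    enough to [t], where [F N] is injective, [side_uniform] applies to the iterated arc on each side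
    of [t], so that [t] is not exceptional. *)
Theorem arc_uniform g : contp g 0 1 -> inj_on g 0 1 -> (forall t, 0 <= t <= 1 -> esc (g t)) ->
  exists N, forall t, 0 <= t <= 1 -> stays MM (F N (g t)).
Proof.
move=> cg ig eg; apply: unif_at_all => t0 t0i; apply: contrapT => nt0.
have [x [y [t [N [xt ty ti nt bd]]]]] := bad_piece cg eg t0i nt0.
have /andP[tg0 tl1] := ti.
have [r r0 rinj] := @F_loc_inj N (g t).
have [r1 r10 r1P] := cg t ti r r0.
have [dl dl0 [d1 d2 d3]] : exists2 dl : R, 0 < dl & [/\ dl < r1, dl < t - x & dl < y - t].
  have m1 : Num.min r1 (Num.min (t - x) (y - t)) <= r1 by rewrite ge_min lexx.
  have m2 : Num.min r1 (Num.min (t - x) (y - t)) <= t - x by rewrite !ge_min lexx orbT.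
  have m3 : Num.min r1 (Num.min (t - x) (y - t)) <= y - t by rewrite !ge_min lexx !orbT.
  have m4 : 0 < Num.min r1 (Num.min (t - x) (y - t)) by rewrite !lt_min r10 !subr_gt0 xt.
  exists (Num.min r1 (Num.min (t - x) (y - t)) / 2); first by rewrite divr_gt0.
  have m5 : Num.min r1 (Num.min (t - x) (y - t)) / 2 < Num.min r1 (Num.min (t - x) (y - t)) by lra_from m4.
  by split; apply: lt_le_trans m5 _.
have side k : k != 0 -> `|k| <= dl -> 0 <= t + k <= 1 ->
    exists (r : R) N', 0 < r /\ forall s, 0 <= s <= 1 -> s < r -> stays MM (F N' (g (t + k * s))).
  move=> k0 kd tk.
  have on s := @itv01_cvx t k s ti tk.
  have near s : 0 <= s <= 1 -> `|t + k * s - t| <= dl.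
    move=> /andP[s0 s1]; rewrite addrAC subrr add0r normrM (ger0_norm (x := s))//.
    by apply: le_trans kd; rewrite -[leRHS]mulr1 ler_wpM2l.
  apply: (one_side (N := N) cg ig eg k0 on).
  - move=> s s' si s'i E; apply: (mulfI k0); apply: (addrI t); apply: ig; [exact: on|exact: on|].
    by apply: rinj E; apply: r1P; rewrite ?on//; apply: le_lt_trans d1; exact: near.
  - move=> s si; apply: bd; last exact: on.
      by have := near s si; rewrite ler_norml => /andP[k1 _]; lra_from k1 d2.
    by have := near s si; rewrite ler_norml => /andP[_ k1]; lra_from k1 d3.
  - exact: bd.
have stM := bd t xt ty ti nt.
have MM1 : MM <= M1 by have [? _ _ ? [? ? ?]] := consts; lra.
(* The signs [e = 1] and [e = - 1] treat the two sides together; the first alternative is that [t]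
   is the end of [[0, 1]] on that side. *)
have dir e : e * e = 1 -> (forall s, 0 <= s <= 1 -> 0 <= e * (s - t) -> s = t) \/
    (exists2 k, 0 < k <= dl & 0 <= t + e * k <= 1) ->
    exists (r : R) N', 0 < r /\
      forall s, 0 <= s <= 1 -> 0 <= e * (s - t) < r -> stays MM (F N' (g s)).
  move=> ee [st|[k /andP[k0 kd] tk]].
    exists 1, N; split => // s si /andP[/(st s si) -> _].
    exact: stays_le stM.
  have e0 : e != 0 by apply/eqP => e0; move: ee; rewrite e0 mul0r => /eqP; rewrite eq_sym oner_eq0.
  have en : `|e| = 1 by apply/eqP; rewrite -(@eqrXn2 _ 2)// real_normK ?num_real// expr2 ee expr1n.
  have [||| q [N' [q0 qP]]] := side (e * k).
  - by rewrite mulf_neq0// gt_eqF.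
  - by rewrite normrM en mul1r gtr0_norm.
  - exact: tk.
  have q1 : k * Num.min 1 q <= 1 * k by rewrite mulrC ler_wpM2r ?ge_min ?lexx// ltW.
  have q2 : k * Num.min 1 q <= q * k by rewrite mulrC ler_wpM2r ?ge_min ?lexx ?orbT// ltW.
  exists (k * Num.min 1 q), N'; split; first by rewrite mulr_gt0// lt_min ltr01.
  move=> s si /andP[ts st]; have := qP (e * (s - t) / k).
  rewrite [t + _ * _](_ : _ = s).
    by apply; rewrite ?divr_ge0 ?ler_pdivrMr ?ltr_pdivrMr ?(ltW k0)//=; lra_from st q1 q2.
  have kn : k != 0 by rewrite gt_eqF.
  by transitivity (t + e * e * (s - t)); [field|rewrite ee mul1r addrC subrK].
apply: nt.
have [||q1 [N1 [q10 P1]]] := dir 1; first by rewrite mulr1.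
  have [t1|t1] := lt_or_le t 1; [right|left].
    exists (Num.min dl (1 - t)).
      by rewrite lt_min dl0 subr_gt0 t1 ge_min lexx.
    have m2 : Num.min dl (1 - t) <= 1 - t by rewrite ge_min lexx orbT.
    have m3 : 0 < Num.min dl (1 - t) by rewrite lt_min dl0 subr_gt0.
    by rewrite mul1r; apply/andP; split; [lra_from tg0 m3|lra_from m2].
  move=> s /andP[_ s1]; rewrite mul1r subr_ge0 => ts; lra_from t1 s1 ts tl1.
have [||q2 [N2 [q20 P2]]] := dir (- 1); first by rewrite mulrNN mulr1.
  have [t1|t1] := lt_or_le 0 t; [right|left].
    exists (Num.min dl t).
      by rewrite lt_min dl0 t1 ge_min lexx.
    have m2 : Num.min dl t <= t by rewrite ge_min lexx orbT.
    have m3 : 0 < Num.min dl t by rewrite lt_min dl0.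
    by rewrite mulN1r; apply/andP; split; [lra_from m2|lra_from tl1 m3].
  move=> s /andP[s0 _]; rewrite mulN1r opprB subr_ge0 => st; lra_from t1 s0 st tg0.
exists (Num.min q1 q2), (maxn N1 N2); split; first by rewrite lt_min q10.
move=> s si; rewrite lt_min !ltr_norml => /andP[/andP[_ h2] /andP[h3 _]].
have [ts|st] := le_or_lt t s.
  by apply: stays_max (leq_maxl _ _) _; apply: P1; rewrite // mul1r subr_ge0 ts.
apply: stays_max (leq_maxr _ _) _; apply: P2 => //.
by rewrite mulN1r opprB subr_ge0 (ltW st); lra_from h3.
Qed.

(** * Exit points of rays *)

(* Orbits in the half plane avoid the lines [im z = thr k], on which [cos (im z) = -1]. *)
Definition thr (k : nat) : R := pi + pi *+ 2 *+ k.

Lemma cos_thr k : cos (thr k) = - 1.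
Proof.
rewrite /thr; elim: k => [|k IH]; first by rewrite mulr0n addr0 cospi.
by rewrite mulrSr addrA cosD2pi.
Qed.

Lemma thr_mono k k' : (k <= k')%N -> thr k <= thr k'.
Proof.
move=> kk; rewrite lerD2l -[leLHS]mulr_natr -[leRHS]mulr_natr ler_wpM2l ?ler_nat//.
by rewrite mulrn_wge0// pi_ge0.
Qed.

Lemma thr_large (B : R) : exists k0, forall k, (k0 <= k)%N -> B <= thr k.
Proof.
exists (Num.bound `|B|) => k kk; apply: le_trans (ler_norm B) _.
have h := archi_boundP (normr_ge0 B); apply: le_trans (ltW h) _.
have : (Num.bound `|B|)%:R <= k%:R :> R by rewrite ler_nat.
have p2 := @pi_ge2 R; have k0 : 0 <= k%:R :> R by [].
rewrite /thr -[(pi *+ 2) *+ k]mulr_natr mulr2n; move: k%:R k0 => y y0 h2.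
have : 0 <= (pi - 2) * y by rewrite mulr_ge0// subr_ge0.
lra.
Qed.

Lemma strip_keep k x y : 0 < cos x -> 0 < cos y -> `|x - y| < pi -> thr k <= x -> thr k <= y.
Proof.
move=> cx cy; rewrite ltr_norml => /andP[_ h1] h2; rewrite leNgt; apply/negP => h3.
have ii : y <= thr k <= x by rewrite (ltW h3).
by have := cos_between cy cx ii h1; rewrite cos_thr ltr0N1.
Qed.

(** The upper limit is a cluster value: [E] collects the bounds that the sequence reaches infinitely
    often. *)
Lemma seq_cluster (x : nat -> R) (B : R) : (forall n, `|x n| <= B) ->
  exists l, forall e, 0 < e -> forall N, exists2 n, (N <= n)%N & `|x n - l| < e.
Proof.
move=> xB; pose E : set R := [set y : R | forall N, exists2 n, (N <= n)%N & y <= x n].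
have E0 : E (- B).
  by move=> N; exists N => //; have := xB N; rewrite ler_norml => /andP[].
have EB : ubound E B.
  by move=> y /(_ 0%N)[n _ h]; apply: le_trans h _; have := xB n; rewrite ler_norml => /andP[].
exists (sup E) => e e0 N.
have [N1 N1P] : exists N1, forall n, (N1 <= n)%N -> x n < sup E + e.
  apply: contrapT => h; have : E (sup E + e).
    move=> N2; apply: contrapT => h2; apply: h; exists N2 => n nN.
    by rewrite ltNge; apply/negP => h3; apply: h2; exists n.
  move=> h3; have : sup E + e <= sup E by apply: ub_le_sup => //; exists B.
  lra.
have [y Ey yl] := @sup_adherent R E e e0 (conj (ex_intro _ _ E0) (ex_intro _ _ EB)).
have [n nN yn] := Ey (N + N1)%N; exists n; first exact: leq_trans (leq_addr _ _) nN.
have := N1P n (leq_trans (leq_addl _ _) nN); rewrite ltr_norml => *; apply/andP; split; lra.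
Qed.

Lemma plane_cluster (u : nat -> C) (B : R) : (forall n, dist1 (u n) 0 <= B) ->
  exists l, forall e, 0 < e -> forall N, exists2 n, (N <= n)%N & dist1 (u n) l < e.
Proof.
move=> uB.
have re_b n : `|re (u n)| <= B.
  by have := le_trans (re_dist1 _ _) (uB n); rewrite -[re 0]/(0 : R) subr0.
have im_b n : `|im (u n)| <= B.
  by have := le_trans (im_dist1 _ _) (uB n); rewrite -[im 0]/(0 : R) subr0.
have [l1 l1P] := seq_cluster re_b.
have /choice[phi phiP] : forall k, exists n, (k <= n)%N /\ `|re (u n) - l1| < k.+1%:R^-1.
  move=> k; have k0 : 0 < k.+1%:R^-1 :> R by rewrite invr_gt0.
  by have [n n1 n2] := l1P _ k0 k; exists n.
have [l2 l2P] := seq_cluster (fun k => im_b (phi k)).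
exists (Complex l1 l2) => e e0 N.
have e20 : 0 < e / 2 by lra.
pose K := Num.bound (2 / e).
have [k kNK hk] := l2P _ e20 (N + K)%N; have [pk hp] := phiP k.
exists (phi k); first by apply: leq_trans pk; apply: leq_trans kNK; exact: leq_addr.
have h3 : k.+1%:R^-1 <= e / 2 :> R.
  rewrite -[e / 2]invrK lef_pV2 ?posrE ?invr_gt0// invf_div.
  have h4 : 2 / e < K%:R by apply: archi_boundP; rewrite divr_ge0// ltW.
  apply: le_trans (ltW h4) _; rewrite ler_nat; apply: leqW; apply: leq_trans kNK; exact: leq_addl.
have h5 := lt_le_trans hp h3; clear hp h3; rewrite /dist1 ReC ImC; lra.
Qed.

(* Choose [im b] with [e^r cos (im b) = r] and [im b] within [pi] of [e^r sin (im b)]. *)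
Lemma far_fixed (r : R) : MM + CC <= r -> exists b : C, [/\ re b = r, 0 < cos (im b),
  dist1 (f b) b <= CC & expR r / 2 - 4 <= im b].
Proof.
move=> rM; have [A0 ra ia CE [KE ME M1E]] := consts; have p4 := @pi_le4 R.
have r0 : 0 < r by lra.
have e0 := expR_gt0 r.
have e2 : 2 * r <= expR r.
  have h := expR_ge1Dx (r / 2); have -> : expR r = expR (r / 2) * expR (r / 2).
    by rewrite -expRD -splitr.
  by nra.
pose Y := Num.sqrt (expR r ^+ 2 - r ^+ 2).
have d0 : 0 <= expR r ^+ 2 - r ^+ 2 by nra.
have Y2 : Y ^+ 2 = expR r ^+ 2 - r ^+ 2 by rewrite sqr_sqrtr.
have Y0 : 0 <= Y by exact: sqrtr_ge0.
have Yh : expR r / 2 <= Y by nra.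
have [|t0 [ct0 st0]] := @polar_unit R (r / expR r) (Y / expR r).
  by rewrite !expr_div_n -mulrDl Y2 addrC subrK divff// expf_eq0 gt_eqF.
have [t [ct st tY]] := periodic_shift t0 Y.
exists (Complex r t); rewrite ReC ImC; split => //.
- by rewrite ct ct0 divr_gt0.
- rewrite /dist1 re_f im_f ReC ImC ct st ct0 st0.
  rewrite !(mulrC (expR r)) !divfK ?gt_eqF// addrAC subrr add0r.
  rewrite ler_norml in tY; have /andP[? ?] := tY.
  have : `|Y + im a - t| <= pi + `|im a|.
    have := ler_norm (im a); have := ler_norm (- im a); rewrite normrN => *.
    by rewrite ler_norml; apply/andP; split; lra.
  by move: CE; rewrite /Aa; lra.
- by rewrite ler_norml in tY; have /andP[? ?] := tY; lra.
Qed.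

(* The orbit of [z] follows that of [w] up to time [n] and then stays near the point of
   [far_fixed]. Hence the last clause: no point in the same strips as [z] can be much
   further to the left at time [n]. *)
Lemma move w e (n0 : nat) (B : R) : stays M1 w -> esc w -> 0 < e -> exists (n : nat) z,
  [/\ (n0 <= n)%N, dist1 z w < e, stays MM z,
     forall i, (i <= n)%N -> `|im (F i z) - im (F i w)| < pi &
     (forall i, (n < i)%N -> B <= im (F i z)) /\
     forall p, `|im (f p) - im (F n.+1 z)| <= 8 -> re (F n z) - CC - 2 <= re p].
Proof.
move=> sw ew e0; have [A0 ra ia CE [KE ME M1E]] := consts; have p4 := @pi_le4 R.
have p0 := @pi_gt0 R.
have [N NP] := ew (2 * `|B| + 4 * (20 + CC + Aa) + MM + 2 * CC + Aa).
have CC5 : 0 < CC + 5 by lra.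
have [N' N'P] := half_pow_small CC5 e0.
have [n [n1 n2 n3 n4]] : exists n, [/\ (0 < n)%N, (n0 <= n)%N, (N <= n)%N & (N' <= n)%N].
  exists (n0 + N + N').+1; split; rewrite ?ltnS//; apply: leqW.
  - by rewrite -addnA leq_addr.
  - by rewrite addnAC leq_addl.
  - exact: leq_addl.
pose r := re (F n w).
have B0 := normr_ge0 B; have Bn := ler_norm B.
have rM : 2 * `|B| + 4 * (20 + CC + Aa) + MM + 2 * CC + Aa <= r.
  exact: NP.
have re1 : r <= expR r by have j := expR_ge1Dx r; lra_from j.
have [|b [br bc bf bi]] := far_fixed (r := r); first lra_from rM B0 A0 CE KE ME.
have [y1 [cy1 sy1 y1P]] := periodic_shift (im b) (im (F n w)).
(* The pseudo-orbit follows [w], is moved vertically at time [n] by at most [pi] to a point with the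
   same image as [b], and then rests at [b]. *)
pose q i := if (i < n)%N then F i w else if i == n then Complex r y1 : C else b.
have qlt i : (i < n)%N -> q i = F i w by rewrite /q => ->.
have qn : q n = Complex r y1 by rewrite /q ltnn eqxx.
have qgt i : (n < i)%N -> q i = b by rewrite /q => ni; rewrite ltnNge (ltnW ni) /= gtn_eqF.
have fqn : f (q n) = f b.
  rewrite qn; apply: cplane_eq; [rewrite re_f [RHS]re_f|rewrite im_f [RHS]im_f].
    by rewrite ReC ImC br cy1.
  by rewrite ReC ImC br sy1.
have [||z zP] := @shadow q.
- move=> i; have [lin|] := ltnP i n.
    rewrite (qlt i lin) -iterS; have [E|ne] := eqVneq i.+1 n.
      by rewrite E qn /dist1 ReC ImC subrr normr0 add0r distrC; lra_from y1P p4 A0 CE.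
    rewrite qlt ?dist1_xx; first lra_from A0 CE.
    by rewrite ltn_neqAle ne.
  rewrite leq_eqVlt => /orP[/eqP <-|ni]; first by rewrite fqn qgt.
  by rewrite !qgt// ltnW.
- have rfb : r - CC <= re (f b).
    by have := le_trans (re_dist1 _ _) bf; rewrite br ler_norml => /andP[j _]; lra_from j.
  move=> i; have [lin|] := ltnP i n.
    by rewrite (qlt i lin) -iterS; have j := sw i.+1; lra_from j A0 CE KE ME M1E.
  rewrite leq_eqVlt => /orP[/eqP <-|ni]; first by rewrite fqn; lra_from rfb rM B0 A0 CE KE ME.
  by rewrite qgt//; lra_from rfb rM B0 A0 CE KE ME.
have sz : stays MM z.
  case=> [|i]; last by have [] := zP i.
  have [h _ _] := zP 0%N; rewrite qlt// in h.
  have := le_trans (re_dist1 _ _) h; have k := sw 0%N.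
  by rewrite ler_norml => /andP[j _]; lra_from j k A0 CE KE ME M1E.
have swM : stays MM w by apply: stays_le sw; lra_from A0 CE KE ME M1E.
have strip i : (i <= n)%N -> `|im (F i z) - im (F i w)| < pi.
  rewrite leq_eqVlt => /orP[/eqP ->|lin]; last by have [_ + _] := zP i; rewrite qlt.
  have [_ h _] := zP n; rewrite qn ImC in h.
  have cy : 0 < cos y1 by rewrite cy1.
  apply: strip_trans h _ => //; [exact: stays_cos|exact: stays_cos|].
  by apply: strip_neq_pi => //; exact: stays_cos.
exists n, z; split => //.
- have : dist1 z w <= dist1 (F n z) (F n w) / 2 ^+ n.
    apply: (contract_iter ) => [i lin|i _]; last by split; [exact: sz|exact: swM].
    by apply: ltW; apply: strip; exact: ltnW.
  have [h _ _] := zP n; have h' := dist1_tri (F n z) (q n) (F n w).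
  have h2 : dist1 (q n) (F n w) <= pi.
    by rewrite qn /dist1 ReC ImC subrr normr0 add0r.
  move=> h3; apply: le_lt_trans h3 _; have h4 := N'P n; apply: lt_le_trans (h4 _).
    by rewrite ltr_pM2r ?invr_gt0 ?exprn_gt0//; lra_from h h' h2 p4.
  by [].
have late i : (n < i)%N -> `|im (F i z) - im b| <= CC.
  by move=> ni; have [h _ _] := zP i; rewrite qgt// in h; exact: le_trans (im_dist1 _ _) h.
split.
  move=> i /late; rewrite ler_norml => /andP[j _]; lra_from j bi rM re1 Bn A0 CE KE ME.
move=> p; have := late n.+1 (ltnSn n); rewrite !ler_norml => /andP[h1 h2] /andP[h3 h4].
have /andP[_ ia2] := im_a_bound.
(* A point whose image is nearly as high as [b] has image at distance at least
   [e^r / 4 >= e^(r - 2)] from [a], hence real part at least [r - 2]. *)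
have h5 : expR r / 4 <= im (f p) - im a by lra_from h1 h3 bi rM re1 B0 A0 CE KE ME ia2.
have h6 : 0 <= expR r / 4 by rewrite divr_ge0// expR_ge0.
have h7 := modulus_ge_im h6 h5.
have h8 : r - 2 <= re p.
  rewrite -ler_expR; apply: le_trans h7; rewrite expRD ler_pM2l ?expR_gt0//.
  rewrite expRN lef_pV2 ?posrE ?expR_gt0//.
  have := expR_ge1Dx (1 : R) => h9; have -> : expR 2 = expR 1 * expR 1 :> R.
    by rewrite -expRD.
  by move: h9; clear_props => h9; nra.
have [h9 _ _] := zP n; rewrite qn in h9; have := le_trans (re_dist1 _ _) h9.
rewrite ReC ler_norml => /andP[_ j]; lra_from j h8.
Qed.

(** All iterates are involved because an arc through [z] can be compared with it only at a level at
    which the whole arc has entered the half plane. *)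
Definition minimal z := forall N p, stays MM p -> same p (F N z) -> ~ slower p (F N z).

Section Threshold.
Variable K0 : nat.
Hypothesis K0P : expR M1 + Aa <= thr K0.

(** Unlike escape, this passes to limits and to points of the half plane with the same code; by the
    choice of [K0] it implies [stays M1]. *)
Definition above z := forall n, thr K0 <= im (F n z).

Lemma above_stays z : above z -> stays M1 z.
Proof.
move=> az n; have := az n.+1 => /= h; have /andP[? ?] := im_a_bound.
have h1 : expR M1 <= im (f (F n z)) - im a by have := K0P; lra.
by have := modulus_ge_im (expR_ge0 _) h1; rewrite ler_expR.
Qed.

Lemma above_same z w : above z -> stays MM w -> same z w -> above w.
Proof.
move=> az sw zw n; have sz := stays_M1_MM (above_stays az).
exact: strip_keep (stays_cos sz n) (stays_cos sw n) (zw n) (az n).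
Qed.

Section Exit.
Variable V : C -> Prop.
Hypothesis Vo : forall z, V z -> exists2 r : R, 0 < r & forall w, dist1 w z < r -> V w.
Variable B : R.
Hypothesis VB : forall z, V z -> dist1 z 0 <= B.

(** [move] is applied not to [z], which need not escape, but to [H s] with [s > 0], which does.
    Taking [s] just before the exit time [t] keeps the new point in [V] and close to [H t], which is
    outside. *)
Lemma tail_exit z (j n : nat) (e : R) : V z -> above z -> 0 < e -> exists (n' : nat) z' p,
  [/\ V z', above z', (n < n')%N & ~ V p /\ dist1 z' p < e] /\
  [/\ forall i, (i <= n')%N -> `|im (F i z') - im (F i z)| < pi,
     forall i, (n' < i)%N -> thr (K0 + j) <= im (F i z') &
     forall w, `|im (f w) - im (F n'.+1 z')| <= 8 -> re (F n' z') - CC - 2 <= re w].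
Proof.
move=> Vz az e0; have sz := above_stays az; have szM := stays_M1_MM sz.
have [H [H0 Hs Hc _ [Hr He]]] := tail sz.
have [X X0 XV] : exists2 X : R, 0 <= X & ~ V (H X).
  have [X XE] : exists X, X = `|B| + `|re z| + 2 + CC by eexists.
  have [? _ _ ? _] := consts; have ? := normr_ge0 B; have ? := normr_ge0 (re z).
  have X0 : 0 <= X by rewrite XE; lra.
  exists X => // /VB h; have := le_trans (re_dist1 _ _) h; rewrite -[re 0]/(0 : R) subr0.
  have := Hr X X0; have := ler_norm (- re z); rewrite normrN => ? ?.
  have := ler_norm (re (H X)); have := ler_norm B.
  by clear h; lra.
have [||t [/andP[t0 tX] nVt Vt]] := @first_time (fun x => ~ V (H x)) 0 X X0.
- by [].
- move=> t tX' /contrapT Vt; have [r r0 rP] := Vo Vt; have [r' r'0 r'P] := Hc X t tX' r r0.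
  by exists r' => // s sX st; apply; apply: rP; exact: r'P.
have {}t0 : 0 < t.
  by rewrite lt_def t0 andbT; apply/eqP => E; apply: nVt; rewrite E H0.
have tt : 0 <= t <= X by rewrite ltW.
have e20 : 0 < e / 2 by lra.
have [r r0 rP] := Hc X t tt _ e20.
pose k := Num.min r t.
have k0 : 0 < k by rewrite lt_min r0.
have kr : k <= r by rewrite ge_min lexx.
have kt : k <= t by rewrite ge_min lexx orbT.
pose s := t - k / 2; have s0 : 0 < s by rewrite /s; lra.
have st : s < t by rewrite /s; lra.
have close : dist1 (H s) (H t) < e / 2.
  apply: rP; first by apply/andP; split; lra.
  by rewrite /s addrAC subrr add0r normrN ger0_norm; lra.
have Vs : V (H s) by apply: contrapT; apply: Vt => //; exact: ltW.
have [r1 r10 r1P] := Vo Vs.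
have [sH sHz _] := Hs s (ltW s0).
have aH : above (H s) by apply: (above_same az sH); exact: same_sym.
have ee : 0 < Num.min (e / 2) r1 by rewrite lt_min e20.
have eH : esc (H s) by move=> M; exact: He.
have [n' [z' [nn zc sz' strip [late tip]]]] := @move (H s) _ n.+1 (thr (K0 + j)) (above_stays aH) eH ee.
move: zc; rewrite lt_min => /andP[zc1 zc2].
exists n', z', (H t); split; split => //.
- exact: r1P.
- move=> i; have [lin|ni] := leqP i n'.
    apply: strip_keep (aH i); [exact: stays_cos|exact: stays_cos|].
    by rewrite distrC; exact: strip.
  by apply: le_trans (late i ni); apply: thr_mono; exact: leq_addr.
- by split => //; have := dist1_tri z' (H s) (H t); lra.
- move=> i lin; apply: (@strip_trans _ _ (im (F i (H s)))); rewrite ?stays_cos//.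
  exact: strip.
Qed.

(** Later points share the strips of [z j] up to time [n j.+1], and so does the cluster point [zs];
    bounds valid for all late [z k] pass to it. If some [x] were slower than [F N zs] with the same
    code, it would lag behind a late [z k.+1] by [KK - 1], and by [gap_step] still at time [n k.+1],
    where only [CC + 2] is possible. *)
Theorem exit_point z0 : V z0 -> above z0 -> exists z, [/\ stays M1 z, esc z, minimal z, ~ V z &
  forall e, 0 < e -> exists2 w, V w & dist1 w z < e].
Proof.
move=> V0 a0; have p4 := @pi_le4 R; have [A0 _ _ CE [KE ME M1E]] := consts.
pose Q (j : nat) (u v : C * nat) := V u.1 -> above u.1 ->
  [/\ V v.1, above v.1, (u.2 < v.2)%N & exists2 p, ~ V p & dist1 v.1 p < 1 / 2 ^+ j] /\
  [/\ forall i, (i <= v.2)%N -> `|im (F i v.1) - im (F i u.1)| < pi,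
     forall i, (v.2 < i)%N -> thr (K0 + j) <= im (F i v.1) &
     forall w, `|im (f w) - im (F v.2.+1 v.1)| <= 8 -> re (F v.2 v.1) - CC - 2 <= re w].
have /choice[S SP] : forall ju : nat * (C * nat), exists v, Q ju.1 ju.2 v.
  move=> [j [z n]]; have [[Vz az]|nVa] := pselect (V z /\ above z); last first.
    by exists (z, n) => /= Vz az; case: nVa.
  have e0 : 0 < 1 / 2 ^+ j :> R by rewrite divr_gt0// exprn_gt0.
  have [n' [z' [p [[h1 h2 h3 [h4 h5]] h6]]]] := tail_exit j n Vz az e0.
  by exists (z', n') => /= _ _; split => //; split => //; exists p.
pose u := fix u j := if j is k.+1 then S (k, u k) else (z0, 0%N).
pose z j := (u j).1; pose n j := (u j).2.
have uP j : V (z j) /\ above (z j).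
  by elim: j => [//|j [Vj aj]]; have [[? ?]] := SP (j, u j) Vj aj.
have uQ j : Q j (u j) (u j.+1) := SP (j, u j).
have uS j := uQ j (uP j).1 (uP j).2.
have nS j : (n j < n j.+1)%N by have [[_ _ h _] _] := uS j.
have nge j : (j <= n j)%N by elim: j => // j IH; exact: leq_ltn_trans IH (nS j).
have nmono j k : (j <= k)%N -> (n j <= n k)%N.
  by move=> /subnK <-; elim: (k - j)%N => // i IH; apply: leq_trans IH (ltnW (nS _)).
have sz j : stays MM (z j) by exact: stays_M1_MM (above_stays (uP j).2).
have strip j i : (i <= n j.+1)%N -> `|im (F i (z j.+1)) - im (F i (z j))| < pi.
  by have [_ [h _ _]] := uS j; exact: h.
have strips j k i : (j <= k)%N -> (i <= n j.+1)%N -> `|im (F i (z k)) - im (F i (z j))| < pi.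
  move=> jk ij; rewrite -(subnK jk); elim: (k - j)%N => [|l IH].
    by rewrite subrr normr0 pi_gt0.
  rewrite addSn; apply: strip_trans IH; rewrite ?stays_cos//.
  by apply: strip; apply: leq_trans ij _; apply: nmono; rewrite ltnS leq_addl.
have high j k i : (j < k)%N -> (n j.+1 < i)%N -> thr (K0 + j) <= im (F i (z k)).
  move=> jk ni; rewrite -(subnK jk); elim: (k - j.+1)%N => [|l IH].
    by have [_ [_ h _]] := uS j; exact: h.
  rewrite addSn; have [il|li] := leqP i (n (l + j.+1).+1).
    apply: strip_keep IH; rewrite ?stays_cos// distrC; exact: strip.
  have [_ [_ h _]] := uS (l + j.+1)%N; apply: le_trans (h i li); apply: thr_mono.
  by rewrite leq_add2l; apply: leq_trans (leq_addl _ _); exact: leqnSn.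
have [zs zsP] := @plane_cluster z B (fun j => VB (uP j).1).
have near i e : 0 < e -> forall N, exists2 k, (N <= k)%N & dist1 (F i (z k)) (F i zs) < e.
  move=> e0 N; have [r r0 rP] := @contC_F i zs e e0.
  by have [k Nk kr] := zsP r r0 N; exists k => //; exact: rP.
have limit (l : R) i (N : nat) : (forall k, (N <= k)%N -> l <= im (F i (z k))) -> l <= im (F i zs).
  move=> h; rewrite leNgt; apply/negP => hl.
  have e0 : 0 < l - im (F i zs) by lra.
  have [k Nk kr] := near i _ e0 N; have := h k Nk.
  by have := le_lt_trans (im_dist1 _ _) kr; rewrite ltr_norml => /andP[_ j]; move=> j1; lra_from j j1.
have azs : above zs by move=> i; apply: (limit _ i 0%N) => k _; exact: (uP k).2.
have szs := stays_M1_MM (above_stays azs).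
have szstrip j i : (i <= n j.+1)%N -> `|im (F i zs) - im (F i (z j))| < pi.
  move=> ij; apply: strip_neq_pi; rewrite ?stays_cos//.
  rewrite leNgt; apply/negP => h.
  have e0 : 0 < `|im (F i zs) - im (F i (z j))| - pi by lra.
  have [k jk kr] := near i _ e0 j; have h1 := strips j k i jk ij.
  have := le_lt_trans (im_dist1 _ _) kr.
  have := ler_distD (im (F i (z k))) (im (F i zs)) (im (F i (z j))).
  by rewrite (distrC (im (F i zs)) (im (F i (z k)))) => j1 j2; lra_from h1 j1 j2.
exists zs; split.
- exact: above_stays.
- move=> M; have [k0 k0P] := thr_large (expR M + Aa).
  exists (n k0.+1) => i ni.
  have h : thr (K0 + k0) <= im (F i.+1 zs).
    by apply: (limit _ _ k0.+1) => k kk; apply: high.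
  have h1 := k0P (K0 + k0)%N (leq_addl _ _); have /andP[_ ia2] := im_a_bound.
  have h2 : expR M <= im (f (F i zs)) - im a by rewrite -iterS; lra_from h h1 ia2.
  by have := modulus_ge_im (expR_ge0 _) h2; rewrite ler_expR.
- move=> N x sx xs [k0 k0P].
  have one : (0 : R) < 1 by [].
  have [[//|k] kk kd] := near (k0 + N)%N 1 one (k0 + N).+1.
  have {kd} start : re (F k0 x) + (KK - 1) <= re (F (k0 + N)%N (z k.+1)).
    have := k0P k0 (leqnn _); rewrite -F_add.
    by have := le_lt_trans (re_dist1 _ _) kd; rewrite ltr_norml => /andP[j1 _] j3; lra_from j1 j3.
  have kn : (k0 + N <= n k.+1)%N by apply: leq_trans (nge k.+1); exact: ltnW.
  (* Strips are shared up to [n k.+2], thus also one step after [n k.+1], where [tip] compares the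
     images. *)
  have ims i : (i + N <= n k.+2)%N -> `|im (F i x) - im (F (i + N)%N (z k.+1))| <= 8.
    move=> ik; have h1 := szstrip k.+1 _ ik; have h2 := xs i; rewrite -F_add in h2.
    by have j := ler_distD (im (F (i + N)%N zs)) (im (F i x)) (im (F (i + N)%N (z k.+1))); lra_from j h1 h2 p4.
  have prop i : (k0 + i + N <= n k.+1)%N -> re (F (k0 + i)%N x) + (KK - 1) <= re (F (k0 + i + N)%N (z k.+1)).
    elim: i => [|i IH]; first by rewrite addn0.
    rewrite addnS addSn => h; have {}IH := IH (ltnW h).
    have := @gap_step (F (k0 + i)%N x) (F (k0 + i + N)%N (z k.+1)) (sx (k0 + i).+1) (sz k.+1 (k0 + i + N).+1).
    move=> g; have := g _ _; rewrite -!iterS.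
    have h8 : `|im (F (k0 + i).+1 x) - im (F (k0 + i + N).+1 (z k.+1))| <= 20.
      have := ims (k0 + i).+1; rewrite addSn => /(_ (leq_trans h (ltnW (nS k.+1)))) => j; lra_from j.
    by move=> /(_ h8) g'; have := g' _; lra.
  pose i := (n k.+1 - (k0 + N))%N.
  have iE : (k0 + i + N = n k.+1)%N by rewrite /i; lia.
  have P1 := prop i; rewrite iE in P1; have {}P1 := P1 (leqnn _).
  have [_ [_ _ tip]] := uS k.
  have := tip (F (k0 + i)%N x); rewrite -/(z k.+1) -/(n k.+1).
  have := ims (k0 + i).+1; rewrite addSn iE => /(_ (nS k.+1)) h8.
  by rewrite -iterS => /(_ h8); lra.
- move=> Vs; have [r r0 rP] := Vo Vs.
  have r20 : 0 < r / 2 by lra.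
  have [N NP] := half_pow_small ltr01 r20.
  have [[//|k] kk kd] := zsP _ r20 N.+1.
  have [[_ _ _ [p np pd]] _] := uS k.
  apply: np; apply: rP; have := dist1_tri p (z k.+1) zs; rewrite (dist1C p (z k.+1)).
  by have := NP k kk; rewrite -/(z k.+1) in pd; lra.
- move=> e e0; have [k _ kd] := zsP e e0 0%N; exists (z k) => //; exact: (uP k).1.
Qed.

End Exit.
End Threshold.

(** * Escaping endpoints *)

(* Arcs are reparametrised to [[0, 1]], the point [1 / 2] standing for [0 \in [-1, 1]]. *)
Definition hair_at z := exists g, [/\ contp g 0 1, inj_on g 0 1,
  forall t, 0 <= t <= 1 -> esc (g t) & g (1 / 2) = z].

Definition epoint z := [/\ esc z, ~ hair_at z & exists g, [/\ contp g 0 1, inj_on g 0 1,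
  g 0 = z & forall t, 0 <= t <= 1 -> esc (g t)]].

(** Some iterate of the arc is a path with one code, on which the midpoint is strictly slowest. The
    slower of the two ends would then be passed again between the midpoint and the other end. *)
Lemma minimal_not_hair z : minimal z -> ~ hair_at z.
Proof.
move=> mz [g [cg ig eg gz]]; have [N st] := arc_uniform cg ig eg.
have i0 : 0 <= (0 : R) <= 1 by rewrite lexx ler01.
have i1 : 0 <= (1 : R) <= 1 by rewrite lexx ler01.
have h0 : 0 <= (1 / 2 : R) by lra. have h1 : (1 / 2 : R) <= 1 by lra.
have ih : 0 <= (1 / 2 : R) <= 1 by rewrite h0.
pose G t := F N (g t).
have cG : contp G 0 1 by exact: contp_F.
have iG : inj_on G 0 1 := path_F_inj cg ig st (n := N).
have sG s t := path_same_all (s := s) (t := t) cG st.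
have fast s : 0 <= s <= 1 -> s <> 1 / 2 -> slower (G (1 / 2)) (G s).
  move=> si ns; have [h|//|h] := stays_trichotomy (st s si) (st _ ih) (sG _ _ si ih).
    by case: (mz N (G s) (st s si)); rewrite -gz; [exact: sG|exact: h].
  by case: ns; exact: iG.
have f0 : slower (G (1 / 2)) (G 0) by apply: fast => //; lra.
have f1 : slower (G (1 / 2)) (G 1) by apply: fast => //; lra.
have [h|h|h] := stays_trichotomy (st _ i0) (st _ i1) (sG _ _ i0 i1).
- have [|||||s /andP[s0 s1] E] := @path_hits G (1 / 2) 1 (G 0) h1.
  + exact: contp_sub h0 (lexx 1) cG.
  + by move=> t tP; apply: st; exact: itv_sub tP.
  + exact: st.
  + exact: sG.
  + by left.
  by have := iG s 0 (itv_sub h0 (lexx 1) (introT andP (conj s0 s1))) i0 E; lra.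
- have [|||||s /andP[s0 s1] E] := @path_hits G 0 (1 / 2) (G 1) h0.
  + exact: contp_sub (lexx 0) h1 cG.
  + by move=> t tP; apply: st; exact: itv_sub tP.
  + exact: st.
  + exact: sG.
  + by right.
  by have := iG s 1 (itv_sub (lexx 0) h1 (introT andP (conj s0 s1))) i1 E; lra.
- by have := iG 0 1 i0 i1 h; lra.
Qed.

Lemma minimal_epoint z : stays M1 z -> esc z -> minimal z -> epoint z.
Proof.
move=> sz ez mz; split => //; first exact: minimal_not_hair.
have [H [H0 Hs Hc Hsl [Hr He]]] := tail sz.
exists H; split => //.
- move=> s t /andP[s0 _] /andP[t0 _] E; have [st|ts|//] := ltgtP s t.
    by have := Hsl s t s0 st; rewrite E => h; case: (slower_asym h h).
  by have := Hsl t s t0 ts; rewrite E => h; case: (slower_asym h h).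
- move=> t /andP[]; rewrite le_eqVlt => /orP[/eqP <- _|t0 _]; first by rewrite H0.
  by move=> B; exact: He.
Qed.

(** One coordinate of [f y - a] is at least half of its modulus, and the perturbation takes away at
    most a quarter. *)
Lemma modulus_near (y v : C) : dist1 v (f y) <= expR (re y) / 4 ->
  (expR (re y) / 4) ^+ 2 <= (re v - re a) ^+ 2 + (im v - im a) ^+ 2.
Proof.
have := modulus_f y; rewrite /dist1; have := expR_gt0 (re y).
have -> : re v - re a = (re v - re (f y)) + (re (f y) - re a) by ring.
have -> : im v - im a = (im v - im (f y)) + (im (f y) - im a) by ring.
move: (expR (re y)) (re v - re (f y)) (re (f y) - re a) (im v - im (f y)) (im (f y) - im a).
move=> E p q s t E0 Eq h; have := ler_norm p; have := ler_norm (- p).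
have := ler_norm s; have := ler_norm (- s); rewrite !normrN.
move: h; move: `|p| `|s| => P S h *.
have sq (x x' : R) : - (E / 4) <= x -> x <= E / 4 -> E / 2 <= `|x'| -> (E / 4) ^+ 2 <= (x + x') ^+ 2.
  move=> h1 h2 h3; rewrite -[leRHS]real_normK ?num_real// ler_pXn2r ?nnegrE//; last first.
    by rewrite divr_ge0// ltW.
  have := ler_normD (x + x') (- x); rewrite addrAC subrr add0r normrN.
  have : `|x| <= E / 4 by rewrite ler_norml h1.
  lra.
have [hq|hq] := le_or_lt (E / 2) `|q|.
  have := sqr_ge0 (s + t); have := sq p q _ _ hq.
  by move=> /(_ _ _) h1; have := h1 ltac:(lra) ltac:(lra); lra.
have [ht|ht] := le_or_lt (E / 2) `|t|.
  have := sqr_ge0 (p + q); have := sq s t _ _ ht.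
  by move=> /(_ _ _) h1; have := h1 ltac:(lra) ltac:(lra); lra.
have q2 : `|q| ^+ 2 <= (E / 2) ^+ 2 by rewrite ler_pXn2r ?nnegrE// ?divr_ge0// ltW.
have t2 : `|t| ^+ 2 <= (E / 2) ^+ 2 by rewrite ler_pXn2r ?nnegrE// ?divr_ge0// ltW.
rewrite !real_normK ?num_real// in q2 t2; nra.
Qed.

(** A Lipschitz branch of the inverse of [f] near [f y]. The bound [m] on [r] keeps away from [a];
    the bound [pi / 2 / k] brings any two lifts within [pi] in height, so that [exp_expansion]
    compares them. *)
Lemma local_lift (y : C) : exists (r k : R) (L : C -> C), [/\ 0 < r, 0 < k,
  forall v, dist1 v (f y) < r -> f (L v) = v /\ dist1 (L v) y <= k * dist1 v (f y) &
  forall v v', dist1 v (f y) < r -> dist1 v' (f y) < r -> dist1 (L v) (L v') <= k * dist1 v v'].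
Proof.
have p0 := @pi_gt0 R; pose E := expR (re y); have E0 : 0 < E by exact: expR_gt0.
have /choice[L LP] : forall v, exists z, v <> a -> f z = v /\ `|im z - im y| <= pi.
  move=> v; have [->|va] := pselect (v = a); first by exists 0.
  by have [z zP] := lift_exists (im y) va; exists z.
pose m := E / 4; have m0 : 0 < m by rewrite divr_gt0.
pose k := 5 / m; have k0 : 0 < k by rewrite divr_gt0.
pose r := Num.min m (pi / 2 / k).
have r0 : 0 < r by rewrite lt_min m0 !divr_gt0.
have rm : r <= m by rewrite ge_min lexx.
have rk : k * r <= pi / 2 by rewrite mulrC -ler_pdivlMr// ge_min lexx orbT.
have big v : dist1 v (f y) < r -> f (L v) = v /\ `|im (L v) - im y| <= pi /\ m <= expR (re (L v)).
  move=> vr; have h : dist1 v (f y) <= E / 4 by exact: le_trans (ltW vr) rm.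
  have {}h := modulus_near h.
  have va : v <> a.
    move=> va; move: h; rewrite va !subrr expr0n /= addr0.
    by rewrite leNgt exprn_gt0.
  have [fL imL] := LP v va; split => //; split => //.
  rewrite -(ler_pXn2r (ltn0Sn 1)) ?nnegrE ?expR_ge0 ?(ltW m0)//.
  by rewrite -(modulus_f) fL.
have lip z z' : `|im z - im z'| <= pi -> m <= expR (re z) -> m <= expR (re z') ->
    dist1 z z' <= k * dist1 (f z) (f z').
  move=> h1 h2 h3; have h := exp_expansion m0 h1 h2 h3.
  by rewrite /k mulrAC ler_pdivlMr// mulrC.
have mE : m <= expR (re y) by rewrite /m -/E; lra.
have near v : dist1 v (f y) < r -> f (L v) = v /\ dist1 (L v) y <= k * dist1 v (f y).
  move=> vr; have [h1 [h2 h3]] := big v vr; split => //.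
  by rewrite -[in leRHS]h1; exact: lip.
exists r, k, L; split => // v v' vr v'r.
have [h1 [h2 h3]] := big v vr; have [h1' [h2' h3']] := big v' v'r.
rewrite -{2}h1 -{2}h1'; apply: lip => //.
have half w : dist1 w (f y) < r -> `|im (L w) - im y| <= pi / 2.
  move=> wr; have [_ h] := near w wr; apply: le_trans (im_dist1 _ _) _.
  apply: le_trans h _; apply: le_trans rk; apply: ler_wpM2l; exact: ltW.
have := half v vr; have := half v' v'r.
have := ler_distD (im y) (im (L v)) (im (L v')); rewrite (distrC (im y)); lra.
Qed.

Definition is_open (V : C -> Prop) := forall z, V z ->
  exists2 r : R, 0 < r & forall w, dist1 w z < r -> V w.

Definition imF (n : nat) (V : C -> Prop) : C -> Prop := fun w => exists2 z, V z & F n z = w.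

Lemma imF_open n V : is_open V -> is_open (imF n V).
Proof.
move=> Vo; elim: n => [|n IH] w.
  move=> [z Vz <-]; have [r r0 rP] := Vo z Vz; exists r => // v vr.
  by exists v => //; exact: rP.
move=> [z Vz <-]; have [|r r0 rP] := IH (F n z); first by exists z.
have [r' [k [L [r'0 k0 LP _]]]] := local_lift (F n z).
exists (Num.min r' (r / k)); first by rewrite lt_min r'0 divr_gt0.
move=> v; rewrite lt_min iterS => /andP[vr' vr]; have [fL Ld] := LP v vr'.
have [|x Vx xE] := rP (L v); last by exists x => //; rewrite iterS xE.
by apply: le_lt_trans Ld _; rewrite mulrC -ltr_pdivlMr.
Qed.

Lemma F_bounded n (B : R) : exists B', forall z, dist1 z 0 <= B -> dist1 (F n z) 0 <= B'.
Proof.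
elim: n => [|n [B' IH]]; first by exists B.
exists (2 * expR B' + Aa) => z /IH h; rewrite iterS.
have h' : re (F n z) <= B'.
  have := le_trans (re_dist1 _ _) h; rewrite -[re 0]/(0 : R) subr0; exact: le_trans (ler_norm _).
rewrite /dist1 -[re 0]/(0 : R) -[im 0]/(0 : R) !subr0 re_f im_f /Aa.
have e0 : expR (re (F n z)) <= expR B' by rewrite ler_expR.
have b (x c : R) : `|x| <= 1 -> `|expR (re (F n z)) * x + c| <= expR B' + `|c|.
  move=> x1; apply: le_trans (ler_normD _ _) _; rewrite lerD2r normrM.
  rewrite (ger0_norm (expR_ge0 _)); apply: le_trans e0.
  by rewrite -[leRHS]mulr1 ler_wpM2l ?expR_ge0.
have c1 := b _ (re a) (cos_max (im (F n z))); have s1 := b _ (im a) (sin_max (im (F n z))).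
lra.
Qed.

Lemma esc_back (y : C) : esc (f y) -> esc y.
Proof.
move=> ey B; have [N NP] := ey B; exists N.+1 => -[//|n] nN.
by rewrite F_S; exact: NP.
Qed.

(** [f] need not be injective along the arc, so only a short piece around its midpoint is pushed
    forward. *)
Lemma hair_push (y : C) : hair_at y -> hair_at (f y).
Proof.
move=> [g [cg ig eg gy]].
have ih : 0 <= (1 / 2 : R) <= 1 by apply/andP; split; lra.
have [r r0 rP] := @F_loc_inj 1 (g (1 / 2)).
have [r1 r10 r1P] := cg _ ih r r0.
pose k := Num.min 1 r1.
have k0 : 0 < k by rewrite lt_min ltr01.
have k1 : k <= 1 by rewrite ge_min lexx.
have kr : k <= r1 by rewrite ge_min lexx orbT.
have on t : 0 <= t <= 1 -> 0 <= (1 - k) / 2 + k * t <= 1 /\ `|(1 - k) / 2 + k * t - 1 / 2| < r1.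
  move=> /andP[t0 t1]; split; first by apply/andP; split; nra.
  by rewrite ltr_norml; apply/andP; split; nra.
exists (fun t => F 1 (g ((1 - k) / 2 + k * t))); split.
- by apply: contp_F; apply: contp_affine cg _ => t /on[].
- move=> s t /on[si sr] /on[ti tr] E; apply: (mulfI (lt0r_neq0 k0)).
  apply: (addrI ((1 - k) / 2)); apply: ig => //.
  by apply: rP E; exact: r1P.
- by move=> t /on[/eg ? _]; exact: esc_F.
- have -> : (1 - k) / 2 + k * (1 / 2) = 1 / 2 by field.
  by rewrite gy.
Qed.

Lemma epoint_back (y : C) : epoint (f y) -> epoint y.
Proof.
move=> [ey nh [g [cg ig gy eg]]]; split; first exact: esc_back.
  by move=> /hair_push.
have [r [l [L [r0 l0 LP Ll]]]] := local_lift y.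
have i0 : 0 <= (0 : R) <= 1 by rewrite lexx ler01.
have [r1 r10 r1P] := cg 0 i0 r r0; rewrite gy in r1P.
pose k := Num.min 1 (r1 / 2).
have k0 : 0 < k by rewrite lt_min ltr01 divr_gt0.
have k1 : k <= 1 by rewrite ge_min lexx.
have kr : k <= r1 / 2 by rewrite ge_min lexx orbT.
have on t : 0 <= t <= 1 -> 0 <= 0 + k * t <= 1 /\ dist1 (g (0 + k * t)) (f y) < r.
  move=> /andP[t0 t1]; have h : 0 <= 0 + k * t <= 1 by apply/andP; split; nra.
  by split => //; apply: r1P => //; rewrite subr0 ltr_norml; apply/andP; split; nra.
have cg' : contp (fun t => g (0 + k * t)) 0 1 by apply: contp_affine cg _ => t /on[].
exists (fun t => L (g (0 + k * t))); split.
- move=> t ti e e0; have el : 0 < e / l by rewrite divr_gt0.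
  have [r2 r20 r2P] := cg' t ti _ el; exists r2 => // s si st.
  apply: le_lt_trans (Ll _ _ (on s si).2 (on t ti).2) _.
  by rewrite mulrC -ltr_pdivlMr//; exact: r2P.
- move=> s t si ti E; apply: (mulfI (lt0r_neq0 k0)); apply: (addrI 0).
  have [h _] := LP _ (on s si).2; have [h' _] := LP _ (on t ti).2.
  by apply: ig; [exact: (on s si).1|exact: (on t ti).1|rewrite -h -h' E].
- rewrite mulr0 addr0 gy; apply: dist1_eq0.
  by have := LP (f y); rewrite dist1_xx mulr0 => /(_ r0)[].
- move=> t ti; have [h _] := LP _ (on t ti).2; apply: esc_back; rewrite h; apply: eg.
  exact: (on t ti).1.
Qed.

Lemma epoint_backF n (y : C) : epoint (F n y) -> epoint y.
Proof. by elim: n => // n IH /epoint_back. Qed.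

(** The orbit of [z0] need not stay high, so [move] replaces it inside the open set [imF N0 U] by
    one that does from time [n.+1] on. The boundary point [z] is found for [imF m U] and pulled back
    by compactness: a cluster point of preimages in [U] of points tending to [z] is mapped to [z],
    and it is outside [U] since [z] is outside the image. *)
Theorem boundary_epoint (U : C -> Prop) (B : R) z0 : is_open U ->
  (forall z, U z -> dist1 z 0 <= B) -> U z0 -> epoint z0 ->
  exists z, [/\ epoint z, ~ U z & forall e, 0 < e -> exists2 w, U w & dist1 w z < e].
Proof.
move=> Uo UB U0 [e0 _ _].
have [N0 N0P] := esc_stays M1 e0; have s0 := N0P N0 (leqnn N0).
have [K0 K0P] := thr_large (expR M1 + Aa).
have [|r r0 rP] := imF_open (n := N0) Uo (z := F N0 z0); first by exists z0.
have [n [z' [_ zr _ _ [late _]]]] := move 0%N (thr K0) s0 (esc_F N0 e0) r0.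
have [x Ux xz] := rP z' zr.
pose m := (n.+1 + N0)%N.
have Vx : imF m U (F m x) by exists x.
have ax : above K0 (F m x).
  move=> i; rewrite /m F_add xz -F_add; apply: late; exact: leq_addl.
have [B' B'P] := F_bounded m B.
have VB z : imF m U z -> dist1 z 0 <= B' by move=> [w Uw <-]; apply: B'P; exact: UB.
have [z [sz ez mz nVz cz]] := exit_point (K0P K0 (leqnn K0)) (imF_open Uo) VB Vx ax.
have /choice[u uP] : forall k : nat, exists w, U w /\ dist1 (F m w) z < 1 / 2 ^+ k.
  move=> k; have [|_ [w Uw <-] h] := cz (1 / 2 ^+ k); last by exists w.
  by rewrite divr_gt0// exprn_gt0.
have [us usP] := @plane_cluster u B (fun k => UB _ (uP k).1).
have usz : F m us = z.
  apply: dist1_small => e e0'; have e20 : 0 < e / 2 by lra.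
  have [r1 r10 r1P] := @contC_F m us _ e20.
  have [N NP] := half_pow_small ltr01 e20.
  have [k Nk kr] := usP r1 r10 N; have := r1P _ kr; have := NP k Nk; have [_ h] := uP k.
  by have := dist1_tri (F m us) (F m (u k)) z; rewrite (dist1C (F m us) (F m (u k))); lra.
exists us; split.
- by apply: (@epoint_backF m); rewrite usz; exact: minimal_epoint.
- by move=> Uus; apply: nVz; rewrite -usz; exists us.
- by move=> e e0'; have [k _ kr] := usP e e0' 0%N; exists (u k) => //; exact: (uP k).1.
Qed.

(** * Topology *)

Lemma nbhs_dist1 z (A : set C) : nbhs z A <-> exists2 r : R, 0 < r & forall w, dist1 w z < r -> A w.
Proof.
have nrm w : `|z - w| = (Num.sqrt ((re z - re w) ^+ 2 + (im z - im w) ^+ 2))%:C%C.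
  by rewrite normc_def /= raddfB raddfB.
split=> [/nbhs_ballP[e /= e0 eA]|[r r0 rA]].
  move: e0; rewrite ltcE /= => /andP[/eqP ei er].
  exists (re e) => // w wz; apply: eA; rewrite -ball_normE /ball_ /= nrm ltcE /= -ei eqxx /=.
  apply: le_lt_trans wz; rewrite -(ger0_norm (dist1_ge0 w z)) -sqrtr_sqr ler_sqrt ?sqr_ge0//.
  rewrite dist1C /dist1 [leRHS]sqrrD !real_normK ?num_real//.
  have : 0 <= `|re z - re w| * `|im z - im w| by rewrite mulr_ge0.
  by rewrite mulr2n; lra.
apply/nbhs_ballP; exists (r / 2)%:C%C => /=; first by rewrite ltcE /= eqxx divr_gt0.
move=> w; rewrite -ball_normE /ball_ /= nrm ltcE /= eqxx /= => h; apply: rA.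
have h1 : `|re z - re w| < r / 2.
  apply: le_lt_trans h; rewrite -sqrtr_sqr ler_sqrt ?addr_ge0 ?sqr_ge0//.
  by rewrite lerDl sqr_ge0.
have h2 : `|im z - im w| < r / 2.
  apply: le_lt_trans h; rewrite -sqrtr_sqr ler_sqrt ?addr_ge0 ?sqr_ge0//.
  by rewrite lerDr sqr_ge0.
by rewrite dist1C /dist1; lra.
Qed.

Lemma within_contp s t g : {within `[s, t], continuous g} <-> contp g s t.
Proof.
split=> [/subspace_continuousP cg x xst e e0|cg].
  have /cg/(_ [set w | dist1 w (g x) < e]) : `[s, t]%classic x by rewrite /= in_itv.
  have : nbhs (g x) [set w | dist1 w (g x) < e] by apply/nbhs_dist1; exists e.
  move=> nx /(_ nx)/nbhs_ballP[r /= r0 rP]; exists r => // y yst yx.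
  by apply: rP; rewrite /= ?in_itv// -ball_normE /ball_ /= distrC.
apply/subspace_continuousP => x /=; rewrite in_itv /= => xst A /nbhs_dist1[e e0 eA].
have [r r0 rP] := cg x xst e e0; apply/nbhs_ballP; exists r => // y.
rewrite -ball_normE /ball_ /= distrC => yx; rewrite in_itv /= => yst.
by apply: eA; exact: rP.
Qed.

Lemma re_continuous : continuous (fun z : C => re z).
Proof.
move=> z A /nbhs_ballP[e /= e0 eA]; apply/nbhs_dist1; exists e => // w wz; apply: eA.
by rewrite -ball_normE /ball_ /= distrC; apply: le_lt_trans wz; exact: re_dist1.
Qed.

Lemma im_continuous : continuous (fun z : C => im z).
Proof.
move=> z A /nbhs_ballP[e /= e0 eA]; apply/nbhs_dist1; exists e => // w wz; apply: eA.
by rewrite -ball_normE /ball_ /= distrC; apply: le_lt_trans wz; exact: im_dist1.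
Qed.

Lemma box_compact (B : R) : compact [set z : C | `|re z| <= B /\ `|im z| <= B].
Proof.
pose h (p : R * R) : C := Complex p.1 p.2.
have ch : continuous h.
  move=> [x y] A /nbhs_dist1[r r0 rA]; have r20 : 0 < r / 2 by rewrite divr_gt0.
  exists (ball x (r / 2), ball y (r / 2)); first by split; exact: nbhsx_ballx.
  move=> [x' y'] /= [bx by']; apply: rA; rewrite /dist1 !ReC !ImC /=.
  have /= := bx; have /= := by'; rewrite -!ball_normE /ball_ /= => h1 h2.
  by rewrite (distrC x') (distrC y'); lra.
have -> : [set z : C | `|re z| <= B /\ `|im z| <= B] = h @` (`[- B, B] `*` `[- B, B]).
  apply/seteqP; split=> [z /= [h1 h2]|_ [[x y] /= [h1 h2] <-]].
    by exists (re z, im z); [split; rewrite /= in_itv /= -ler_norml|exact: cplane_eq].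
  by rewrite !in_itv /= -!ler_norml in h1 h2; split.
apply: continuous_compact; last by apply: compact_setX; exact: segment_compact.
exact: continuous_subspaceT.
Qed.

Lemma plane_hausdorff : hausdorff_space C.
Proof. exact: norm_hausdorff. Qed.

Lemma compact_bound (K : set C) : compact K -> exists B : R, forall z, K z -> dist1 z 0 <= B.
Proof.
move=> cK; have bd (T : C -> R) : continuous T -> exists B : R, forall z, K z -> `|T z| <= B.
  move=> cT; have : compact (T @` K).
    by apply: continuous_compact cK; exact: continuous_subspaceT.
  move=> /compact_bounded[M [_ MP]]; exists (`|M| + 1) => z Kz; apply: MP; last by exists z.
  by rewrite (le_lt_trans (ler_norm _))// ltrDl.
have [B1 P1] := bd _ re_continuous; have [B2 P2] := bd _ im_continuous.
exists (B1 + B2) => z Kz; rewrite /dist1 -[re 0]/(0 : R) -[im 0]/(0 : R) !subr0.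
by apply: lerD; [exact: P1|exact: P2].
Qed.

(** The distance of [F n.+1 z] to [a] is the exponential of [re (F n z)], so leaving a large box at
    time [n.+1] makes the real part large at time [n]. *)
Lemma escP z : escaping_set a z <-> esc z.
Proof.
split=> [ez B|ez A].
  have [A0 ra ia _ _] := consts; have e0 := expR_gt0 B.
  pose M := expR B + Aa; pose K := [set z : C | `|re z| <= M /\ `|im z| <= M].
  have cK : compact K by exact: box_compact.
  have := ez ((Some @` (~` K)) `|` [set None]).
  have nK : nbhs (None : riemann_sphere R) ((Some @` (~` K)) `|` [set None]).
    by exists K => //; split => //; exact: compact_closed plane_hausdorff cK.
  move=> /(_ nK)[N _ NP]; exists N => n Nn.
  have := NP n.+1 (leqW Nn); case=> [[w nKw [wE]]|//].
  have big : M < `|re (F n.+1 z)| \/ M < `|im (F n.+1 z)|.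
    have [h1|h1] := le_or_lt `|re (F n.+1 z)| M; last by left.
    have [h2|h2] := le_or_lt `|im (F n.+1 z)| M; last by right.
    by case: nKw; rewrite wE.
  have m := modulus_f (F n z); rewrite -iterS in m.
  have far x c : `|c| <= Aa -> M < `|x| -> expR B ^+ 2 <= (x - c) ^+ 2.
    move=> ca Mx; rewrite -[leRHS]real_normK ?num_real// ler_pXn2r ?nnegrE ?expR_ge0//.
    have := lerB_dist x c; rewrite /M in Mx; lra.
  rewrite -ler_expR -(ler_pXn2r (ltn0Sn 1)) ?nnegrE ?expR_ge0// -m.
  case: big => h.
    by apply: le_trans (far _ _ ra h) _; rewrite lerDl sqr_ge0.
  by apply: le_trans (far _ _ ia h) _; rewrite lerDr sqr_ge0.
move=> [K [cK _] KA]; have [B BP] := compact_bound cK; have [N NP] := ez (B + 1).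
exists N => // n /= Nn; apply: KA; left; exists (F n z) => // /BP h.
have := le_trans (re_dist1 _ _) h; rewrite -[re 0]/(0 : R) subr0.
by have := ler_norm (re (F n z)); have := NP n Nn; clear h; lra.
Qed.

Lemma arcP s t g : is_arc s t g <-> contp g s t /\ inj_on g s t.
Proof.
rewrite /is_arc within_contp; by split=> -[cg ig]; split.
Qed.

Lemma hairP z : on_hair a z <-> hair_at z.
Proof.
have p2 : (2 : R) != 0 by []. have ph : (1 / 2 : R) != 0 by rewrite gt_eqF// divr_gt0.
split=> [[g [/arcP[cg ig] eg gz]]|[g [cg ig eg gz]]].
  have on t : 0 <= t <= 1 -> - 1 <= - 1 + 2 * t <= 1.
    by move=> /andP[? ?]; apply/andP; split; lra.
  exists (fun t => g (- 1 + 2 * t)); split.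
  - exact: contp_affine cg on.
  - exact: inj_affine p2 ig on.
  - by move=> t /on ti; apply/escP; apply: eg; exists (- 1 + 2 * t) => //=; rewrite in_itv.
  - by rewrite -gz; congr g; field.
have on t : - 1 <= t <= 1 -> 0 <= 1 / 2 + 1 / 2 * t <= 1.
  by move=> /andP[? ?]; apply/andP; split; lra.
exists (fun t => g (1 / 2 + 1 / 2 * t)); split.
- by apply/arcP; split; [exact: contp_affine cg on|exact: inj_affine ph ig on].
- by move=> _ [t ti <-]; move: ti; rewrite /= in_itv /= => /on ti; apply/escP; exact: eg.
- by rewrite mulr0 addr0.
Qed.

Lemma epointP z : escaping_endpoints a z <-> epoint z.
Proof.
split=> [[[nh [g [/arcP[cg ig] gz eg]]] /escP ez]|[ez nh [g [cg ig gz eg]]]].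
  split => //; first by move=> /hairP.
  exists g; split => // t /andP[]; rewrite le_eqVlt => /orP[/eqP <- _|t0 t1].
    by rewrite gz.
  by apply/escP; apply: eg; exists t => //=; rewrite in_itv /= t0.
split; last exact/escP; split; first by move=> /hairP.
exists g; split => //; first exact/arcP.
move=> _ [t ti <-]; move: ti; rewrite /= in_itv /= => /andP[t0 t1].
by apply/escP; apply: eg; rewrite ltW.
Qed.

(* The union of half-sized balls around the points of [P] is open and bounded and has no
   escaping endpoint on its boundary. *)
Lemma separation_absurd (P Q : C -> Prop) (B : R) z0 :
  (forall z, epoint z <-> P z \/ Q z) -> P z0 -> (forall z, P z -> dist1 z 0 <= B) ->
  (forall z, P z -> exists2 r : R, 0 < r & forall w, dist1 w z < r -> ~ Q w) ->
  (forall z, Q z -> exists2 r : R, 0 < r & forall w, dist1 w z < r -> ~ P w) -> False.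
Proof.
move=> PQ P0 PB Pr Qr.
pose U z := exists p (r : R), [/\ P p, 0 < r, r <= 1, forall w, dist1 w p < r -> ~ Q w &
   dist1 z p < r / 2].
have PU z : P z -> U z.
  move=> Pz; have [r r0 rP] := Pr z Pz.
  have m0 : 0 < Num.min 1 r by rewrite lt_min ltr01.
  exists z, (Num.min 1 r); split => //; first by rewrite ge_min lexx.
    by move=> w; rewrite lt_min => /andP[_]; exact: rP.
  by rewrite dist1_xx divr_gt0.
have Uo : is_open U.
  move=> z [p [r [Pp r0 r1 rQ zp]]].
  have e0 : 0 < r / 2 - dist1 z p by lra.
  exists (r / 2 - dist1 z p) => // w wz; exists p, r; split => //.
  by have := dist1_tri w z p; lra.
have UB z : U z -> dist1 z 0 <= B + 1.
  by move=> [p [r [/PB Pp r0 r1 _ zp]]]; have := dist1_tri z p 0; lra.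
have e0 : epoint z0 by apply/PQ; left.
have [z [ez nUz cz]] := boundary_epoint Uo UB (PU _ P0) e0.
have [/PU //|Qz] := (PQ z).1 ez.
have [s s0 sP] := Qr z Qz; have s20 : 0 < s / 2 by rewrite divr_gt0.
have [w [p [r [Pp r0 r1 rQ wp]]] wz] := cz _ s20.
(* [z] is at distance at least [r] from [p], while [w] is within [r / 2] of [p] and [s / 2] of [z];
   the half-sized radii give [dist1 p z < s]. *)
have pz := dist1_tri p w z; rewrite (dist1C p w) in pz.
have rp : r <= dist1 z p by rewrite leNgt; apply/negP => /rQ.
rewrite dist1C in rp; by apply: (sP p) => //; lra.
Qed.

End Dynamics.

Theorem theorem1p4 (R : realType) (a : cplane R) :
  connected ((Some @` escaping_endpoints a) `|` [set None]
             : set (riemann_sphere R)).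
Proof.
apply/connectedP => E [E0 ES sep].
(* [b] is the piece containing infinity; the other piece avoids a neighbourhood of infinity and is
   therefore bounded. *)
have [b bN] : exists b, E b None.
  have : ((Some @` escaping_endpoints a) `|` [set None] : set (riemann_sphere R)) None by right.
  by rewrite ES => -[?|?]; [exists false|exists true].
have [s1 s2] : separated (E (~~ b)) (E b) by case: (b) => //=; rewrite separatedC.
have EE z : E (~~ b) z \/ E b z -> ((Some @` escaping_endpoints a) `|` [set None]) z.
  by rewrite ES; case: (b) => -[]; [left|right|right|left].
have EE' z : ((Some @` escaping_endpoints a) `|` [set None]) z -> E (~~ b) z \/ E b z.
  by rewrite ES; case: (b) => -[]; [left|right|right|left].
have nN : ~ E (~~ b) None.
  move=> h; have : (E (~~ b) `&` closure (E b)) None by split => //; exact: subset_closure.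
  by rewrite s2.
have away z (A : set (riemann_sphere R)) : ~ closure A z -> exists2 V, nbhs z V & forall w, V w -> ~ A w.
  move=> nc; apply: contrapT => nV; apply: nc => V zV; apply: contrapT => nAV; apply: nV.
  by exists V => // w Vw Aw; apply: nAV; exists w.
have [V [K [cK _] KV] VP] : exists2 V, nbhs (None : riemann_sphere R) V & forall w, V w -> ~ E (~~ b) w.
  apply: away => h; have : (closure (E (~~ b)) `&` E b) None by [].
  by rewrite s1.
have [B BP] := compact_bound cK.
have [[z0|] // Pz0] := E0 (~~ b).
have near (z : cplane R) (A : set (riemann_sphere R)) : ~ closure A (Some z) ->
    exists2 r : R, 0 < r & forall w, dist1 w z < r -> ~ A (Some w).
  move=> /away[W /nbhs_dist1[r r0 rP] WA]; exists r => // w /rP; exact: WA.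
apply: (@separation_absurd R a (fun z => E (~~ b) (Some z)) (fun z => E b (Some z)) B z0) => //.
- move=> z; rewrite -epointP; split=> [ez|/EE[[w ? [<-]]//|//]].
  by apply: EE'; left; exists z.
- move=> z Pz; apply: BP; apply: contrapT => nK; apply: (VP (Some z)) => //.
  by apply: KV; left; exists z.
- move=> z Pz; apply: near => h; have : (E (~~ b) `&` closure (E b)) (Some z) by [].
  by rewrite s2.
- move=> z Qz; apply: near => h; have : (closure (E (~~ b)) `&` E b) (Some z) by [].
  by rewrite s1.
Qed.
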